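(* Let $d\ge 3$, let $p$ be a prime number, and let $$f\colon \mathbb{P}^2_{\overline{\mathbb{Q}}}\dashrightarrow\mathbb{P}^2_{\overline{\mathbb{Q}}},\qquad (x:y:z)\mapsto\Big(x^d-\tfrac{1}{p^{d-3}}y^2z^{d-2} : xy^2z^{d-3} : y^2z^{d-2}\Big).$$ (1) We have $d_1(f)=d$ and $d_2(f)=2$. In particular, the map $f$ is $1$-cohomologically hyperbolic. (2) Let $d=4$, $p=2$, and $P_0=\big(\tfrac{1+\sqrt3}{2}:\tfrac{1+\sqrt3}{2}:1\big)$. Then $f(P_0)=P_0$, $P_0\in(\mathbb{P}^2)_f^{\mathrm{back}}$, and there is a sequence of points $\{P_n\}_{n\ge1}$ of $(\mathbb{P}^2\setminus I_f)(\overline{\mathbb{Q}})$ such that $f(P_n)=P_{n-1}$ for $n\ge1$, $\{P_n\mid n\ge0\}$ is Zariski dense, and $\lim_{n\to\infty}h(P_n)=\infty$.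
   Context: $I_f$ is the indeterminacy locus of $f$; $h$ is the naive logarithmic height function on $\mathbb{P}^2(\overline{\mathbb{Q}})$. For a dominant rational map $f\colon X\dashrightarrow X$ on a projective variety over a field, let $\Gamma_f$ be its graph with projections $\pi\colon\Gamma_f\to X$ (to the source) and $g\colon\Gamma_f\to X$ (to the target, so $g=f\circ\pi$ as rational maps). We say $f$ is finite over an open subset $U\subset X$ if $g|_{g^{-1}(U)}\colon g^{-1}(U)\to U$ is finite and $g^{-1}(U)\cap\pi^{-1}(I_f)=\emptyset$. Define $X_f^{\mathrm{back}}$ as the set of $P\in X$ such that for every $n\ge1$ there is a Zariski open neighbourhood of $P$ over which $f^n$ is finite. Dynamical degrees: for a dominant rational self-map of a projective variety $X$ of dimension $N$ over an algebraically closed field and an ample divisor $H$, $d_i(f)=\lim_{n\to\infty}\big((f^n)^*H^i\cdot H^{N-i}\big)^{1/n}$, computed on the graph of $f^n$ (or a projective birational model dominating it). $f$ is $p$-cohomologically hyperbolic if $p$ is the unique element of $\{1,\dots,\dim X\}$ with $d_p(f)=\max\{d_i(f)\mid1\le i\le\dim X\}$. *)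

(* Defs.v *)
From HB Require Import structures.
From mathcomp Require Import all_boot all_order all_algebra all_field.
From mathcomp Require Import mpoly.
From mathcomp Require Import boolp classical_sets functions fsbigop reals.
From mathcomp Require Import topology normedtype sequences exp.

Set Implicit Arguments.
Unset Strict Implicit.
Unset Printing Implicit Defensive.

Import Order.TTheory GRing.Theory Num.Theory.
Import numFieldNormedType.Exports.

Local Open Scope classical_set_scope.
Local Open Scope ring_scope.

(* Classical varieties over the algebraically closed field algC (the algebraic
   numbers).  A space is a set of points with a graded family of forms: the
   zero loci of forms are its closed sets, and quotients of forms of equal
   degree are its local regular functions.  A variety is given by a subset of
   the points of a space, with the induced topology and regular functions. *)
Record space := Space {
  point :> Type;
  degree : Type;
  form : degree -> set (point -> algC) }.

Section Zariski.
Variable X : space.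

Definition is_form (phi : X -> algC) : Prop := exists d, form d phi.

Definition zeros (E : set (X -> algC)) : set X :=
  [set x | forall phi, E phi -> phi x = 0].

Definition zclosed (C : set X) : Prop :=
  exists E : set (X -> algC), E `<=` is_form /\ C = zeros E.

Definition zopen (U : set X) : Prop := zclosed (~` U).

Definition zclosure (S : set X) : set X :=
  zeros [set phi | is_form phi /\ forall x, S x -> phi x = 0].

Definition zdense (S : set X) : Prop := zclosure S = setT.

Definition regular (S : set X) (phi : X -> algC) : Prop :=
  forall x, S x -> exists (d : degree X) (a b : X -> algC),
    [/\ form d a, form d b, b x != 0 &
        forall y, S y -> b y != 0 -> phi y = a y / b y].

(* Dimension of the degree d part of the homogeneous coordinate ring of S
   (forms of degree d modulo those vanishing on S). *)
Definition coord_dim (S : set X) (d : degree X) (n : nat) : Prop :=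
  exists e : 'I_n -> X -> algC,
    [/\ forall k, form d (e k),
        forall c : 'I_n -> algC,
          (forall x, S x -> \sum_k c k * e k x = 0) -> forall k, c k = 0 &
        forall phi, form d phi -> exists c : 'I_n -> algC,
          forall x, S x -> phi x = \sum_k c k * e k x].

End Zariski.

Definition morphism (X Y : space) (S : set X) (T : set Y) (u : X -> Y) : Prop :=
  [/\ forall x, S x -> T (u x),
      forall C : set Y, zclosed C ->
        exists2 C' : set X, zclosed C' &
          S `&` u @^-1` C = S `&` C' &
      forall (O : set Y) (phi : Y -> algC), zopen O ->
        regular (T `&` O) phi -> regular (S `&` u @^-1` O) (phi \o u)].

Definition isomorphic (X Y : space) (S : set X) (T : set Y) : Prop :=
  exists (u : X -> Y) (v : Y -> X),
    [/\ morphism S T u, morphism T S v,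
        forall x, S x -> v (u x) = x & forall y, T y -> u (v y) = y].

Definition affine_space (n : nat) : space :=
  @Space ('I_n -> algC) unit
    (fun _ => [set phi | exists p : {mpoly algC[n]}, forall v, phi v = p.@[v]]).

Definition affine (X : space) (S : set X) : Prop :=
  exists (n : nat) (Z : set (affine_space n)), zclosed Z /\ isomorphic S Z.

(* T is covered by affine open subsets V whose preimage is affine, with
   coordinate ring a finitely generated module over that of V. *)
Definition finite_morphism (X Y : space) (S : set X) (T : set Y) (u : X -> Y)
    : Prop :=
  morphism S T u /\
  forall y, T y -> exists O : set Y,
    let V := T `&` O in
    let W := S `&` u @^-1` O in
    [/\ zopen O, O y, affine V, affine W &
        exists (m : nat) (e : 'I_m -> X -> algC),
          (forall k, regular W (e k)) /\
          forall phi, regular W phi -> exists b : 'I_m -> Y -> algC,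
            (forall k, regular V (b k)) /\
            forall x, W x -> phi x = \sum_k b k (u x) * e k x].

(* The points of the projective plane are the lines of algC^3.  Homogeneous
   polynomials are evaluated at an arbitrary spanning vector, coords P: their
   vanishing, and quotients in equal degrees, do not depend on this choice. *)
Definition P2point := {L : {vspace 'rV[algC]_3} | \dim L == 1%N}.

Definition coords (P : P2point) : 'rV[algC]_3 := vpick (val P).

Definition eval3 (p : {mpoly algC[3]}) (v : 'rV[algC]_3) : algC :=
  p.@[fun i => v 0 i].

Definition P2 : space :=
  @Space P2point nat
    (fun d => [set phi | exists2 p : {mpoly algC[3]}, p \is d.-homog &
                 forall P, phi P = eval3 p (coords P)]).

(* A bihomogeneous polynomial is a sum of products of homogeneous ones. *)
Definition prod_space (X Y : space) : space :=
  @Space (X * Y)%type (degree X * degree Y)%type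
    (fun d => [set phi | exists (m : nat)
         (u : 'I_m -> X -> algC) (v : 'I_m -> Y -> algC),
       [/\ forall k, form d.1 (u k), forall k, form d.2 (v k) &
           forall x y, phi (x, y) = \sum_k u k x * v k y]]).

Lemma row1_neq0 (a b : algC) :
  (\row_j [:: a; b; 1%R]`_j : 'rV[algC]_3) != 0.
Proof.
apply/eqP => /rowP /(_ (@Ordinal 3 2 isT)); rewrite !mxE /=.
by move/eqP; rewrite oner_eq0.
Qed.

(* The point (a : b : 1). *)
Definition affine_point (a b : algC) : P2point :=
  exist (fun L : {vspace 'rV[algC]_3} => \dim L == 1%N)
    <[\row_j [:: a; b; 1%R]`_j]>%VS
    (introT eqP (etrans (dim_vline _) (congr1 nat_of_bool (row1_neq0 a b)))).

(* Rational self-maps of P2 are represented by triples of forms of the same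
   degree, not all zero.  Common factors are allowed, since they appear when
   composing: the notions below only depend on the rational map. *)
Definition triple := 3.-tuple {mpoly algC[3]}.

Definition is_ratmap (F : triple) : Prop :=
  (exists d : nat, forall i, tnth F i \is d.-homog) /\
  exists i, tnth F i != 0.

Definition same_ratmap (F G : triple) : Prop :=
  forall i j, tnth F i * tnth G j = tnth F j * tnth G i.

Definition eval_triple (F : triple) (P : P2) : 'rV[algC]_3 :=
  \row_i eval3 (tnth F i) (coords P).

Definition maps_to (F : triple) (P Q : P2) : Prop :=
  exists G : triple,
    [/\ is_ratmap G, same_ratmap F G, eval_triple G P != 0 &
        eval_triple G P \in val Q].

Definition indet (F : triple) : set P2 :=
  [set P | ~ exists G : triple,
             [/\ is_ratmap G, same_ratmap F G & eval_triple G P != 0]].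

Definition dominant (F : triple) : Prop :=
  is_ratmap F /\ zdense [set Q : P2 | exists P, maps_to F P Q].

Definition comp_triple (F G : triple) : triple :=
  [tuple tnth F i \mPo G | i < 3].

Definition iterate (F : triple) (n : nat) : triple :=
  iter n (comp_triple F) [tuple 'X_i | i < 3].

(* The projections of the graph to the source and target are fst and snd. *)
Definition graph (F : triple) : set (prod_space P2 P2) :=
  @zclosure (prod_space P2 P2) [set x | maps_to F x.1 x.2].

Definition finite_over (F : triple) (U : set P2) : Prop :=
  let gU : set (prod_space P2 P2) := [set x | graph F x /\ U x.2] in
  @finite_morphism (prod_space P2 P2) P2 gU U snd /\
  forall x, gU x -> ~ indet F x.1.

Definition back (F : triple) : set P2 :=
  [set P | forall n, (0 < n)%N ->
     exists U : set P2, [/\ zopen U, U P & finite_over (iterate F n) U]].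

Section DynamicalDegrees.
Variable R : realType.

(* A polynomial chi with chi(a, b) = dim of the bidegree (a, b) part of the
   coordinate ring of S for a, b >> 0, that is, the Euler characteristic of
   O_S(a, b). *)
Definition hilbert_poly (S : set (prod_space P2 P2)) (chi : {poly {poly R}})
    : Prop :=
  exists N : nat, forall a b : nat, (N <= a)%N -> (N <= b)%N ->
    exists2 n : nat, @coord_dim (prod_space P2 P2) S (a, b) n &
                     chi.[a%:R, b%:R] = n%:R.

(* The intersection number (L . M) on a projective surface, in terms of Euler
   characteristics: chi(O) - chi(-L) - chi(-M) + chi(-L-M), which is the
   coefficient of st in the polynomial chi(sL + tM). *)
Definition intersection (chi : {poly {poly R}}) (L M : R * R) : R :=
  chi.[0, 0] - chi.[- L.1, - L.2] - chi.[- M.1, - M.2]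
  + chi.[- L.1 - M.1, - L.2 - M.2].

(* On the graph of f, with H a line of P2, the class of H pulled back from the
   source is O(1, 0) and f^* H, pulled back from the target, is O(0, 1). *)
Definition mixed_degree (F : triple) (i : nat) (u : R) : Prop :=
  let D j : R * R := if (j < i)%N then (0, 1) else (1, 0) in
  exists2 chi, hilbert_poly (graph F) chi & u = intersection chi (D 0) (D 1).

Definition dynamical_degree (F : triple) (i : nat) (l : R) : Prop :=
  dominant F /\
  exists2 u : nat -> R,
    (forall n, (0 < n)%N -> mixed_degree (iterate F n) i (u n)) &
    ((fun n : nat => u n `^ n%:R^-1) @ \oo --> l).

Definition coh_hyperbolic (F : triple) (q : nat) : Prop :=
  (1 <= q <= 2)%N /\
  exists2 delta : nat -> R,
    (forall i, (1 <= i <= 2)%N -> dynamical_degree F i (delta i)) &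
    forall j, (1 <= j <= 2)%N ->
      ((forall i, (1 <= i <= 2)%N -> delta i <= delta j) <-> j = q).

End DynamicalDegrees.

Section Height.
Variable R : realType.

Definition absval (w : algC -> R) : Prop :=
  [/\ forall x, 0 <= w x, forall x, w x = 0 <-> x = 0,
      forall x y, w (x * y) = w x * w y &
      forall x y, w (x + y) <= w x + w y].

Definition padic_abs (p : nat) (q : rat) : R :=
  if q == 0 then 0
  else p%:R ^+ logn p `|denq q|%N / p%:R ^+ logn p `|numq q|%N.

Definition usual_abs (q : rat) : R := ratr `|q|.

(* An extension to algC of the absolute value nu of rat. *)
Definition extend_abs (nu : rat -> R) : algC -> R :=
  xget (fun=> 0) [set w | absval w /\ forall q, w (ratr q) = nu q].

Definition embeddings (K : fieldExtType rat) : set (K -> algC) :=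
  [set s : K -> algC | exists g : {rmorphism K -> algC}, forall x, s x = g x].

Definition log_max (nu : rat -> R) (x : seq algC) : R :=
  ln (\big[Num.max/0]_(t <- x) extend_abs nu t).

(* 1/[K:Q] sum_(v in M_Q) sum_(s : K -> algC) log max_i |s(x_i)|_v, where |.|_v
   is extended to algC.  By the transitivity of Galois groups on places this
   does not depend on the extensions; as each place w | v of K is of the form
   |s(.)|_v for exactly [K_w : Q_v] embeddings s, it is the sum over the
   places w of K of [K_w:Q_v]/[K:Q] log max_i |x_i|_w. *)
Definition field_height (K : fieldExtType rat) (x : seq K) : R :=
  (\dim {:K})%:R^-1 *
  ((\sum_(s \in @embeddings K) log_max usual_abs (map s x)) +
   \sum_(p \in [set p : nat | prime p])
     \sum_(s \in @embeddings K) log_max (padic_abs p) (map s x)).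

(* The field is the one generated by the coordinates; the value does not
   depend on the number field containing them. *)
Definition height (P : P2) : R :=
  let: existT K (existT _ (exist2 x _ _)) :=
    num_field_exists [seq coords P 0 i | i : 'I_3] in
  field_height x.

End Height.

Definition fdp (d p : nat) : triple :=
  let x : {mpoly algC[3]} := 'X_(@Ordinal 3 0 isT) in
  let y : {mpoly algC[3]} := 'X_(@Ordinal 3 1 isT) in
  let z : {mpoly algC[3]} := 'X_(@Ordinal 3 2 isT) in
  [tuple x ^+ d - (p%:R ^- (d - 3) : algC) *: (y ^+ 2 * z ^+ (d - 2));
         x * y ^+ 2 * z ^+ (d - 3);
         y ^+ 2 * z ^+ (d - 2)].

(* Main.v *)
(* In the chart z = 1 the map is f(x, y) = (x^d / y^2 - c, x), so that its fibres
   have two points: (u, v) comes from (v, w) with w^2 (u + c) = v^d.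

   Dynamical degrees.  The coordinate ring of the graph of f^n in bidegree (a, b)
   is the span of the forms p * q(f^n).  Its Hilbert function is a polynomial for
   large a and b (Dickson's lemma), and bounding it in the two directions gives
   the mixed terms d^n and 2^n: the components of f^n have degree d^n and no common
   factor, and the function field has degree 2^n over its image.

   Finiteness.  Over the points whose backward orbits of length n avoid v = 0 and
   u + c = 0, the regular functions upstairs are b0 + y b1 at each step, with
   b0 and b1 regular downstairs.  All 2-adic sizes on the backward orbits of P_0
   are sqrt 2, whence P_0 is in the back locus.

   The sequence.  Start from t = (1 + sqrt 3) / 2 and take the preimages
   w_n = t, t, -t, t and then any square roots.  3-adically the logarithms of the
   sizes satisfy l_{n+1} = 2 l_n - l_{n-1} / 2 with positive initial growth, for
   every embedding of Q(w_{n-1}, w_n) and every extension of the absolute value,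
   and by the product formula the height is at least l_n.  By the irrationality of
   sqrt 2, the 3-adic sizes of distinct monomials w_{n-1}^i w_n^j are eventually
   distinct, so no form vanishes on the whole sequence. *)

From HB Require Import structures.
From mathcomp Require Import all_boot all_order all_algebra all_field.
From mathcomp Require Import mpoly.
From mathcomp Require Import boolp classical_sets functions fsbigop reals.
From mathcomp Require Import topology normedtype sequences exp.
From mathcomp Require Import zify ring lra.
Require Import Defs.

Set Implicit Arguments.
Unset Strict Implicit.
Unset Printing Implicit Defensive.

Import Order.TTheory GRing.Theory Num.Theory.
Import numFieldNormedType.Exports.

Local Open Scope classical_set_scope.
Local Open Scope ring_scope.

(** The graph is only a Zariski closure and may be singular, so its intersection numbers are read
    off from the quadratic part of the Hilbert polynomial. For fixed b, the forms of degree a + bD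
    bound the Hilbert function above and the space G_0^b S_a + G_2^b S_a bounds it below; this fixes
    the coefficient of ab. For fixed a, comparison with 2^n copies of the forms in the target
    variables fixes that of b^2. For finiteness, the closed graph could contain points over the two
    indeterminacy points; the iterated norms of [tower_polynomial] exclude them. The segment t, t,
    -t, t is chosen because t^2 = t + 1/2 makes t a 3-adic unit with (1/2 - t)^2 = 3/4: the division
    by u + 1/2 at u = -t creates the first size larger than 1. The prime 2 serves finiteness: |1/2|
    = 2 exceeds |u| = sqrt 2, so u + 1/2 never vanishes. The height uses extensions of absolute
    values picked by [xget], so their existence has to be proved at every place: by Dedekind cuts at
    infinity, and by a maximal subring without 1/p at a prime p. *)

Lemma poly_fun_eq0 (K : numDomainType) (p : {poly K}) :
  (forall x, p.[x] = 0) -> p = 0.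
Proof.
move=> p0; apply: (@roots_geq_poly_eq0 _ _ [seq n%:R | n <- iota 0 (size p)]).
- by apply/allP => x _; apply/rootP.
- by rewrite map_inj_uniq ?iota_uniq // => m n /eqP; rewrite eqr_nat => /eqP.
- by rewrite size_map size_iota.
Qed.

Section MpolyEval.
Variable K : numFieldType.

Lemma muni_eq0 n (p : {mpoly K[n.+1]}) : muni p = 0 -> p = 0.
Proof.
move=> p0; apply/mpolyP => m; rewrite mcoeff0.
have := congr1 (fun q : {poly {mpoly K[n]}} =>
  (q`_(m ord_max))@_[multinom m (widen_ord (leqnSn n) i) | i < n]) p0.
rewrite muniE coef0 mcoeff0 coef_sum raddf_sum /=.
have [mp|mp] := boolP (m \in msupp p); last by rewrite (memN_msupp_eq0 mp).
rewrite (bigD1_seq m) ?msupp_uniq //= coefZ coefXn eqxx mulr1 mcoeffZ mcoeffX.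
rewrite eqxx mulr1 big1 ?addr0 // => m' /eqP ne.
rewrite coefZ coefXn; case: eqP => [e|_]; last by rewrite mulr0 mcoeff0.
rewrite mulr1 mcoeffZ mcoeffX; case: eqP => [e'|_]; last by rewrite mulr0.
case: ne; apply/mnmP => i; have [j ->|->] := unliftP ord_max i => //.
move/mnmP/(_ j): e'; rewrite !mnmE.
by rewrite (_ : widen_ord _ j = lift ord_max j) //; apply/val_inj; rewrite /= /bump leqNgt ltn_ord.
Qed.

Lemma meval_muni n (p : {mpoly K[n.+1]}) (v : 'I_n -> K) (x : K) :
  (map_poly (meval v) (muni p)).[x] =
  p.@[fun i => if unlift ord_max i is Some j then v j else x].
Proof.
rewrite muniE rmorph_sum horner_sum mevalE; apply: eq_bigr => m _.
rewrite -mul_polyC !rmorphM /= !map_polyC /= map_polyXn !hornerE.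
rewrite mevalZ mevalX big_ord_recr /= unlift_none -mulrA; congr (_ * (_ * _)).
apply: eq_bigr => i _; rewrite mnmE.
rewrite (_ : widen_ord _ i = lift ord_max i) ?liftK //.
by apply/val_inj; rewrite /= /bump leqNgt ltn_ord.
Qed.

Lemma mpoly_fun_eq0 n (p : {mpoly K[n]}) : (forall v, p.@[v] = 0) -> p = 0.
Proof.
elim: n p => [|n IH] p p0.
  rewrite (nvar0_mpolyC p); have := p0 (fun=> 0); rewrite {1}(nvar0_mpolyC p).
  by rewrite mevalC => ->.
apply/muni_eq0/polyP => i; rewrite coef0; apply: IH => v.
have -> : ((muni p)`_i).@[v] = (map_poly (meval v) (muni p))`_i by rewrite coef_map.
rewrite (@poly_fun_eq0 _ (map_poly (meval v) (muni p))) ?coef0 // => x.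
by rewrite meval_muni.
Qed.

Lemma mpoly_fun_inj n (p q : {mpoly K[n]}) :
  (forall v, p.@[v] = q.@[v]) -> p = q.
Proof.
move=> pq; apply/eqP; rewrite -subr_eq0; apply/eqP/mpoly_fun_eq0 => v.
by rewrite mevalB pq subrr.
Qed.

Lemma meval_homog n d (p : {mpoly K[n]}) (v w : 'I_n -> K) (l : K) :
  p \is d.-homog -> (forall i, w i = l * v i) -> p.@[w] = l ^+ d * p.@[v].
Proof.
move=> hp wv; rewrite !mevalE mulr_sumr !big_seq; apply: eq_bigr => m mp.
rewrite mulrCA; congr (_ * _).
have <- : mdeg m = d by move/dhomogP: hp => /(_ _ mp).
rewrite mdegE -prodrXr -big_split /=.
by apply: eq_bigr => i _; rewrite wv exprMn.
Qed.

Lemma comp_homog n k d e (p : {mpoly K[n]}) (F : n.-tuple {mpoly K[k]}) :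
  p \is d.-homog -> (forall i, tnth F i \is e.-homog) ->
  p \mPo F \is (d * e)%N.-homog.
Proof.
move=> hp hF; rewrite comp_mpolyEX big_seq rpred_sum // => m mp.
have <- : mdeg m = d by move/dhomogP: hp => /(_ _ mp).
rewrite rpredZ // comp_mpolyX mdegE big_distrl /=.
elim/big_rec2: _ => [|i a b _ IH]; first exact: dhomog1.
by apply: dhomogM => //; rewrite mulnC; apply: dhomogMn.
Qed.

Lemma comp_mpolyM n k (p q : {mpoly K[n]}) (F : n.-tuple {mpoly K[k]}) :
  (p * q) \mPo F = (p \mPo F) * (q \mPo F).
Proof. exact: rmorphM. Qed.

Lemma comp_mpolyA n k l (p : {mpoly K[n]}) (F : n.-tuple {mpoly K[k]})
    (G : k.-tuple {mpoly K[l]}) :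
  (p \mPo F) \mPo G = p \mPo [tuple tnth F i \mPo G | i < n].
Proof.
apply: mpoly_fun_inj => v; rewrite !comp_mpoly_meval.
by apply: meval_eq => i; rewrite tnth_mktuple comp_mpoly_meval.
Qed.

End MpolyEval.

(** * Points of the plane, and forms on a graph *)

Notation i0 := (@Ordinal 3 0 isT).
Notation i1 := (@Ordinal 3 1 isT).
Notation i2 := (@Ordinal 3 2 isT).

Lemma ord3P (P : 'I_3 -> Prop) : P i0 -> P i1 -> P i2 -> forall i, P i.
Proof.
move=> P0 P1 P2 [[|[|[|//]]] h]; rewrite (bool_irrelevance h isT) //.
Qed.

Definition vec (x y z : algC) : 'rV[algC]_3 := \row_i [:: x; y; z]`_i.

Lemma vecE (v : 'rV[algC]_3) : v = vec (v 0 i0) (v 0 i1) (v 0 i2).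
Proof. by apply/rowP; elim/ord3P; rewrite mxE. Qed.

Lemma scale_vec l x y z : l *: vec x y z = vec (l * x) (l * y) (l * z).
Proof. by apply/rowP; elim/ord3P; rewrite !mxE. Qed.

Lemma vec_inj x y z x' y' z' :
  vec x y z = vec x' y' z' -> [/\ x = x', y = y' & z = z'].
Proof.
by move/rowP=> h; split; [have := h i0|have := h i1|have := h i2]; rewrite !mxE.
Qed.

Lemma vec_eq0 x y z : (vec x y z == 0) = [&& x == 0, y == 0 & z == 0].
Proof.
apply/eqP/and3P => [/rowP h|[/eqP-> /eqP-> /eqP->]].
  by split; apply/eqP; [have := h i0|have := h i1|have := h i2]; rewrite !mxE.
by apply/rowP; elim/ord3P; rewrite !mxE.
Qed.

Lemma affine_vec_neq0 x y : vec x y 1 != 0.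
Proof. by rewrite vec_eq0 oner_eq0 !andbF. Qed.

Lemma coords_neq0 (P : P2point) : coords P != 0.
Proof. by rewrite vpick0 -dimv_eq0 (eqP (valP P)). Qed.

Lemma val_coords (P : P2point) : val P = <[coords P]>%VS.
Proof.
apply/esym/eqP; rewrite eqEdim -memvE memv_pick /= (eqP (valP P)).
by rewrite dim_vline coords_neq0.
Qed.

Definition P2of (v : 'rV[algC]_3) (hv : v != 0) : P2point :=
  exist (fun L : {vspace 'rV[algC]_3} => \dim L == 1%N) <[v]>%VS
    (introT eqP (etrans (dim_vline _) (congr1 nat_of_bool hv))).

(** [coords] is a choice of spanning vector, so the point built from v gives v back only up to a
    factor. Later computations carry such factors and cancel them by homogeneity. *)
Lemma coords_P2of v (hv : v != 0) : exists2 l, l != 0 & coords (P2of hv) = l *: v.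
Proof.
have : coords (P2of hv) \in <[v]>%VS by apply: memv_pick.
case/vlineP => l e; exists l => //; apply/eqP => l0.
by have := coords_neq0 (P2of hv); rewrite e l0 scale0r eqxx.
Qed.

Lemma P2point_eq (P Q : P2point) l : coords P = l *: coords Q -> P = Q.
Proof.
move=> e; apply/val_inj/eqP; rewrite eqEdim (eqP (valP P)) (eqP (valP Q)) /= leqnn.
by rewrite andbT val_coords -memvE e memvZ // memv_pick.
Qed.

Lemma P2of_eq v (hv : v != 0) (P : P2point) l :
  coords P = l *: v -> P = P2of hv.
Proof.
have [m m0 e] := coords_P2of hv => h; apply: (@P2point_eq _ _ (l / m)).
by rewrite h e scalerA divfK.
Qed.

Lemma affine_pointE a b : affine_point a b = P2of (affine_vec_neq0 a b).
Proof. exact/val_inj. Qed.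

Lemma coords_affine a b :
  exists2 l, l != 0 & coords (affine_point a b) = l *: vec a b 1.
Proof. by rewrite affine_pointE; apply: coords_P2of. Qed.

Lemma affine_pointP (P : P2point) : coords P 0 i2 != 0 ->
  P = affine_point (coords P 0 i0 / coords P 0 i2) (coords P 0 i1 / coords P 0 i2).
Proof.
move=> z0; rewrite affine_pointE; apply: (@P2of_eq _ _ _ (coords P 0 i2)).
by rewrite {1}[coords P]vecE scale_vec mulr1 !(mulrC (coords P 0 i2)) !divfK.
Qed.

Lemma affine_point_inj a b a' b' :
  affine_point a b = affine_point a' b' -> a = a' /\ b = b'.
Proof.
move=> e; have [l l0 h] := coords_affine a b; have [m m0] := coords_affine a' b'.
rewrite -e h !scale_vec => /vec_inj [].
by rewrite !mulr1 => + + ml; rewrite ml; split; apply: (mulfI m0).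
Qed.

Lemma eval3Z d p v l : p \is d.-homog -> eval3 p (l *: v) = l ^+ d * eval3 p v.
Proof. by move=> hp; apply: meval_homog => // i; rewrite mxE. Qed.

Lemma eval3_comp p (F : triple) v :
  eval3 (p \mPo F) v = eval3 p (\row_i eval3 (tnth F i) v).
Proof. by rewrite /eval3 comp_mpoly_meval; apply: meval_eq => i; rewrite mxE. Qed.

Lemma eval3_fun_eq0 p : (forall v, eval3 p v = 0) -> p = 0.
Proof.
move=> p0; apply: mpoly_fun_eq0 => v; rewrite -[RHS](p0 (\row_i v i)).
by apply: meval_eq => i; rewrite mxE.
Qed.

(** The product p b z vanishes at every vector: where b and z do not vanish, rescaling to z = 1
    reduces to the hypothesis. Identities between forms can thus be checked on a dense open part of
    the chart. *)
Lemma homog_chart_eq0 d (p b : {mpoly algC[3]}) : p \is d.-homog -> b != 0 ->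
  (forall v : 'rV[algC]_3, v 0 i2 = 1 -> eval3 b v != 0 -> eval3 p v = 0) ->
  (exists e, b \is e.-homog) -> p = 0.
Proof.
move=> hp b0 h [e hb]; have : p * b * 'X_i2 = 0.
  apply: eval3_fun_eq0 => v; rewrite /eval3 !mevalM mevalXU.
  have [->|z0] := eqVneq (v 0 i2) 0; first by rewrite mulr0.
  have [b1|b1] := eqVneq (eval3 b ((v 0 i2)^-1 *: v)) 0.
    move: b1; rewrite (eval3Z _ _ hb) => /eqP; rewrite mulf_eq0 expf_eq0 invr_eq0.
    by rewrite (negbTE z0) andbF /eval3 /= => /eqP->; rewrite mulr0 mul0r.
  have := h _ _ b1; rewrite mxE mulVf // => /(_ erefl).
  rewrite (eval3Z _ _ hp) => /eqP; rewrite mulf_eq0 expf_eq0 invr_eq0.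
  by rewrite (negbTE z0) andbF /eval3 /= => /eqP->; rewrite !mul0r.
move/eqP; rewrite !mulf_eq0 (negbTE b0) orbF => /orP[/eqP//|].
by rewrite -msupp_eq0 msuppX.
Qed.

Definition evalt (F : triple) (v : 'rV[algC]_3) : 'rV[algC]_3 :=
  \row_i eval3 (tnth F i) v.

Definition thomog (D : nat) (F : triple) : Prop :=
  forall i, tnth F i \is D.-homog.

Lemma eval_tripleE F (P : P2) : eval_triple F P = evalt F (coords P).
Proof. by []. Qed.

Lemma evaltZ D F v l : thomog D F -> evalt F (l *: v) = l ^+ D *: evalt F v.
Proof. by move=> hF; apply/rowP => i; rewrite !mxE (eval3Z _ _ (hF i)). Qed.

Lemma evalt_comp F G v : evalt (comp_triple F G) v = evalt F (evalt G v).
Proof. by apply/rowP => i; rewrite !mxE tnth_mktuple eval3_comp. Qed.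

Lemma same_ratmap_refl F : same_ratmap F F.
Proof. by move=> i j; rewrite mulrC. Qed.

Lemma maps_toP F P Q : is_ratmap F -> evalt F (coords P) != 0 ->
  (exists l, evalt F (coords P) = l *: coords Q) -> maps_to F P Q.
Proof.
move=> hF h0 [l e]; exists F; split => //; first exact: same_ratmap_refl.
by rewrite eval_tripleE e memvZ // memv_pick.
Qed.

Lemma not_indet F P : is_ratmap F -> evalt F (coords P) != 0 -> ~ indet F P.
Proof. by move=> hF h; apply; exists F; split => //; apply: same_ratmap_refl. Qed.

Lemma prod_formP a b (phi : prod_space P2 P2 -> algC) :
  @form (prod_space P2 P2) (a, b) phi <->
  exists (m : nat) (u v : 'I_m -> {mpoly algC[3]}),
    [/\ forall k, u k \is (a).-homog, forall k, v k \is b.-homog &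
        forall x y, phi (x, y) =
          \sum_k eval3 (u k) (coords x) * eval3 (v k) (coords y)].
Proof.
split=> [[m [u [v [hu hv e]]]]|[m [u [v [hu hv e]]]]].
  have /choice[u' hu'] : forall k, exists p : {mpoly algC[3]},
      p \is (a).-homog /\ forall P, u k P = eval3 p (coords P).
    by move=> k; have [p p1 p2] := hu k; exists p.
  have /choice[v' hv'] : forall k, exists p : {mpoly algC[3]},
      p \is b.-homog /\ forall P, v k P = eval3 p (coords P).
    by move=> k; have [p p1 p2] := hv k; exists p.
  exists m, u', v'; split=> [k|k|x y]; [by case: (hu' k)|by case: (hv' k)|].
  rewrite e; apply: eq_bigr => k _.
  by have [_ ->] := hu' k; have [_ ->] := hv' k.
exists m, (fun k P => eval3 (u k) (coords P)), (fun k P => eval3 (v k) (coords P)).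
by split=> // k; [exists (u k)|exists (v k)].
Qed.

Lemma zclosure_formP (X : space) (S : set X) phi : is_form phi ->
  (forall x, zclosure S x -> phi x = 0) <-> (forall x, S x -> phi x = 0).
Proof.
move=> hphi; split=> h x Sx; first by apply: h => psi [_ hpsi]; apply: hpsi.
by apply: Sx.
Qed.

Section GraphForms.
Variables (F : triple) (D : nat).
Hypotheses (hF : thomog D F) (rF : is_ratmap F).
Variables (m a b : nat) (u v : 'I_m -> {mpoly algC[3]}).
Hypotheses (hu : forall k, u k \is (a).-homog) (hv : forall k, v k \is b.-homog).

Let W (G : triple) := \sum_k u k * (v k \mPo G).

Let evalW G x : eval3 (W G) x = \sum_k eval3 (u k) x * eval3 (v k) (evalt G x).
Proof.
rewrite /W /eval3 raddf_sum; apply: eq_bigr => k _ /=.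
by rewrite mevalM -/(eval3 (v k \mPo G) x) eval3_comp.
Qed.

(* On the graph, the target point is proportional to [F] at the source point, so
   a form of bidegree [(a, b)] becomes a polynomial in the source variables. *)
Lemma graph_formP :
  (forall x, graph F x ->
     \sum_k eval3 (u k) (coords x.1) * eval3 (v k) (coords x.2) = 0) <->
  \sum_k u k * (v k \mPo F) = 0.
Proof.
pose phi (x : prod_space P2 P2) :=
  \sum_k eval3 (u k) (coords x.1) * eval3 (v k) (coords x.2).
have phiF : is_form phi.
  by exists (a, b); apply/prod_formP; exists m, u, v; split.
apply: (iff_trans (zclosure_formP _ phiF)); rewrite -/(W F).
have [_ [j Fj0]] := rF; split=> [h|W0 [P Q] /= [G [[[e hG] [i Gi0]] FG PG PQ]]].
  (* The factors F_j and x_0 restrict attention to vectors such that both the vector and its image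
     under F define points of the plane. *)
  have : W F * tnth F j * 'X_i0 = 0.
    apply: eval3_fun_eq0 => x; rewrite /eval3 !mevalM mevalXU.
    have [->|x0] := eqVneq (x 0 i0) 0; first by rewrite mulr0.
    have xN : x != 0 by apply: contra_neq x0 => ->; rewrite mxE.
    have [Fj|Fj] := eqVneq ((tnth F j).@[fun i => x 0 i]) 0.
      by rewrite Fj mulr0 mul0r.
    have Fx : evalt F x != 0.
      by apply: contra_neq Fj => /rowP/(_ j); rewrite !mxE.
    have [l l0 lE] := coords_P2of xN; have [r r0 rE] := coords_P2of Fx.
    have FPE : evalt F (coords (P2of xN)) = l ^+ D *: evalt F x.
      by rewrite lE (evaltZ _ _ hF).
    have mFP : maps_to F (P2of xN) (P2of Fx).
      apply: maps_toP => //; first by rewrite FPE scaler_eq0 expf_eq0 (negbTE l0) andbF.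
      by exists (l ^+ D / r); rewrite FPE rE scalerA divfK.
    have := h (P2of xN, P2of Fx) mFP; rewrite /phi /= => h0.
    have : eval3 (W F) x = 0.
      apply: (mulfI (expf_neq0 a l0)); apply: (mulfI (expf_neq0 b r0)).
      rewrite !mulr0 -[RHS]h0 evalW !mulr_sumr; apply: eq_bigr => k _.
      by rewrite lE rE (eval3Z _ _ (hu k)) (eval3Z _ _ (hv k)); ring.
    by rewrite /eval3 => ->; rewrite !mul0r.
  move/eqP; rewrite !mulf_eq0 (negbTE Fj0) orbF => /orP[/eqP//|].
  by rewrite -msupp_eq0 msuppX.
(* [G] represents the same map as [F]: proportionality gives F_j^b W(G) = G_j^b W(F), and F_j is not
   the zero form. *)
have WG : W G = 0.
  apply: (mulfI (expf_neq0 b Fj0)); rewrite mulr0.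
  transitivity (tnth G j ^+ b * W F); last by rewrite W0 mulr0.
  apply: mpoly_fun_inj => x.
  rewrite [RHS]mevalM [LHS]mevalM [in LHS]rmorphXn [in RHS]rmorphXn /=.
  pose y : 'rV[algC]_3 := \row_i x i.
  have evE p : p.@[x] = eval3 p y by apply: meval_eq => k; rewrite mxE.
  rewrite !evE !evalW !mulr_sumr; apply: eq_bigr => k _.
  rewrite mulrCA [RHS]mulrCA -!(eval3Z _ _ (hv k)); congr (_ * eval3 _ _).
  apply/rowP => t; rewrite !mxE -!evE -!mevalM; congr (meval _ _).
  by rewrite FG mulrC.
move: PQ; rewrite /= val_coords => /vlineP[l lE].
have l0 : l != 0 by apply: contra_neq PG; rewrite lE => ->; rewrite scale0r.
apply: (mulfI (expf_neq0 b l0)); rewrite mulr0 -[RHS](meval0 (fun i => coords P 0 i)).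
rewrite -WG -/(eval3 _ _) evalW /phi mulr_sumr; apply: eq_bigr => k _.
by rewrite -eval_tripleE lE (eval3Z _ _ (hv k)) mulrCA.
Qed.

End GraphForms.

(** * The map, its iterates, and the absence of common factors *)

Section Family.
Variables (d : nat) (c : algC).
Hypothesis (d3 : (3 <= d)%N).

(** An arbitrary constant c covers both parts of the theorem; for d = 4 and p = 2 it is 1/2. As for
    plane Henon maps, the old first coordinate becomes the second one. *)
Definition henon : triple :=
  [tuple 'X_i0 ^+ d - c *: ('X_i1 ^+ 2 * 'X_i2 ^+ (d - 2));
         'X_i0 * 'X_i1 ^+ 2 * 'X_i2 ^+ (d - 3);
         'X_i1 ^+ 2 * 'X_i2 ^+ (d - 2)].

Local Notation F := henon.

Lemma evalt_henon x y z : evalt F (vec x y z) =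
  vec (x ^+ d - c * (y ^+ 2 * z ^+ (d - 2))) (x * y ^+ 2 * z ^+ (d - 3))
      (y ^+ 2 * z ^+ (d - 2)).
Proof.
by apply/rowP; elim/ord3P; rewrite !mxE /eval3 (tnth_nth 0) /=
  ?(mevalB, mevalZ, mevalM, rmorphXn) /= !mevalXU !mxE.
Qed.

Lemma henon_homog : thomog d F.
Proof.
have X i : ('X_i : {mpoly algC[3]}) \is 1.-homog by rewrite dhomogX /= mdeg1.
have Xk i k : ('X_i ^+ k : {mpoly algC[3]}) \is k.-homog.
  by rewrite -{2}[k]mul1n dhomogMn.
have YZ : ('X_i1 ^+ 2 * 'X_i2 ^+ (d - 2) : {mpoly algC[3]}) \is d.-homog.
  by have := dhomogM (Xk i1 2%N) (Xk i2 (d - 2)%N); rewrite subnKC // ltnW.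
apply: ord3P; rewrite (tnth_nth 0) //=; first by rewrite rpredB ?rpredZ.
have := dhomogM (dhomogM (X i0) (Xk i1 2%N)) (Xk i2 (d - 3)%N).
by rewrite subnKC.
Qed.

Lemma iterateS n : iterate F n.+1 = comp_triple F (iterate F n).
Proof. by []. Qed.

Lemma iterateSr n : iterate F n.+1 = comp_triple (iterate F n) F.
Proof.
elim: n => [|n IH].
  apply: eq_from_tnth => i; transitivity (tnth F i).
    by rewrite tnth_mktuple comp_mpoly_id.
  by rewrite tnth_mktuple tnth_mktuple comp_mpolyXU -tnth_nth.
rewrite iterateS {1}IH iterateS; apply: eq_from_tnth => i.
by rewrite !tnth_mktuple comp_mpolyA.
Qed.

Lemma iterate_homog n : thomog (d ^ n) (iterate F n).
Proof.
elim: n => [|n IH] i; first by rewrite tnth_mktuple dhomogX /= mdeg1.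
by rewrite iterateS tnth_mktuple expnS; apply: comp_homog => //; apply: henon_homog.
Qed.

Lemma iterate0E i : tnth (iterate F 0) i = 'X_i.
Proof. by rewrite tnth_mktuple. Qed.

Lemma iterate_recl n (G := iterate F n) :
  [/\ tnth (iterate F n.+1) i0 = tnth G i0 ^+ d
         - c *: (tnth G i1 ^+ 2 * tnth G i2 ^+ (d - 2)),
      tnth (iterate F n.+1) i1 = tnth G i0 * tnth G i1 ^+ 2 * tnth G i2 ^+ (d - 3) &
      tnth (iterate F n.+1) i2 = tnth G i1 ^+ 2 * tnth G i2 ^+ (d - 2)].
Proof.
rewrite iterateS !tnth_mktuple !(tnth_nth 0) /= -/G.
rewrite comp_mpolyB comp_mpolyZ !rmorphM !rmorphXn /= !comp_mpolyXU.
by [].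
Qed.

(** Coprimality in terms of syzygies: every relation between A and B is a multiple of the trivial
    one. This is the kernel computed in [hilb_ge_coprime], and stability under products follows
    without factorizations. *)
Definition mcoprime (A B : {mpoly algC[3]}) : Prop :=
  forall p q, p * A = q * B -> exists r, p = r * B /\ q = r * A.

Lemma mcoprime_sym A B : mcoprime A B -> mcoprime B A.
Proof. by move=> h p q /esym/h[r [-> ->]]; exists r. Qed.

Lemma mcoprime1 A : mcoprime A 1.
Proof. by move=> p q; rewrite mulr1 => <-; exists p; rewrite mulr1. Qed.

Lemma mcoprimeM A B C : mcoprime A B -> mcoprime A C -> mcoprime A (B * C).
Proof.
move=> AB AC p q; rewrite mulrCA [p * A]mulrC mulrC [X in _ = X]mulrC => e.
have [|r [pE]] := AB p (q * C); first by rewrite e; ring.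
move=> /esym/AC[s [rE ->]]; exists s; split=> //.
by rewrite pE rE; ring.
Qed.

Lemma mcoprimeX A B k : mcoprime A B -> mcoprime A (B ^+ k).
Proof.
move=> AB; elim: k => [|k IH]; first by rewrite expr0; apply: mcoprime1.
by rewrite exprS; apply: mcoprimeM.
Qed.

Lemma mcoprimeDMl A B C : mcoprime A B -> mcoprime (A + C * B) B.
Proof.
move=> AB p q e; have [|r [pE h]] := AB p (q - p * C).
  by rewrite mulrBl -e; ring.
exists r; split=> //; have -> : q = (q - p * C) + p * C by ring.
by rewrite h pE; ring.
Qed.

Lemma mcoprimeZ A B k : k != 0 -> mcoprime A B -> mcoprime A (k *: B).
Proof.
move=> k0 AB p q e; have [|r [-> h]] := AB p (k *: q).
  by rewrite e -scalerAr scalerAl.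
exists (k^-1 *: r); rewrite -scalerAl -scalerAr scalerA mulVf // scale1r; split=> //.
by apply: (scalerI k0); rewrite h scalerAl scalerA mulfV // scale1r.
Qed.

(** Since p X_i is a multiple of X_j, every monomial of p contains X_j; removing it gives the
    quotient r. *)
Lemma mcoprimeXX (i j : 'I_3) : i != j -> mcoprime 'X_i 'X_j.
Proof.
move=> ij p q e; pose r := \sum_(m <- msupp p) p@_m *: 'X_[m - U_(j)].
have pE : p = r * 'X_j.
  rewrite {1}[p]mpolyE /r mulr_suml !big_seq; apply: eq_bigr => m mp.
  rewrite -scalerAl -mpolyXD submK // lep1mP.
  have : (m + U_(i))%MM \in msupp (p * 'X_i).
    by rewrite mcoeff_msupp addmC mcoeffMX -mcoeff_msupp.
  rewrite e (perm_mem (msuppMX _ _)) => /mapP[m' _ /mnmP/(_ j)].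
  by rewrite !mnmDE !mnm1E (negbTE ij) eqxx addn0 => ->; rewrite add1n.
exists r; split=> //; apply: (@mulIf _ ('X_j : {mpoly algC[3]})).
  by rewrite -msupp_eq0 msuppX.
by rewrite -e pE; ring.
Qed.

Lemma henon_preimage u w y : y ^+ 2 * (u + c) = w ^+ d ->
  evalt F (vec w y 1) = y ^+ 2 *: vec u w 1.
Proof.
move=> e; rewrite evalt_henon scale_vec !expr1n !mulr1; congr vec; last exact: mulrC.
by rewrite -e; ring.
Qed.

(** Dominance in algebraic form. A point (u, v) of the chart with v (u + c) nonzero has a preimage,
    given by a square root of v^d / (u + c), so q vanishes there. *)
Lemma comp_henon_eq0 b q : q \is b.-homog -> q \mPo F = 0 -> q = 0.
Proof.
move=> hq qF; pose g : {mpoly algC[3]} := 'X_i1 * ('X_i0 + c *: 'X_i2).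
have X i : ('X_i : {mpoly algC[3]}) \is 1.-homog by rewrite dhomogX /= mdeg1.
have gE v : eval3 g v = v 0 i1 * (v 0 i0 + c * v 0 i2).
  by rewrite /eval3 mevalM mevalD mevalZ !mevalXU.
apply: (@homog_chart_eq0 b _ g) => //.
(* At (1 - c, 1, 1) the form g takes the value 1. *)
- apply/eqP => g0; have := gE (vec (1 - c) 1 1).
  by rewrite g0 /eval3 meval0 !mxE /= mulr1 subrK mul1r => /eqP; rewrite eq_sym oner_eq0.
- move=> v v2; rewrite gE v2 mulr1 mulf_eq0 negb_or => /andP[v1 v0].
  pose y := sqrtC (v 0 i1 ^+ d / (v 0 i0 + c)).
  have y2 : y ^+ 2 * (v 0 i0 + c) = v 0 i1 ^+ d by rewrite sqrtCK divfK.
  have y0 : y ^+ 2 != 0 by apply: contra_neq (expf_neq0 d v1) => h; rewrite -y2 h mul0r.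
  have := congr1 (eval3^~ (vec (v 0 i1) y 1)) qF.
  rewrite eval3_comp -/(evalt _ _) (henon_preimage y2) (eval3Z _ _ hq).
  have -> : vec (v 0 i0) (v 0 i1) 1 = v by rewrite [RHS]vecE v2.
  rewrite [in RHS]/eval3 meval0 => /eqP.
  by rewrite mulf_eq0 expf_eq0 (negbTE y0) andbF => /eqP.
by exists (1 + 1)%N; rewrite dhomogM ?rpredD ?rpredZ.
Qed.

Lemma comp_iterate_eq0 n b q : q \is b.-homog -> q \mPo iterate F n = 0 -> q = 0.
Proof.
elim: n b q => [|n IH] b q hq; first by rewrite comp_mpoly_id.
rewrite iterateS -comp_mpolyA => /(IH _ _ (comp_homog hq henon_homog)).
exact: comp_henon_eq0 hq.
Qed.

Lemma iterate_neq0 n i : tnth (iterate F n) i != 0.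
Proof.
apply/eqP => h; have : 'X_i \mPo iterate F n = 0 by rewrite comp_mpolyXU -tnth_nth.
move/(@comp_iterate_eq0 n 1); rewrite dhomogX /= mdeg1 => /(_ isT)/eqP.
by rewrite -msupp_eq0 msuppX.
Qed.

Lemma iterate_ratmap n : is_ratmap (iterate F n).
Proof.
split; first by exists (d ^ n)%N; apply: iterate_homog.
by exists i0; apply: iterate_neq0.
Qed.

(** If A, B, C are the components, the next ones are A^d - c B^2 C^(d-2), A B^2 C^(d-3) and B^2
    C^(d-2). Modulo B or C the first is A^d; modulo A it is -c B^2 C^(d-2), and here c must be
    nonzero. *)
Lemma iterate_coprime n (G := iterate F n) : c != 0 ->
  mcoprime (tnth G i0) (tnth G i1) /\ mcoprime (tnth G i0) (tnth G i2).
Proof.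
move=> c0; rewrite {}/G; elim: n => [|n [co1 co2]].
  by rewrite !iterate0E; split; apply: mcoprimeXX.
have [-> -> ->] := iterate_recl n; set A := tnth _ i0 in co1 co2 *.
set B := tnth _ i1 in co1 *; set C := tnth _ i2 in co2 *.
have coA X : mcoprime A X -> mcoprime (A ^+ d) X.
  by move=> h; apply/mcoprime_sym/mcoprimeX/mcoprime_sym.
have co : mcoprime A (B ^+ 2 * C ^+ (d - 2)).
  by apply: mcoprimeM; apply: mcoprimeX.
split; last first.
  rewrite -[- _]scaleNr -mul_mpolyC.
  exact/mcoprimeDMl/coA.
apply: mcoprimeM; first apply: mcoprimeM.
- have -> : A ^+ d = A ^+ d.-1 * A by rewrite -exprSr prednK // (leq_trans _ d3).
  rewrite addrC; apply: mcoprimeDMl; rewrite -scaleNr; apply: mcoprime_sym.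
  by apply: mcoprimeZ; rewrite ?oppr_eq0.
- have -> : - (c *: (B ^+ 2 * C ^+ (d - 2))) = - (c *: (B * C ^+ (d - 2))) * B.
    by rewrite mulNr -scalerAl; congr (- (_ *: _)); ring.
  by apply: mcoprimeX; apply: mcoprimeDMl; apply: coA.
have -> : - (c *: (B ^+ 2 * C ^+ (d - 2))) = - (c *: (B ^+ 2 * C ^+ (d - 3))) * C.
  rewrite mulNr -scalerAl -[in RHS]mulrA; congr (- (_ *: (_ * _))).
  by rewrite -exprSr; congr (_ ^+ _); move: d3; lia.
by apply: mcoprimeX; apply: mcoprimeDMl; apply: coA.
Qed.

End Family.

(** * Counting monomials outside an up-closed set *)

Section Dickson.

Definition len (n : nat) (f g : nat -> nat) : Prop := forall i, (i < n)%N -> (f i <= g i)%N.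

Let upd (n : nat) (f : nat -> nat) (k : nat) := fun i => if i == n then k else f i.

(** Induction on the number of coordinates, slicing by the last one. The slices grow with k, and the
    finitely many generators of their union all lie in some slice K; the generators of the slices 0
    to K then suffice. *)
Lemma dickson n (U : set (nat -> nat)) :
  (forall f g, U f -> len n f g -> U g) ->
  exists L : seq (nat -> nat), forall f, U f <-> exists2 g, List.In g L & len n g f.
Proof.
elim: n U => [|n IH] U up.
  have [[f Uf]|U0] := pselect (exists f, U f).
    exists [:: f] => g; split=> [_|_]; last exact: up Uf _.
    by exists f => //; left.
  exists [::] => f; split=> [Uf|[]//]; by case: U0; exists f.
pose Uk k := [set f | U (upd n f k)].
have len_upd f g k l : len n f g -> (k <= l)%N -> len n.+1 (upd n f k) (upd n g l).
  move=> fg kl i; rewrite ltnS leq_eqVlt /upd; case: eqP => [//|_ /= ilt]; exact: fg.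
have upk k : forall f g, Uk k f -> len n f g -> Uk k g.
  by move=> f g Uf fg; apply: up Uf _; apply: len_upd.
have [L' hL'] := IH [set f | exists k, Uk k f] (fun f g '(ex_intro k Uf) fg =>
  ex_intro _ k (upk k f g Uf fg)).
have [K hK] : exists K, forall g, List.In g L' -> Uk K g.
  have : forall g, List.In g L' -> exists k, Uk k g.
    by move=> g gL; apply/hL'; exists g => //; move=> i.
  elim: {hL'}L' => [|g L' IHL] h; first by exists 0%N.
  have [k gk] := h g (or_introl erefl).
  have [|K hK] := IHL; first by move=> g' g'L; apply: h; right.
  exists (maxn k K) => g' [<-|/hK g'K]; [apply: up gk _|apply: up g'K _];
    by apply: len_upd; rewrite ?leq_maxl ?leq_maxr.
have /choice[Ls hLs] : forall k, exists L, forall f, Uk k f <-> exists2 g, List.In g L & len n g f.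
  by move=> k; apply: IH; apply: upk.
pose L := flatten [seq [seq upd n g k | g <- Ls k] | k <- iota 0 K.+1].
have inL h : List.In h L <-> exists k g, [/\ (k <= K)%N, List.In g (Ls k) & h = upd n g k].
  rewrite /L; move: (iota 0 K.+1) (mem_iota 0 K.+1) => s hs.
  have -> : (exists k g, [/\ (k <= K)%N, List.In g (Ls k) & h = upd n g k]) <->
            (exists k g, [/\ k \in s, List.In g (Ls k) & h = upd n g k]).
    by split=> -[k [g [a b e]]]; exists k, g; split=> //; move: a; rewrite hs.
  elim: s {hs} => [|k s IHs] /=; first by split=> // -[k [g []]].
  rewrite List.in_app_iff IHs List.in_map_iff; split.
    move=> [[g [<- gk]]|[k' [g [k's gk' ->]]]]; first by exists k, g; rewrite mem_head.
    by exists k', g; rewrite inE k's orbT.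
  move=> [k' [g []]]; rewrite inE => /orP[/eqP->|k's] gk ->; first by left; exists g.
  by right; exists k', g.
exists L => f; split=> [Uf|[h /inL[k [g [kK gk ->]]] hf]].
  have Ufn : Uk (f n) f.
    by apply: up Uf _ => i _; rewrite /upd; case: eqP => [->|].
  have [fK|Kf] := leqP (f n) K.
    have /hLs[g gL gf] := Ufn; exists (upd n g (f n)); first by apply/inL; exists (f n), g.
    by move=> i; rewrite ltnS leq_eqVlt /upd; case: eqP => [->//|_]; apply: gf.
  have /hL'[g gL' gf] : [set f | exists k, Uk k f] f by exists (f n).
  have /hLs[g' g'L g'g] := hK _ gL'; exists (upd n g' K); first by apply/inL; exists K, g'.
  move=> i; rewrite ltnS leq_eqVlt /upd; case: eqP => [-> _|_ /= ilt]; first exact: ltnW.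
  by apply: leq_trans (gf _ ilt); apply: g'g.
have : Uk k g by apply/hLs; exists g.
by move=> Ug; apply: up Ug hf.
Qed.

End Dickson.

Definition monom2 := ('X_{1..3} *l 'X_{1..3})%type.

Definition le2 (m m' : monom2) : bool := (m.1 <= m'.1)%MM && (m.2 <= m'.2)%MM.
Definition add2 (m m' : monom2) : monom2 := ((m.1 + m'.1)%MM, (m.2 + m'.2)%MM).
Definition sub2 (m m' : monom2) : monom2 := ((m.1 - m'.1)%MM, (m.2 - m'.2)%MM).

Definition monoms (a : nat) : seq 'X_{1..3} :=
  [seq s2m (val t) | t <- enum (mpoly.basis 3 a)].

Definition monoms2 (a b : nat) : seq monom2 :=
  [seq ((x, y) : monom2) | x <- monoms a, y <- monoms b].

Lemma mem_monoms a m : (m \in monoms a) = (mdeg m == a).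
Proof. by rewrite (basis_cover a m). Qed.

Lemma mem_monoms2 a b (m : monom2) :
  (m \in monoms2 a b) = (mdeg m.1 == a) && (mdeg m.2 == b).
Proof.
case: m => x y; rewrite -!mem_monoms; apply/allpairsP/andP => [[[x' y'] /= [hx hy [-> ->]]]|[hx hy]] //.
by exists (x, y).
Qed.

Lemma uniq_monoms2 a b : uniq (monoms2 a b).
Proof. by apply: allpairs_uniq; rewrite ?uniq_basis // => -[? ?] [? ?] _ _ []-> ->. Qed.

Lemma size_monoms2 a b : size (monoms2 a b) = ('C(a + 2, 2) * 'C(b + 2, 2))%N.
Proof.
rewrite size_allpairs !size_basis; congr (_ * _)%N; rewrite -[RHS]bin_sub ?leq_addl //.
  by rewrite addnK.
by rewrite addnK.
Qed.

Lemma add2K m m' : sub2 (add2 m m') m = m'.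
Proof.
by case: m m' => x y [x' y']; rewrite /add2 /sub2 /= !(addmC x) !(addmC y) !addmK.
Qed.

Lemma sub2K m m' : le2 m m' -> add2 m (sub2 m' m) = m'.
Proof.
case: m m' => x y [x' y'] /andP[/= hx hy].
by rewrite /add2 /sub2 /= addmC submK // addmC submK.
Qed.

Lemma le2_add m m' : le2 m (add2 m m').
Proof. by apply/andP; split; apply/mnm_lepP => i; rewrite mnmDE leq_addr. Qed.

Lemma le2_sub g m k : le2 g (add2 m k) = le2 (sub2 g m) k.
Proof.
rewrite /le2; congr andb; apply/mnm_lepP/mnm_lepP => h i; have := h i;
  by rewrite mnmDE mnmBE leq_subLR.
Qed.

Definition avoid (L : seq monom2) (m : monom2) : bool := all (fun g => ~~ le2 g m) L.

Lemma count_multiples (g : monom2) (P : pred monom2) a b :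
  (mdeg g.1 <= a)%N -> (mdeg g.2 <= b)%N ->
  count (fun m => le2 g m && P m) (monoms2 a b) =
  count (fun k => P (add2 g k)) (monoms2 (a - mdeg g.1) (b - mdeg g.2)).
Proof.
move=> ga gb; rewrite -!size_filter -[RHS](size_map (add2 g)).
apply/perm_size/uniq_perm; first by rewrite filter_uniq ?uniq_monoms2.
  rewrite map_inj_in_uniq ?filter_uniq ?uniq_monoms2 // => x y _ _ e.
  by rewrite -[x](add2K g) e add2K.
move=> m; rewrite mem_filter mem_monoms2; apply/idP/mapP.
  move=> /andP[/andP[gm Pm] /andP[/eqP ma /eqP mb]]; exists (sub2 m g); last by rewrite sub2K.
  rewrite mem_filter sub2K // Pm mem_monoms2.
  have e1 : mdeg m.1 = (mdeg g.1 + mdeg (sub2 m g).1)%N by rewrite -{1}(sub2K gm) mdegD.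
  have e2 : mdeg m.2 = (mdeg g.2 + mdeg (sub2 m g).2)%N by rewrite -{1}(sub2K gm) mdegD.
  by rewrite -ma -mb e1 e2 !addKn !eqxx.
move=> [k]; rewrite mem_filter mem_monoms2 => /andP[Pk /andP[/eqP ka /eqP kb]] ->.
by rewrite le2_add Pk /= !mdegD ka kb !subnKC // !eqxx.
Qed.

Section EventuallyPolynomial.
Variable R : realType.

Definition evpoly (H : nat -> nat -> R) : Prop :=
  exists (chi : {poly {poly R}}) (N : nat), forall a b : nat,
    (N <= a)%N -> (N <= b)%N -> chi.[a%:R, b%:R] = H a b.

Lemma evpolyB H H' : evpoly H -> evpoly H' -> evpoly (fun a b => H a b - H' a b).
Proof.
move=> [p [N hp]] [q [N' hq]]; exists (p - q), (maxn N N') => a b.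
by rewrite !geq_max => /andP[? ?] /andP[? ?]; rewrite !hornerE hp ?hq.
Qed.

Lemma evpoly_shift H i j : evpoly H -> evpoly (fun a b => H (a - i)%N (b - j)%N).
Proof.
move=> [p [N hp]].
exists (map_poly (comp_poly ('X - j%:R%:P)) p \Po ('X - i%:R%:P%:P)), (N + i + j)%N => a b ha hb.
have h1 : (N <= a - i)%N by lia.
have h2 : (N <= b - j)%N by lia.
have <- := hp _ _ h1 h2; rewrite horner_comp !hornerE.
have -> : (a%:R%:P - i%:R%:P : {poly R}) = (a - i)%:R%:P \Po ('X - j%:R%:P).
  by rewrite comp_polyC natrB ?polyCB //; lia.
by rewrite horner_map /= horner_comp !hornerE [(b - j)%:R]natrB //; lia.
Qed.

Lemma evpoly_ext N H H' : (forall a b, (N <= a)%N -> (N <= b)%N -> H a b = H' a b) ->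
  evpoly H -> evpoly H'.
Proof.
move=> e [p [N' hp]]; exists p, (maxn N N') => a b.
by rewrite !geq_max => /andP[? ?] /andP[? ?]; rewrite hp ?e.
Qed.

Lemma natr_bin2 (a : nat) : ('C(a + 2, 2))%:R = ((a%:R + 2) * (a%:R + 1) / 2 : R).
Proof.
have h : ('C(a + 2, 2) * 2 = (a + 2) * (a + 1))%N.
  by rewrite mulnC -(mul_bin_diag (a + 2) 1) bin1 addn2 addn1.
have two0 : (2 : R) != 0 by rewrite pnatr_eq0.
by apply: (mulIf two0); rewrite divfK // -natrM h natrM !natrD.
Qed.

Lemma evpoly_size : evpoly (fun a b => (size (monoms2 a b))%:R).
Proof.
pose q : {poly R} := (2^-1)%:P * (('X + 2%:P) * ('X + 1%:P)).
have qE (x : nat) : q.[x%:R] = 'C(x + 2, 2)%:R.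
  by rewrite natr_bin2 !(hornerM, hornerD, hornerC, hornerX) mulrC.
exists (map_poly polyC q * q%:P), 0%N => a b _ _.
by rewrite size_monoms2 natrM -!qE hornerM hornerC horner_map /= hornerM hornerC.
Qed.

(** A further generator g removes the multiples of g that avoid L. Divided by g, these are the
    monomials avoiding the quotients of the members of L by g, counted in shifted degrees. *)
Lemma evpoly_avoid L : evpoly (fun a b => (count (avoid L) (monoms2 a b))%:R).
Proof.
(* One recursive call is on the list of truncated quotients, which is not a tail of L; hence
   induction on a bound for the length. *)
move: {2}(size L) (leqnn (size L)) => n; elim: n L => [|n IH] [|g L] //= hL.
- by apply: (@evpoly_ext 0) evpoly_size => a b _ _; rewrite count_predT.
- by apply: (@evpoly_ext 0) evpoly_size => a b _ _; rewrite count_predT.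
have hL' : (size [seq sub2 g' g | g' <- L] <= n)%N by rewrite size_map.
have := evpolyB (IH _ hL) (evpoly_shift (mdeg g.1) (mdeg g.2) (IH _ hL')).
apply: (@evpoly_ext (mdeg g.1 + mdeg g.2)) => a b ha hb.
have -> : count (avoid L) (monoms2 a b) =
    (count (avoid (g :: L)) (monoms2 a b) + count (fun m => le2 g m && avoid L m) (monoms2 a b))%N.
  elim: (monoms2 a b) => //= m s ->; rewrite addnACA; congr (_ + _)%N.
  by case: (le2 g m); rewrite /= ?addn0 ?add0n.
have ha' : (mdeg g.1 <= a)%N by lia.
have hb' : (mdeg g.2 <= b)%N by lia.
rewrite (count_multiples _ ha' hb').
rewrite natrD (@eq_count _ (fun k => avoid L (add2 g k)) (avoid [seq sub2 g' g | g' <- L])) ?addrK //.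
move=> k; rewrite /avoid all_map; apply: eq_all => g' /=; by rewrite le2_sub.
Qed.

Lemma evpoly_upset (U : set monom2) :
  (forall m k, U m -> U (add2 m k)) ->
  evpoly (fun a b => (count (fun m => `[< ~ U m >]) (monoms2 a b))%:R).
Proof.
(* The two exponent triples are the first and the last three of six coordinates, to which [dickson]
   applies. *)
move=> up; pose mk (f : nat -> nat) : monom2 :=
  ([multinom f (val i) | i < 3], [multinom f (3 + val i)%N | i < 3]).
pose fn (m : monom2) i := if (i < 3)%N then m.1 (inord i) else m.2 (inord (i - 3)).
have mkfn m : mk (fn m) = m.
  case: m => x y; rewrite /mk /fn; congr pair; apply/mnmP => i; rewrite mnmE /=.
    by rewrite ltn_ord inord_val.
  by rewrite addKn inord_val.
have lenP f g : len 6 f g <-> le2 (mk f) (mk g).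
  split=> [h|/andP[/mnm_lepP h1 /mnm_lepP h2] i i6].
    apply/andP; split; apply/mnm_lepP => i; rewrite !mnmE; apply: h; case: i => i /=; lia.
  have [i3|i3] := ltnP i 3; first by have := h1 (Ordinal i3); rewrite !mnmE.
  have i3' : (i - 3 < 3)%N by lia.
  by have := h2 (Ordinal i3'); rewrite !mnmE /= subnKC.
have [L hL] : exists L, forall f, U (mk f) <-> exists2 g, List.In g L & len 6 g f.
  apply: (@dickson 6 [set f | U (mk f)]) => f g Uf /lenP fg /=.
  by rewrite -(sub2K fg); apply: up.
apply: (@evpoly_ext 0) (evpoly_avoid [seq mk g | g <- L]) => a b _ _.
congr (_%:R); apply: eq_count => m; apply/idP/asboolP.
  move=> /allP h; rewrite -(mkfn m) => /hL[g gL /lenP]; rewrite mkfn; apply/negP/h.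
  elim: {hL h}L gL => //= g' L IH [->|/IH]; rewrite inE ?eqxx // => ->; exact: orbT.
move=> nU; apply/allP => h hL'; apply/negP => hm; apply: nU; rewrite -(sub2K hm).
apply: up; have [g gL ->] : exists2 g, List.In g L & h = mk g.
  elim: {hL}L hL' => //= g L IH; rewrite inE => /orP[/eqP->|/IH[g' g'L ->]].
    by exists g => //; left.
  by exists g' => //; right.
by apply/hL; exists g => // i.
Qed.

End EventuallyPolynomial.

(** * The Hilbert function of the graph *)

Section LinearAlgebra.
Variables (K : fieldType) (V : vectType K).

Lemma dim_add_line (U : {vspace V}) v : \dim (U + <[v]>) = (\dim U + (v \notin U))%N.
Proof.
have [vU|vU] /= := boolP (v \in U).
  by rewrite addn0; congr (\dim _); apply/addv_idPl; rewrite -memvE.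
rewrite dimv_disjoint_sum ?dim_vline; last first.
  apply/eqP; rewrite -subv0; apply/subvP => w; rewrite memv_cap => /andP[wU /vlineP[k wE]].
  rewrite memv0 wE; have [->|k0] := eqVneq k 0; first by rewrite scale0r.
  by case/negP: vU; rewrite -(scalerK k0 v) -wE memvZ.
by congr (_ + _)%N; case: eqP vU => // ->; rewrite mem0v.
Qed.

Lemma memv_spanP (T : eqType) (f : T -> V) (s : seq T) v : uniq s ->
  reflect (exists c : T -> K, v = \sum_(x <- s) c x *: f x) (v \in <<map f s>>%VS).
Proof.
move=> us; apply: (iffP idP) => [|[c ->]]; last first.
  by rewrite big_seq memv_suml // => x xs; rewrite memvZ // memv_span // map_f.
elim: s v us => [|x s IH] v /=.
  by rewrite span_nil memv0 => _ /eqP->; exists (fun=> 0); rewrite big_nil.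
move=> /andP[xs us]; rewrite span_cons => /memv_addP[_ /vlineP[k ->] [w /IH[//|c ->] ->]].
exists (fun y => if y == x then k else c y); rewrite big_cons eqxx; congr (_ + _).
rewrite !big_seq; apply: eq_bigr => y ys; case: eqP => // yx.
by rewrite -yx ys in xs.
Qed.

(** When the vectors are added in increasing order, the dimension grows exactly at those not spanned
    by smaller ones. These are the standard monomials of Groebner theory. *)
Lemma dim_span_sorted d (T : porderType d) (f : T -> V) (s : seq T) : sorted <%O s ->
  \dim <<map f s>> =
  count (fun x => f x \notin <<map f [seq y <- s | (y < x)%O]>>%VS) s.
Proof.
elim/last_ind: s => [|s x IH] hs; first by rewrite span_nil dimv0.
have sx : all (fun y => (y < x)%O) s.
  have : pairwise <%O (rcons s x) by rewrite -lt_sorted_pairwise.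
  by rewrite pairwise_rcons => /andP[].
have srt : sorted <%O s.
  by move: hs; rewrite !lt_sorted_pairwise pairwise_rcons => /andP[].
rewrite -cats1 map_cat span_cat span_seq1 dim_add_line IH // count_cat /= addn0.
congr (_ + _)%N; last first.
  rewrite filter_cat /= ltxx cats0; congr (nat_of_bool (_ \notin <<map f _>>%VS)).
  by apply/esym/all_filterP.
apply: eq_in_count => y ys; have yx : (y < x)%O by apply: (allP sx).
by rewrite filter_cat /= lt_gtF // cats0.
Qed.

End LinearAlgebra.

(** A total map into the finite-dimensional space of forms: the projection to degree e, which is the
    identity on forms of that degree. *)
Definition tohom (e : nat) (p : {mpoly algC[3]}) : dhomog 3 algC e :=
  DHomog (pihomogP mdeg e p).

Lemma val_tohom e p : p \is e.-homog -> val (tohom e p) = p.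
Proof. exact: pihomog_dE. Qed.

Lemma lin_hom (V : vectType algC) e (g : V -> {mpoly algC[3]}) :
  linear g -> (forall v, g v \is e.-homog) ->
  exists f : 'Hom(V, dhomog 3 algC e), forall v, val (f v) = g v.
Proof.
move=> lg hg; have lf : linear (fun v => tohom e (g v)).
  by move=> k u v; apply/val_inj; rewrite /= lg linearP.
pose L := GRing.isLinear.Build algC V (dhomog 3 algC e) _ (fun v => tohom e (g v)) lf.
pose f : {linear V -> dhomog 3 algC e} := HB.pack (fun v => tohom e (g v)) L.
by exists (linfun f) => v; rewrite lfunE /= pihomog_dE.
Qed.

Lemma val_dhomogZ e k (x : dhomog 3 algC e) : val (k *: x) = k *: val x.
Proof. by []. Qed.

Lemma val_dhomog_sum e (I : Type) (r : seq I) (F : I -> dhomog 3 algC e) :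
  val (\sum_(i <- r) F i) = \sum_(i <- r) val (F i).
Proof. exact: raddf_sum. Qed.

Lemma dim_dhomog e : \dim {: dhomog 3 algC e} = 'C(e + 2, 2).
Proof. by rewrite dimvf /dim /= -bin_sub ?leq_addr // addKn. Qed.

Section Hilbert.
Variables (G : triple) (D : nat).
Hypotheses (hG : thomog D G) (rG : is_ratmap G).

(** The restriction of a bihomogeneous monomial to the graph, with the components of [G] substituted
    for the target variables. *)
Definition mon (m : monom2) : {mpoly algC[3]} := 'X_[m.1] * ('X_[m.2] \mPo G).

Lemma mon_homog a b m : m \in monoms2 a b -> mon m \is (a + b * D)%N.-homog.
Proof.
rewrite mem_monoms2 => /andP[ma mb]; apply: dhomogM; first by rewrite dhomogX.
by apply: comp_homog => //; rewrite dhomogX.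
Qed.

Lemma monD m k : mon (add2 m k) = mon m * mon k.
Proof. by rewrite /mon /= !mpolyXD rmorphM /=; ring. Qed.

Definition monspan a b : {vspace dhomog 3 algC (a + b * D)} :=
  <<[seq tohom _ (mon m) | m <- monoms2 a b]>>.

Definition hilb a b := \dim (monspan a b).

Lemma monspanP a b (w : dhomog 3 algC (a + b * D)) :
  reflect (exists c : monom2 -> algC, val w = \sum_(m <- monoms2 a b) c m *: mon m)
          (w \in monspan a b).
Proof.
apply: (iffP (memv_spanP _ _ (uniq_monoms2 a b))) => -[c e]; exists c.
  rewrite e raddf_sum !big_seq; apply: eq_bigr => m hm.
  by rewrite [LHS]linearZ /= pihomog_dE // mon_homog.
apply/val_inj; rewrite e raddf_sum !big_seq; apply: eq_bigr => m hm.
by rewrite [RHS]linearZ /= pihomog_dE // mon_homog.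
Qed.

(** The leading monomials of the bihomogeneous ideal of the graph. Comparison takes place inside the
    bidegree of m, so that one set serves all bidegrees. *)
Definition redundant (m : monom2) : Prop := exists s : seq (algC * monom2),
  (forall x, x \in s -> [/\ mdeg x.2.1 = mdeg m.1, mdeg x.2.2 = mdeg m.2 & (x.2 < m)%O]) /\
  mon m = \sum_(x <- s) x.1 *: mon x.2.

Lemma lt_add2 (m m' k : monom2) : (m < m')%O -> (add2 m k < add2 m' k)%O.
Proof.
by rewrite !ltEprodlexi /= !lemc_add2l ltmc_add2l.
Qed.

(** [mon] is multiplicative and the order is compatible with products, so a relation with leading
    monomial m can be multiplied by k. This is the hypothesis of [evpoly_upset]. *)
Lemma redundant_add m k : redundant m -> redundant (add2 m k).
Proof.
move=> [s [hs e]]; exists [seq (x.1, add2 x.2 k) | x <- s]; split=> [_ /mapP[x /hs[h1 h2 h3] ->]|].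
  by rewrite /= !mdegD h1 h2; split=> //; apply: lt_add2.
by rewrite monD e mulr_suml big_map; apply: eq_bigr => x _; rewrite /= monD -scalerAl.
Qed.

Lemma redundantP a b m : m \in monoms2 a b ->
  redundant m <->
  tohom (a + b * D) (mon m) \in
    <<[seq tohom (a + b * D) (mon m') | m' <- [seq y <- monoms2 a b | (y < m)%O]]>>%VS.
Proof.
move=> hm; have hm' := hm; move: hm'; rewrite mem_monoms2 => /andP[/eqP ma /eqP mb].
split=> [[s [hs e]]|/memv_spanP].
  rewrite e (_ : tohom _ _ = \sum_(x <- s) x.1 *: tohom (a + b * D) (mon x.2)).
    rewrite big_seq memv_suml // => x /hs[h1 h2 h3].
    rewrite memvZ // memv_span // (map_f (fun m => tohom _ (mon m))) //.
    by rewrite mem_filter h3 mem_monoms2 h1 h2 ma mb !eqxx.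
  apply/val_inj; rewrite /= !raddf_sum /=; apply: eq_bigr => x _.
  by rewrite linearZ.
rewrite filter_uniq ?uniq_monoms2 // => /(_ isT)[c /(congr1 val)].
rewrite /= pihomog_dE ?mon_homog // raddf_sum /= => e.
exists [seq (c y, y) | y <- [seq y <- monoms2 a b | (y < m)%O]]; split.
  move=> _ /mapP[y + ->]; rewrite mem_filter mem_monoms2 => /andP[h /andP[/eqP h1 /eqP h2]].
  by rewrite /= h1 h2 ma mb.
rewrite e big_map !big_seq; apply: eq_bigr => y; rewrite mem_filter => /andP[_ hy].
by rewrite pihomog_dE // mon_homog.
Qed.

Lemma hilb_count a b : hilb a b = count (fun m => `[< ~ redundant m >]) (monoms2 a b).
Proof.
pose s := sort <=%O (monoms2 a b).
have ps : perm_eq s (monoms2 a b) by rewrite perm_sort.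
have srt : sorted <%O s.
  by rewrite lt_sorted_uniq_le sort_uniq uniq_monoms2 sort_sorted //; apply: le_total.
have -> : hilb a b = \dim <<[seq tohom (a + b * D) (mon m) | m <- s]>>.
  congr (\dim _); apply: eq_span => x; apply/perm_mem/perm_map.
  by rewrite perm_sym.
have sE m : (<<[seq tohom (a + b * D) (mon m') | m' <- [seq y <- s | (y < m)%O]]>> =
  <<[seq tohom (a + b * D) (mon m') | m' <- [seq y <- monoms2 a b | (y < m)%O]]>>)%VS.
  by apply: eq_span => x; apply/perm_mem/perm_map/perm_filter.
rewrite dim_span_sorted // -(permP ps); apply: eq_in_count => m.
rewrite (perm_mem ps) => hm; rewrite /= sE; apply/idP/asboolP.
  by move=> /negP h /(redundantP hm).
by move=> nr; apply/negP => h; apply: nr; apply/(redundantP hm).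
Qed.

Lemma hilb_evpoly (R : realType) : evpoly (fun a b => (hilb a b)%:R : R).
Proof.
apply: (@evpoly_ext _ 0) (evpoly_upset R redundant_add) => a b _ _.
by rewrite hilb_count.
Qed.

Lemma expand_homog e (p : {mpoly algC[3]}) : p \is e.-homog -> p = \sum_(m <- monoms e) p@_m *: 'X_[m].
Proof.
move=> hp; apply/mpolyP => m; rewrite raddf_sum /=.
have [me|me] := boolP (m \in monoms e).
  rewrite (bigD1_seq m) ?uniq_basis //= big1 ?addr0 => [|m' ne].
    by rewrite mcoeffZ mcoeffX eqxx mulr1.
  by rewrite mcoeffZ mcoeffX (negbTE ne) mulr0.
rewrite (dhomog_nemf_coeff hp) -?mem_monoms // big_seq big1 // => m' hm'.
rewrite mcoeffZ mcoeffX; case: eqP => [mm|_]; last by rewrite mulr0.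
by rewrite -mm hm' in me.
Qed.

Lemma tensor_expand a b (u v : {mpoly algC[3]}) : u \is (a).-homog -> v \is b.-homog ->
  exists c : monom2 -> algC, u * (v \mPo G) = \sum_(m <- monoms2 a b) c m *: mon m.
Proof.
move=> /expand_homog uE /expand_homog vE.
exists (fun m => u@_(m.1) * v@_(m.2)).
rewrite {1}uE {1}vE raddf_sum mulr_suml big_allpairs_dep /=; apply: eq_bigr => x _.
rewrite mulr_sumr; apply: eq_bigr => y _.
by rewrite linearZ /= -scalerAr -scalerAl scalerA mulrC.
Qed.

(** A basis of [monspan] lifts to bihomogeneous forms, and [graph_formP] exchanges linear relations
    on the graph with polynomial identities. *)
Lemma hilb_coord_dim a b :
  @coord_dim (prod_space P2 P2) (graph G) (a, b) (hilb a b).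
Proof.
have /choice[c hc] : forall k : 'I_(hilb a b), exists c : monom2 -> algC,
    val (vbasis (monspan a b))`_k = \sum_(m <- monoms2 a b) c m *: mon m.
  by move=> k; apply/monspanP/vbasis_mem/mem_nth; rewrite size_tuple.
pose s := monoms2 a b.
pose u k (j : 'I_(size s)) := c k (nth (0, 0)%MM s j) *: 'X_[(nth (0, 0)%MM s j).1] : {mpoly algC[3]}.
pose v (j : 'I_(size s)) := 'X_[(nth (0, 0)%MM s j).2] : {mpoly algC[3]}.
have hs j : nth (0, 0)%MM s (j : 'I_(size s)) \in s by rewrite mem_nth.
have hu k j : u k j \is (a).-homog.
  by rewrite rpredZ // dhomogX /=; have := hs j; rewrite mem_monoms2 => /andP[].
have hv j : v j \is b.-homog.
  by rewrite dhomogX /=; have := hs j; rewrite mem_monoms2 => /andP[].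
have sumE k : \sum_j u k j * (v j \mPo G) = val (vbasis (monspan a b))`_k.
  rewrite hc (big_nth (0, 0)%MM) big_mkord; apply: eq_bigr => j _.
  by rewrite -scalerAl.
exists (fun k x => \sum_j eval3 (u k j) (coords x.1) * eval3 (v j) (coords x.2)); split.
- by move=> k; apply/prod_formP; exists (size s), (u k), v.
- move=> e he; pose w := \sum_k e k *: (vbasis (monspan a b))`_k.
  pose u' j := \sum_k e k *: u k j.
  have : \sum_j u' j * (v j \mPo G) = 0.
    have hu' j : u' j \is (a).-homog.
      by apply: rpred_sum => k _; apply: rpredZ; apply: hu.
    apply/(graph_formP hG rG hu' hv).
    move=> x /he; apply: etrans; under [RHS]eq_bigr do rewrite mulr_sumr.
    rewrite exchange_big /=; apply: eq_bigr => j _.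
    rewrite /eval3 raddf_sum mulr_suml; apply: eq_bigr => k _ /=.
    by rewrite mevalZ mulrA.
  have -> : \sum_j u' j * (v j \mPo G) = val w.
    rewrite val_dhomog_sum; under eq_bigr do rewrite mulr_suml.
    rewrite exchange_big; apply: eq_bigr => k _.
    rewrite val_dhomogZ -sumE scaler_sumr; apply: eq_bigr => j _.
    by rewrite scalerAl.
  move=> w0; have {}w0 : w = 0 by apply/val_inj.
  by have /freeP/(_ _ w0) := basis_free (vbasisP (monspan a b)).
move=> phi /prod_formP[m [u2 [v2 [hu2 hv2 phiE]]]].
pose W := \sum_k u2 k * (v2 k \mPo G).
have hW : W \is (a + b * D)%N.-homog.
  by rewrite rpred_sum // => k _; apply: dhomogM => //; apply: comp_homog.
have WE : val (tohom (a + b * D) W) = W by exact: val_tohom.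
have : tohom (a + b * D) W \in monspan a b.
  apply/monspanP; rewrite WE.
  have /choice[cc hcc] : forall k, exists c : monom2 -> algC,
      u2 k * (v2 k \mPo G) = \sum_(m <- monoms2 a b) c m *: mon m.
    by move=> k; apply: tensor_expand.
  exists (fun m => \sum_k cc k m); rewrite /W.
  under eq_bigr do rewrite hcc; rewrite exchange_big /=; apply: eq_bigr => x _.
  by rewrite scaler_suml.
move=> /coord_vbasis => WB.
pose e k := coord (vbasis (monspan a b)) k (tohom (a + b * D) W); exists e => [[P Q] Sx].
(* The difference of phi and the proposed combination is written as a single bihomogeneous form with
   N summands, so that [graph_formP] applies to it. *)
pose N := (m + size s)%N.
pose uu (j : 'I_N) := match fintype.split j with inl k => u2 k | inr k => - \sum_i e i *: u i k end.
pose vv (j : 'I_N) := match fintype.split j with inl k => v2 k | inr k => v k end.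
have uul k : uu (lshift _ k) = u2 k by rewrite /uu (unsplitK (inl k)).
have vvl k : vv (lshift _ k) = v2 k by rewrite /vv (unsplitK (inl k)).
have uur k : uu (rshift _ k) = - \sum_i e i *: u i k by rewrite /uu (unsplitK (inr k)).
have vvr k : vv (rshift _ k) = v k by rewrite /vv (unsplitK (inr k)).
have hN : \sum_j uu j * (vv j \mPo G) = 0.
  rewrite big_split_ord /=.
  under eq_bigr do rewrite uul vvl.
  under [X in _ + X]eq_bigr do rewrite uur vvr.
  rewrite -/W -{1}WE WB val_dhomog_sum -[X in _ + X]opprK -sumrN; apply/eqP.
  rewrite subr_eq0; apply/eqP.
  under [RHS]eq_bigr do rewrite mulNr opprK mulr_suml.
  rewrite exchange_big; apply: eq_bigr => k _.
  rewrite val_dhomogZ -sumE scaler_sumr; apply: eq_bigr => j _.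
  by rewrite scalerAl.
have huu j : uu j \is (a).-homog.
  rewrite /uu; case: (fintype.split j) => k //; rewrite rpredN.
  by apply: rpred_sum => i _; apply: rpredZ; apply: hu.
have hvv j : vv j \is b.-homog by rewrite /vv; case: (fintype.split j).
have /(graph_formP hG rG huu hvv)/(_ (P, Q) Sx) := hN.
rewrite big_split_ord /=.
under eq_bigr do rewrite uul vvl.
under [X in _ + X]eq_bigr do rewrite uur vvr.
rewrite -phiE => /eqP; rewrite addr_eq0 => /eqP->; rewrite -sumrN.
under [RHS]eq_bigr do rewrite mulr_sumr.
rewrite exchange_big /=; apply: eq_bigr => j _.
rewrite /eval3 mevalN mulNr opprK raddf_sum mulr_suml; apply: eq_bigr => k _ /=.
by rewrite mevalZ mulrA.
Qed.

End Hilbert.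

(** * Bounds for the Hilbert function *)

Lemma dim_limg_inj (K : fieldType) (V W : vectType K) (f : 'Hom(V, W)) (U : {vspace V}) :
  (forall v, f v = 0 -> v = 0) -> \dim (f @: U) = \dim U.
Proof.
move=> finj; apply: limg_dim_eq; apply/eqP; rewrite -subv0; apply/subvP => v.
by rewrite memv_cap memv_ker memv0 => /andP[_ /eqP/finj->].
Qed.

Lemma lin_lfun (K : fieldType) (V W : vectType K) (g : V -> W) :
  linear g -> exists f : 'Hom(V, W), f =1 g.
Proof.
move=> lg; pose L := GRing.isLinear.Build K V W _ g lg.
pose f : {linear V -> W} := HB.pack g L.
by exists (linfun f) => v; rewrite lfunE.
Qed.

Lemma dim_limg_le (K : fieldType) (V W : vectType K) (f : 'Hom(V, W)) (U : {vspace V}) :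
  (\dim (f @: U) <= \dim U)%N.
Proof. by rewrite -[leqRHS](limg_ker_dim f) leq_addl. Qed.

Lemma pihomogM k e (r g : {mpoly algC[3]}) : g \is e.-homog ->
  pihomog mdeg (k + e) (r * g) = pihomog mdeg k r * g.
Proof.
move=> hg; rewrite {1}(mpolyE r) mulr_suml raddf_sum pihomogE mulr_suml [RHS]big_mkcond /=.
rewrite big_seq [RHS]big_seq; apply: eq_bigr => m _; rewrite -!scalerAl linearZ /=.
have hm : 'X_[m] * g \is (mdeg m + e)%N.-homog by rewrite dhomogM // dhomogX.
case: eqP => [<-|ne]; first by rewrite pihomog_dE // scalerAl.
by rewrite (pihomog_ne0 _ hm) ?scaler0 // eqn_add2r; apply/eqP.
Qed.

Section Bounds.
Variables (G : triple) (D : nat).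
Hypotheses (hG : thomog D G) (rG : is_ratmap G).

Lemma tensor_in a b (u v : {mpoly algC[3]}) : u \is (a).-homog -> v \is b.-homog ->
  tohom (a + b * D) (u * (v \mPo G)) \in monspan G D a b.
Proof.
move=> hu hv; apply/monspanP => //; rewrite val_tohom; first exact: tensor_expand.
by rewrite dhomogM // comp_homog.
Qed.

Lemma hilb_le a b : (hilb G D a b <= 'C(a + b * D + 2, 2))%N.
Proof. by rewrite -dim_dhomog dimvS ?subvf. Qed.

(** Let S_a be the forms of degree a. The map (p, q) -> p G_0^b - q G_2^b from pairs in S_a lands in
    [monspan], and by coprimality its kernel is contained in an image of S_(a - bD). *)
Lemma hilb_ge_coprime a b : mcoprime (tnth G i0) (tnth G i2) -> (b * D <= a)%N ->
  ('C(a + 2, 2) * 2 <= hilb G D a b + 'C(a - b * D + 2, 2))%N.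
Proof.
move=> co ba; pose A := tnth G i0 ^+ b; pose B := tnth G i2 ^+ b.
have hA : A \is (b * D)%N.-homog by rewrite mulnC dhomogMn.
have hB : B \is (b * D)%N.-homog by rewrite mulnC dhomogMn.
have coAB : mcoprime A B by apply/mcoprimeX/mcoprime_sym/mcoprimeX/mcoprime_sym.
have [f fE] := @lin_hom (dhomog 3 algC a * dhomog 3 algC a)%type (a + b * D)
  (fun pq => val pq.1 * A - val pq.2 * B)
  ltac:(by move=> k [p q] [p' q'] /=; rewrite -!mul_mpolyC; ring)
  ltac:(by move=> [p q] /=; rewrite rpredB // dhomogM // dhomog_is_dhomog).
have [g gE] := @lin_hom (dhomog 3 algC (a - b * D)) a (fun r => val r * B)
  ltac:(by move=> k r r' /=; rewrite -!mul_mpolyC; ring)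
  ltac:(by move=> r; have := dhomogM (dhomog_is_dhomog r) hB; rewrite subnK).
have [g' gE'] := @lin_hom (dhomog 3 algC (a - b * D)) a (fun r => val r * A)
  ltac:(by move=> k r r' /=; rewrite -!mul_mpolyC; ring)
  ltac:(by move=> r; have := dhomogM (dhomog_is_dhomog r) hA; rewrite subnK).
have dimV : \dim {: (dhomog 3 algC a * dhomog 3 algC a)%type} = ('C(a + 2, 2) * 2)%N.
  by rewrite muln2 -addnn -dim_dhomog !dimvf.
rewrite -dimV -(limg_ker_dim f) addnC leq_add //.
  apply: dimvS; apply/subvP => _ /memv_imgP[[p q] _ ->].
  have -> : f (p, q) = tohom (a + b * D) (val p * ('X_i0 ^+ b \mPo G)) -
                       tohom (a + b * D) (val q * ('X_i2 ^+ b \mPo G)).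
    apply/val_inj; rewrite fE !rmorphXn /= !comp_mpolyXU -!tnth_nth -/A -/B.
    by rewrite !pihomog_dE // ?dhomogM ?dhomog_is_dhomog.
  by rewrite rpredB // tensor_in ?dhomog_is_dhomog // -{2}[b]mul1n dhomogMn ?dhomogX /= ?mdeg1.
rewrite capfv -dim_dhomog.
have lgg : linear (fun r => (g r, g' r)) by move=> k r r'; rewrite !linearP.
have [gg ggE] := lin_lfun lgg.
apply: leq_trans (dim_limg_le gg _); apply: dimvS; apply/subvP => -[p q].
rewrite memv_ker => /eqP/(congr1 val); rewrite fE /= => /eqP; rewrite subr_eq0 => /eqP/coAB[r [pE qE]].
apply/memv_imgP; exists (tohom _ r); first exact: memvf.
rewrite ggE.
(* Coprimality does not say that r is homogeneous; its part of degree a - bD has the same products,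
   because these have degree a. *)
have hr k X : X \is (b * D)%N.-homog -> val (k : dhomog 3 algC a) = r * X ->
    pihomog mdeg (a - b * D) r * X = r * X.
  by move=> hX e; rewrite -(pihomogM _ _ hX) subnK // -e pihomog_dE // dhomog_is_dhomog.
by congr pair; apply/val_inj; rewrite ?gE ?gE' /= (hr _ _ _ pE, hr _ _ _ qE).
Qed.

End Bounds.

Lemma homog_split k (p : {mpoly algC[3]}) : p \is k.+1.-homog ->
  exists q : 'I_3 -> {mpoly algC[3]}, (forall i, q i \is k.-homog) /\
    p = \sum_i 'X_i * q i.
Proof.
move=> hp; have pick m : m \in msupp p -> exists i, m i != 0%N.
  move=> mp; have : mdeg m = k.+1 by move/dhomogP: hp => /(_ _ mp).
  rewrite mdegE => h; apply: contrapT => n0; suff : (\sum_i m i = 0)%N by rewrite h.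
  by rewrite big1 // => i _; apply/eqP/negP => mi; apply: n0; exists i; apply/negP.
have /choice[c hc] : forall m : 'X_{1..3}, exists i, m \in msupp p -> m i != 0%N.
  move=> m; have [mp|] := boolP (m \in msupp p); last by exists i0.
  by have [i] := pick _ mp; exists i.
exists (fun i => \sum_(m <- msupp p | c m == i) p@_m *: 'X_[m - U_(i)]); split=> [i|].
  rewrite big_seq_cond; apply: rpred_sum => m /andP[mp /eqP cm]; apply: rpredZ.
  have : mdeg m = k.+1 by move/dhomogP: hp => /(_ _ mp).
  rewrite dhomogX /= -{1}(submK (m := U_(i)) (m' := m)) ?lep1mP; last by rewrite -cm hc.
  by rewrite mdegD mdeg1 addn1 => -[->].
under eq_bigr do rewrite mulr_sumr.
rewrite (exchange_big_dep xpredT) //= {1}(mpolyE p) !big_seq; apply: eq_bigr => m mp.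
rewrite (big_pred1 (c m)) => [|i]; last by rewrite eq_sym.
by rewrite -scalerAr -mpolyXD addmC submK // lep1mP hc.
Qed.

(** * The function field as an extension of degree 2^n *)

Section Tower.
Variables (d : nat) (c : algC).
Hypothesis (d3 : (3 <= d)%N).

Local Notation F := (henon d c).
Local Notation hF := (henon_homog c d3).

Let FE : [/\ tnth F i0 = 'X_i0 ^+ d - c *: ('X_i1 ^+ 2 * 'X_i2 ^+ (d - 2)),
  tnth F i1 = 'X_i0 * 'X_i1 ^+ 2 * 'X_i2 ^+ (d - 3) &
  tnth F i2 = 'X_i1 ^+ 2 * 'X_i2 ^+ (d - 2)].
Proof. by []. Qed.

Let X0n : ('X_i0 : {mpoly algC[3]}) != 0.
Proof. by rewrite -msupp_eq0 msuppX. Qed.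

Let X1h i : ('X_i : {mpoly algC[3]}) \is 1.-homog.
Proof. by rewrite dhomogX /= mdeg1. Qed.

Let Xkh i k : ('X_i ^+ k : {mpoly algC[3]}) \is k.-homog.
Proof. by rewrite -{2}[k]mul1n dhomogMn. Qed.

(* [henon], hence its composition with [p] and [q], is even in the second variable. *)
Lemma henon_free b (p q : {mpoly algC[3]}) : p \is b.-homog -> q \is b.-homog ->
  'X_i0 * (p \mPo F) + 'X_i1 * (q \mPo F) = 0 -> p = 0 /\ q = 0.
Proof.
move=> hp hq e.
have ev (v : 'rV[algC]_3) : v 0 i0 * eval3 (p \mPo F) v + v 0 i1 * eval3 (q \mPo F) v = 0.
  by have := congr1 (eval3^~ v) e; rewrite /eval3 mevalD !mevalM !mevalXU meval0.
have even r (v : 'rV[algC]_3) : eval3 (r \mPo F) (vec (v 0 i0) (- v 0 i1) (v 0 i2)) =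
    eval3 (r \mPo F) v.
  by rewrite [in RHS](vecE v) !eval3_comp -!/(evalt _ _) !evalt_henon sqrrN.
have p0 : p \mPo F = 0.
  apply: (mulfI X0n); rewrite mulr0; apply: eval3_fun_eq0 => v.
  rewrite /eval3 mevalM mevalXU -/(eval3 _ _); apply: (@mulIf _ 2).
    by rewrite pnatr_eq0.
  rewrite mul0r mulr_natr mulr2n -[RHS]addr0 -{1}(ev v).
  by have <- := ev (vec (v 0 i0) (- v 0 i1) (v 0 i2)); rewrite !even !mxE /=; ring.
have p0' : p = 0 by apply: (comp_henon_eq0 hp p0).
split=> //; apply: (@comp_henon_eq0 d c _ _ hq).
move: e; rewrite p0 mulr0 add0r => /eqP; rewrite mulf_eq0 => /orP[|/eqP//].
by rewrite -msupp_eq0 msuppX.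
Qed.

(** Up to denominators, x and y span all forms over the pullbacks by the map; with [henon_free], the
    function field extension has degree 2. In the induction a variable is split off, and the
    pullbacks of y and of [k] bring its products with x and y back into the span. *)
Lemma henon_span a : exists e (h : {mpoly algC[3]}),
  [/\ h \is e.+1.-homog, h != 0 & forall t, t \is (a.+1).-homog -> exists p q,
      [/\ p \is e.+1.-homog, q \is e.+1.-homog &
          (h \mPo F) * t = 'X_i0 ^+ a * ('X_i0 * (p \mPo F) + 'X_i1 * (q \mPo F))]].
Proof.
have [F0 F1 F2] := FE.
have XF i : 'X_i \mPo F = tnth F i by rewrite comp_mpolyXU -tnth_nth.
(* The second coordinate of the image is x / z; this trades z for x. *)
have XFz : tnth F i1 * 'X_i2 = tnth F i2 * 'X_i0.
  rewrite F1 F2 (_ : d - 2 = (d - 3).+1)%N ?exprS; last by move: d3; lia.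
  by ring.
elim: a => [|a [e [h [he h0 IH]]]].
  exists 0%N, 'X_i1; split; rewrite ?X1h //; first by rewrite -msupp_eq0 msuppX.
  move=> t /homog_split[q [hq ->]].
  have qC i : q i = (mcoeff 0%MM (q i))%:MP.
    have := hq i; case: (eqVneq (q i) 0) => [->|q0] hqi; first by rewrite mcoeff0 mpolyC0.
    by apply: msize1_polyC; rewrite -mlead_deg // (_ : mdeg _ = 0%N) //;
       move/dhomogP: hqi => /(_ _ (mlead_supp q0)).
  exists ('X_i1 * q i0 + 'X_i2 * q i2), ('X_i1 * q i1); split.
  - by apply: rpredD; apply: (dhomogM (X1h _) (hq _)).
  - exact: (dhomogM (X1h _) (hq _)).
  rewrite expr0 mul1r !rmorphD !rmorphM /= !XF.
  have qF i : q i \mPo F = q i by rewrite qC comp_mpolyC.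
  rewrite !qF !big_ord_recl big_ord0 /= addr0.
  rewrite (_ : lift _ _ = i1); last exact/val_inj.
  rewrite (_ : lift _ _ = i2); last exact/val_inj.
  rewrite (_ : ord0 = i0); last exact/val_inj.
  by rewrite !mulrDr mulrA [tnth F i1 * ('X_i2 * _)]mulrA XFz; ring.
(* [k] and [l] homogenize the two sides of w^2 (u + c) = v^d, with a factor v^2 written as x^2. The
   resulting identity [kl] replaces y^2 by x^2 over the pullbacks. *)
pose k : {mpoly algC[3]} := 'X_i2 ^+ (d - 3) * ('X_i0 + c *: 'X_i2).
pose l : {mpoly algC[3]} := 'X_i1 ^+ (d - 2).
have d2E : (d - 2 = (d - 3) + 1)%N by move: d3; lia.
have hk : k \is (d - 2)%N.-homog by rewrite d2E dhomogM // rpredD // rpredZ.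
have hl : l \is (d - 2)%N.-homog by exact: Xkh.
have kl : 'X_i1 ^+ 2 * (k \mPo F) = 'X_i0 ^+ 2 * (l \mPo F).
  rewrite !rmorphM !rmorphXn rmorphD /= comp_mpolyZ !XF F0 F1 F2 subrK !exprMn.
  have -> : d = (d - 3 + 3)%N by rewrite subnK.
  rewrite (_ : d - 3 + 3 - 2 = d - 3 + 1)%N ?addnK; last by move: d3; lia.
  have -> : ('X_i2 ^+ (d - 3 + 1)) ^+ (d - 3) = ('X_i2 ^+ (d - 3)) ^+ (d - 3 + 1) :> {mpoly algC[3]}.
    by rewrite -!exprM mulnC.
  move: ('X_i2 ^+ (d - 3) : {mpoly algC[3]}) => Z; rewrite !exprD.
  move: ('X_i0 ^+ (d - 3) : {mpoly algC[3]}) (Z ^+ (d - 3)) (('X_i1 ^+ 2) ^+ (d - 3) : {mpoly algC[3]}) => U V W.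
  by ring.
have k0 : k != 0.
  rewrite mulf_neq0 //; first by rewrite expf_neq0 // -msupp_eq0 msuppX.
  apply/eqP => /(congr1 (mcoeff U_(i0))).
  rewrite mcoeffD mcoeffZ !mcoeffXU mcoeff0 eqxx /= mulr0 addr0 => /eqP.
  by rewrite oner_eq0.
clearbody k l.
exists (e + 1 + (d - 2))%N, (h * 'X_i1 * k); split.
- by rewrite -!addSn !dhomogM.
- by apply: mulf_neq0 => //; apply: mulf_neq0 => //; rewrite -msupp_eq0 msuppX.
move=> t /homog_split[q [hq ->]].
have [p0 [q0 [hp0 hq0 E0]]] := IH _ (hq i0).
have [p1 [q1 [hp1 hq1 E1]]] := IH _ (hq i1).
have [p2 [q2 [hp2 hq2 E2]]] := IH _ (hq i2).
exists (p0 * 'X_i1 * k + q1 * 'X_i1 * l + p2 * 'X_i2 * k),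
       (q0 * 'X_i1 * k + p1 * 'X_i1 * k + q2 * 'X_i2 * k); split.
- by rewrite -!addSn !rpredD // !dhomogM.
- by rewrite -!addSn !rpredD // !dhomogM.
rewrite !big_ord_recl big_ord0 /= addr0.
rewrite (_ : lift _ _ = i1); last exact/val_inj.
rewrite (_ : lift _ _ = i2); last exact/val_inj.
rewrite (_ : ord0 = i0); last exact/val_inj.
rewrite !(rmorphD, rmorphM) /= !XF.
set H := h \mPo F in E0 E1 E2 *; set K := k \mPo F in kl *; set L := l \mPo F in kl *.
set A := tnth F i1 in XFz *; set B := tnth F i2 in XFz *.
transitivity (A * K * ('X_i0 * (H * q i0)) + A * ('X_i1 * K) * (H * q i1)
              + (A * 'X_i2) * K * (H * q i2)); first by move: (q i0) (q i1) (q i2) => *; ring.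
rewrite E0 E1 E2 XFz exprSr.
transitivity ('X_i0 ^+ a * 'X_i0 * ('X_i0 * (p0 \mPo F) * A * K + 'X_i1 * (q0 \mPo F) * A * K
  + A * 'X_i1 * K * (p1 \mPo F) + B * K * ('X_i0 * (p2 \mPo F) + 'X_i1 * (q2 \mPo F)))
  + 'X_i0 ^+ a * A * ('X_i1 ^+ 2 * K) * (q1 \mPo F)); first by ring.
by rewrite kl; ring.
Qed.

End Tower.

Section TowerIteration.
Variables (d : nat) (c : algC).
Hypothesis (d3 : (3 <= d)%N).

Local Notation F := (henon d c).
Local Notation hF := (henon_homog c d3).
Local Notation G n := (iterate F n).

Let X0n : ('X_i0 : {mpoly algC[3]}) != 0.
Proof. by rewrite -msupp_eq0 msuppX. Qed.

Let X1h i : ('X_i : {mpoly algC[3]}) \is 1.-homog.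
Proof. by rewrite dhomogX /= mdeg1. Qed.

Let X0h k : ('X_i0 ^+ k : {mpoly algC[3]}) \is k.-homog.
Proof. by rewrite -{2}[k]mul1n dhomogMn. Qed.

Let comp0 b p : p \is b.-homog -> p != 0 -> p \mPo F != 0.
Proof. by move=> hp; apply: contra_neq; apply: (@comp_henon_eq0 d c b p hp). Qed.

Let compS n p : p \mPo G n.+1 = (p \mPo G n) \mPo F.
Proof. by rewrite comp_mpolyA iterateSr. Qed.

(* The analogue for forms of a basis [s] of the function field of P2 over its
   subfield generated by the components of [f^n]. *)
Definition tower_basis (n : nat) (I : finType) (m : nat) (s : I -> {mpoly algC[3]}) : Prop :=
  [/\ forall i, s i \is m.-homog,
      forall b (q : I -> {mpoly algC[3]}), (forall i, q i \is b.-homog) ->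
        \sum_i s i * (q i \mPo G n) = 0 -> forall i, q i = 0 &
      forall a, exists ew ew' e (w w' h : {mpoly algC[3]}),
        [/\ w \is ew.-homog /\ w != 0, w' \is ew'.-homog /\ w' != 0,
            h \is e.-homog /\ h != 0 &
        forall t, t \is (a.+1).-homog -> exists q : I -> {mpoly algC[3]},
          (forall i, q i \is e.-homog) /\
          (h \mPo G n) * w' * t = w * \sum_i s i * (q i \mPo G n)]].

(** Degrees multiply in towers: the iterate n + 1 is the map followed by the iterate n, so the
    products of x and y with the pullbacks of a basis for n form a basis for n + 1. The forms w, w'
    and h collect the denominators. *)
Lemma tower_basisP n : exists (I : finType) (m : nat) (s : I -> {mpoly algC[3]}),
  #|I| = (2 ^ n)%N /\ tower_basis n m s.
Proof.
elim: n => [|n [I [m [s [cI [hs ind span]]]]]].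
  exists unit, 0%N, (fun=> 1); split; first by rewrite card_unit.
  have E q : \sum_(i : unit) 1 * (q i \mPo G 0) = q tt.
    by rewrite (big_pred1 tt) => [|[]//]; rewrite mul1r comp_mpoly_id.
  split=> [_|b q hq|a]; first exact: dhomog1.
    by rewrite E => q0 [].
  exists a.+1, 0%N, a.+1, ('X_i0 ^+ a.+1), 1, ('X_i0 ^+ a.+1); split.
  - by split; rewrite ?X0h ?expf_neq0.
  - by split; rewrite ?dhomog1 ?oner_neq0.
  - by split; rewrite ?X0h ?expf_neq0.
  move=> t ht; exists (fun=> t); split=> //.
  by rewrite E comp_mpoly_id mulr1.
pose s' (x : bool * I) := (if x.1 then 'X_i1 else 'X_i0) * (s x.2 \mPo F).
have sumE (q : bool * I -> {mpoly algC[3]}) : \sum_x s' x * (q x \mPo G n.+1) =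
    'X_i0 * ((\sum_i s i * (q (false, i) \mPo G n)) \mPo F) +
    'X_i1 * ((\sum_i s i * (q (true, i) \mPo G n)) \mPo F).
  transitivity (\sum_bl \sum_i s' (bl, i) * (q (bl, i) \mPo G n.+1)).
    by rewrite pair_bigA; apply: eq_bigr => -[].
  rewrite big_bool /= addrC !raddf_sum /= !mulr_sumr.
  by apply: f_equal2; apply: eq_bigr => i _; rewrite /s' [LHS]/= compS [in RHS]comp_mpolyM mulrA.
exists (bool * I)%type, (1 + m * d)%N, s'; split; first by rewrite card_prod card_bool cI expnS.
split=> [x|b q hq|a].
- by rewrite dhomogM //; [case: ifP|apply: comp_homog => //; apply: hF].
- have hA bl : \sum_i s i * (q (bl, i) \mPo G n) \is (m + b * d ^ n)%N.-homog.
    by apply: rpred_sum => i _; apply: dhomogM => //; apply: comp_homog => //; apply: iterate_homog.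
  rewrite sumE => /(henon_free (hA false) (hA true))[e0 e1] [[] i].
    exact: (ind _ (fun i => q (true, i)) _ e1).
  exact: (ind _ (fun i => q (false, i)) _ e0).
have [e1 [h1 [hh1 h10 span1]]] := henon_span c d3 a.
have [ew [ew' [e [w [w' [h [[hw w0] [hw' w'0] [hh h0] spann]]]]]]] := span e1.
exists (a + ew * d)%N, (e1.+1 * d + ew' * d)%N, e,
  ('X_i0 ^+ a * (w \mPo F)), ((h1 \mPo F) * (w' \mPo F)), h; split=> //.
- split; last by rewrite mulf_neq0 ?expf_neq0 // (comp0 hw).
  by rewrite dhomogM // comp_homog //; apply: hF.
- split; last by rewrite mulf_neq0 ?(comp0 hh1) // (comp0 hw').
  by rewrite dhomogM // comp_homog //; apply: hF.
move=> t /span1[p [q [hp hq tE]]].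
have [rp [hrp pE]] := spann _ hp; have [rq [hrq qE]] := spann _ hq.
exists (fun x => if x.1 then rq x.2 else rp x.2); split=> [[[] i]|]; [exact: hrq|exact: hrp|].
rewrite (sumE (fun x => if x.1 then rq x.2 else rp x.2)) /= compS.
transitivity (((h \mPo G n) \mPo F) * (w' \mPo F) * ((h1 \mPo F) * t)); first by ring.
rewrite tE.
transitivity ('X_i0 ^+ a * ('X_i0 * (((h \mPo G n) * w' * p) \mPo F)
  + 'X_i1 * (((h \mPo G n) * w' * q) \mPo F))).
  by rewrite !rmorphM /=; ring.
rewrite pE qE !comp_mpolyM.
by move: (h \mPo G n \mPo F) (w' \mPo F) (w \mPo F) (\sum_i s i * (rp i \mPo G n) \mPo F)
  (\sum_i s i * (rq i \mPo G n) \mPo F) => *; ring.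
Qed.

Variables (n : nat).
Local Notation D := (d ^ n)%N.
Let hG := iterate_homog c d3 n.
Let rG := iterate_ratmap c d3 n.

(** The products x^(a - m) s_i q_i(G), with q_i of degree b, are independent by the second clause of
    [tower_basis], and there are 2^n indices i. *)
Lemma hilb_ge_topdeg : exists m, forall a b, (m <= a)%N ->
  (2 ^ n * 'C(b + 2, 2) <= hilb (G n) D a b)%N.
Proof.
have [I [m [s [cI [hs ind _]]]]] := tower_basisP n.
exists m => a b ma.
have [f fE] := @lin_hom {ffun I -> dhomog 3 algC b} (a + b * D)
  (fun q => 'X_i0 ^+ (a - m) * \sum_i s i * (val (q i) \mPo G n))
  ltac:(move=> k q q' /=; rewrite -!mul_mpolyC mulrCA -mulrDr; congr (_ * _);
        rewrite mulr_sumr -big_split; apply: eq_bigr => i _;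
        rewrite !ffunE /= linearP /= -mul_mpolyC; ring)
  ltac:(move=> q; rewrite -{2}(subnK ma) -addnA dhomogM //;
        apply: rpred_sum => i _; apply: dhomogM => //; apply: comp_homog => //;
        exact: dhomog_is_dhomog).
have -> : (2 ^ n * 'C(b + 2, 2) = \dim {: {ffun I -> dhomog 3 algC b}})%N.
  by rewrite -cI -dim_dhomog !dimvf.
rewrite -(@dim_limg_inj _ _ _ f) => [|q /(congr1 val)].
  apply: dimvS; apply/subvP => _ /memv_imgP[q _ ->].
  have -> : f q = \sum_i tohom (a + b * D) ('X_i0 ^+ (a - m) * s i * (val (q i) \mPo G n)).
    apply/val_inj; rewrite fE val_dhomog_sum mulr_sumr; apply: eq_bigr => i _.
    rewrite val_tohom -?mulrA // -{2}(subnK ma) -addnA !dhomogM //.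
    by rewrite comp_homog // dhomog_is_dhomog.
  apply: rpred_sum => i _; apply: tensor_in; rewrite ?dhomog_is_dhomog //.
  by rewrite -{2}(subnK ma) dhomogM.
rewrite fE => /eqP; rewrite mulf_eq0 expf_eq0 (negbTE X0n) andbF /= => /eqP.
move=> /(ind b) h; apply/ffunP => i; apply/val_inj; rewrite ffunE /=.
by apply: h => j; apply: dhomog_is_dhomog.
Qed.

(** Multiplication by h(G) w' is injective and leads into w times the combinations of the s_i with
    coefficients of degree b + e, where e depends on a but not on b. *)
Lemma hilb_le_topdeg a : exists e, forall b,
  (hilb (G n) D a.+1 b <= 2 ^ n * 'C(b + e + 2, 2))%N.
Proof.
have [I [m [s [cI [hs _ span]]]]] := tower_basisP n.
have [ew [ew' [e [w [w' [h [[hw w0] [hw' w'0] [hh h0] spann]]]]]]] := span a.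
exists e => b.
have hGn : h \mPo G n != 0.
  by apply: contra_neq h0; apply: (@comp_iterate_eq0 d c d3 n _ _ hh).
have hhG : h \mPo G n \is (e * D)%N.-homog by apply: comp_homog.
(* [tower_basis] does not record how the degrees of w, w' and h are related; its identity at the
   nonzero form x^(a + 1) reveals it. *)
have degE : (e * D + ew' + a.+1 = ew + (m + e * D))%N.
  have [q [hq E]] := spann _ (X0h a.+1).
  have n0 : (h \mPo G n) * w' * 'X_i0 ^+ a.+1 != 0 by rewrite !mulf_neq0 ?expf_neq0.
  apply: (dhomog_uniq n0 (dhomogM (dhomogM hhG hw') (X0h _))).
  rewrite E; apply: (dhomogM hw); apply: rpred_sum => i _; apply: (dhomogM (hs i)).
  exact: comp_homog.
pose E := (ew + (m + (b + e) * D))%N.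
have EE : E = (e * D + ew' + (a.+1 + b * D))%N by rewrite /E; move: degE; clear; lia.
have [f fE] := @lin_hom (dhomog 3 algC (a.+1 + b * D)) E
  (fun v => (h \mPo G n) * w' * val v)
  ltac:(by move=> k q q' /=; rewrite -!mul_mpolyC; ring)
  ltac:(by move=> v; rewrite EE dhomogM ?dhomog_is_dhomog // dhomogM).
have [g gE] := @lin_hom {ffun I -> dhomog 3 algC (b + e)} E
  (fun q => w * \sum_i s i * (val (q i) \mPo G n))
  ltac:(move=> k q q' /=; rewrite -!mul_mpolyC mulrCA -mulrDr; congr (_ * _);
        rewrite mulr_sumr -big_split; apply: eq_bigr => i _;
        rewrite !ffunE /= linearP /= -mul_mpolyC; ring)
  ltac:(move=> q; apply: dhomogM => //;
        apply: rpred_sum => i _; apply: dhomogM => //; apply: comp_homog => //;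
        exact: dhomog_is_dhomog).
have -> : (2 ^ n * 'C(b + e + 2, 2) = \dim {: {ffun I -> dhomog 3 algC (b + e)}})%N.
  by rewrite -cI -dim_dhomog !dimvf.
rewrite /hilb -(@dim_limg_inj _ _ _ f) => [|v /(congr1 val)]; last first.
  rewrite fE => /eqP; rewrite !mulf_eq0 (negbTE hGn) (negbTE w'0) /= => /eqP v0.
  exact/val_inj.
apply: leq_trans (dim_limg_le g _); apply: dimvS; apply/subvP => _ /memv_imgP[v /(monspanP hG)[k vE] ->].
have /choice[q hq] : forall x : monom2, exists q : I -> {mpoly algC[3]},
    x \in monoms2 a.+1 b -> (forall i, q i \is e.-homog) /\
    (h \mPo G n) * w' * 'X_[x.1] = w * \sum_i s i * (q i \mPo G n).
  move=> x; have [xm|] := boolP (x \in monoms2 a.+1 b); last by exists (fun=> 0).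
  have [|q hq] := spann 'X_[x.1]; last by exists q.
  by move: xm; rewrite mem_monoms2 dhomogX => /andP[].
pose r i := \sum_(x <- monoms2 a.+1 b) k x *: ('X_[x.2] * q x i).
have hr i : r i \is (b + e)%N.-homog.
  rewrite /r big_seq; apply: rpred_sum => x xm; apply: rpredZ; apply: dhomogM.
    by rewrite dhomogX; move: xm; rewrite mem_monoms2 => /andP[].
  by have [] := hq x xm.
apply/memv_imgP; exists [ffun i => tohom (b + e) (r i)]; first exact: memvf.
apply/val_inj; rewrite fE gE.
under [X in w * X]eq_bigr do rewrite ffunE val_tohom // raddf_sum mulr_sumr.
rewrite exchange_big /= vE !mulr_sumr !big_seq; apply: eq_bigr => x xm.
have [_ hx] := hq x xm; rewrite /mon -scalerAr mulrA hx.
rewrite -mulrA scalerAr; congr (_ * _); rewrite mulr_suml scaler_sumr.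
apply: eq_bigr => i _; rewrite linearZ rmorphM /= -!mul_mpolyC; ring.
Qed.

End TowerIteration.

(** * Intersection numbers and dynamical degrees *)

Section PolyGrowth.
Variable R : realType.
Implicit Types p q : {poly R}.

(** For p = q X + k the bound passes to q with a larger constant, so q = 0 by induction; a constant
    that decays like 1/n is 0. *)
Lemma poly_decay_eq0 p (C : R) (N : nat) :
  (forall n : nat, (N <= n)%N -> `|p.[n%:R]| * n.+1%:R <= C) -> p = 0.
Proof.
elim/poly_ind: p C N => // q k IH C N h.
have q0 : q = 0.
  apply: (IH (2 * (C + `|k|)) N.+1) => n Nn.
  have n0 : (0 : R) < n%:R by rewrite ltr0n; apply: leq_ltn_trans Nn.
  have := h n (ltnW Nn); rewrite hornerMXaddC => hn.
  have h1 : `|q.[n%:R] * n%:R + k| <= C.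
    by apply: le_trans hn; rewrite ler_peMr // ler1n.
  have h2 : `|q.[n%:R]| * n%:R <= C + `|k|.
    rewrite -[X in _ * X]gtr0_norm // -normrM -[X in `|X|](addrK k).
    by apply: le_trans (ler_normB _ _) _; rewrite lerD2r.
  apply: (@le_trans _ _ (`|q.[n%:R]| * (2 * n%:R))).
    apply: ler_wpM2l => //; rewrite -natrM ler_nat; move: Nn; lia.
  by rewrite mulrCA ler_pM2l.
rewrite {}q0 in h *; suff -> : k = 0 by rewrite mul0r add0r.
apply/eqP/negPn/negP => k0.
have kp : 0 < `|k| by rewrite normr_gt0.
pose n := maxn N (Num.truncn (C / `|k|)).+1.
have := h n (leq_maxl _ _); rewrite mul0r add0r hornerC mulrC -ler_pdivlMr //; apply/negP.
rewrite -ltNge; apply: lt_le_trans (truncnS_gt _) _.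
by rewrite ler_nat (leq_trans (leq_maxr N _)).
Qed.

Lemma poly_bounded_const p (C : R) (N : nat) :
  (forall n : nat, (N <= n)%N -> `|p.[n%:R]| <= C) -> exists k, p = k%:P.
Proof.
elim/poly_ind: p => [|q k _] h; first by exists 0.
exists k; rewrite (@poly_decay_eq0 q (2 * (C + `|k|)) N.+1) ?mul0r ?add0r // => n Nn.
have n0 : (0 : R) < n%:R by rewrite ltr0n; apply: leq_ltn_trans Nn.
have := h n (ltnW Nn); rewrite hornerMXaddC => h1.
have h2 : `|q.[n%:R]| * n%:R <= C + `|k|.
  rewrite -[X in _ * X]gtr0_norm // -normrM -[X in `|X|](addrK k).
  by apply: le_trans (ler_normB _ _) _; rewrite lerD2r.
apply: (@le_trans _ _ (`|q.[n%:R]| * (2 * n%:R))).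
  apply: ler_wpM2l => //; rewrite -natrM ler_nat; move: Nn; lia.
by rewrite mulrCA ler_pM2l.
Qed.

Lemma poly_linear_growth p (C : R) (N : nat) :
  (forall n : nat, (N <= n)%N -> `|p.[n%:R]| <= C * n.+1%:R) ->
  exists k l, p = l *: 'X + k%:P.
Proof.
elim/poly_ind: p => [|q k _] h; first by exists 0, 0; rewrite scale0r addr0.
have [|l ->] := @poly_bounded_const q (2 * C + `|k|) N.+1; last first.
  by exists k, l; rewrite mul_polyC.
move=> n Nn; have n1 : (1 : R) <= n%:R by rewrite ler1n; apply: leq_ltn_trans Nn.
have n0 : (0 : R) < n%:R by apply: lt_le_trans n1.
have := h n (ltnW Nn); rewrite hornerMXaddC => h1.
have C0 : 0 <= C by rewrite -(@pmulr_lge0 _ n.+1%:R) ?ltr0n //; apply: le_trans h1.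
rewrite -(ler_pM2r n0); apply: (@le_trans _ _ (C * n.+1%:R + `|k|)).
  rewrite -[X in _ * X]gtr0_norm // -normrM -[X in `|X|](addrK k).
  by apply: le_trans (ler_normB _ _) _; rewrite lerD2r.
rewrite mulrDl lerD //; last by rewrite ler_peMr.
rewrite mulrAC [leRHS]mulrC ler_wpM2l // -natrM ler_nat; move: Nn; lia.
Qed.

End PolyGrowth.

Section HilbertPolynomial.
Variable R : realType.
Variables (H : nat -> nat -> nat) (D T : nat).
Hypothesis Hle : forall a b, (H a b <= 'C(a + b * D + 2, 2))%N.
Hypothesis Hge : forall a b, (b * D <= a)%N -> ('C(a + 2, 2) * 2 <= H a b + 'C(a - b * D + 2, 2))%N.
Hypothesis Tge : exists m, forall a b, (m <= a)%N -> (T * 'C(b + 2, 2) <= H a b)%N.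
Hypothesis Tle : forall a, exists e, forall b, (H a.+1 b <= T * 'C(b + e + 2, 2))%N.

Let Q (x y : R) := (x + y * D%:R + 2) * (x + y * D%:R + 1) / 2.

(** [Q] is the binomial bound as a polynomial. For fixed b the two bounds differ by a constant,
    which determines chi up to a function of y alone; for fixed a, that function is squeezed up to a
    linear error. The unknown l and k cancel in [intersection]. *)
Lemma hilbert_poly_shape (chi : {poly {poly R}}) (N : nat) :
  (forall a b : nat, (N <= a)%N -> (N <= b)%N -> chi.[a%:R, b%:R] = (H a b)%:R) ->
  exists k l : R, forall x y, chi.[x, y] = Q x y - Q 0 y + T%:R / 2 * y ^+ 2 + l * y + k.
Proof.
move=> hchi.
pose slice (y : R) : {poly R} := map_poly (horner_eval y) chi.
have sliceE x y : (slice y).[x] = chi.[x, y].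
  have -> : x = horner_eval y x%:P by rewrite /horner_eval hornerC.
  by rewrite /slice horner_map /= /horner_eval hornerC.
pose QP (y : R) : {poly R} := 2^-1%:P * (('X + (y * D%:R + 2)%:P) * ('X + (y * D%:R + 1)%:P)).
have QPE x y : (QP y).[x] = Q x y.
  by rewrite /QP /Q !(hornerM, hornerD, hornerC, hornerX) !addrA mulrC.
have step1 (b : nat) x : (N <= b)%N -> chi.[x, b%:R] = Q x b%:R - Q 0 b%:R + chi.[0, b%:R].
  move=> Nb; have [|k hk] := @poly_bounded_const R (slice b%:R - QP b%:R) ((b * D)%:R ^+ 2) (N + b * D).
    move=> a ha; rewrite hornerD hornerN sliceE QPE hchi //; last by move: ha; lia.
    have QE : Q a%:R b%:R = 'C(a + b * D + 2, 2)%:R by rewrite natr_bin2 /Q natrD natrM.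
    have h1 : (H a b)%:R <= Q a%:R b%:R by rewrite QE ler_nat.
    have ba : (b * D <= a)%N by move: ha; lia.
    have h2 : Q a%:R b%:R - (b * D)%:R ^+ 2 <= (H a b)%:R.
      have := Hge ba; rewrite -(ler_nat R) natrM natrD !natr_bin2 natrB // => h.
      rewrite -(lerD2r ((a%:R - (b * D)%:R + 2) * (a%:R - (b * D)%:R + 1) / 2)).
      apply: le_trans h; rewrite /Q -natrM; set A : R := a%:R; set B : R := (b * D)%:R.
      by rewrite le_eqVlt; apply/orP; left; apply/eqP; field.
    rewrite ler0_norm ?subr_le0 // opprB lerBlDr addrC -lerBlDr //.
  have e z : chi.[z, b%:R] - Q z b%:R = k by rewrite -sliceE -QPE -hornerN -hornerD hk hornerC.
  by have := e x; have := e 0; move: (chi.[x, b%:R]) (chi.[0, b%:R]) (Q x b%:R) (Q 0 b%:R) => *; lra.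
have step2 x y : chi.[x, y] = Q x y - Q 0 y + chi.[0, y].
  (* The terms subtracted are the expansion of Q x y - Q 0 y, namely (x + 2)(x + 1)/2 - 1 + x D y;
     as a polynomial in y, [q] then vanishes at all large naturals. *)
  pose q : {poly R} := chi.[x%:P] - chi.[0%:P] - ((x + 2) * (x + 1) / 2 - 1)%:P - (x * D%:R) *: 'X.
  have qE z : q.[z] = chi.[x, z] - chi.[0, z] - ((x + 2) * (x + 1) / 2 - 1) - x * D%:R * z.
    by rewrite /q !(hornerD, hornerN, hornerC, hornerZ, hornerX).
  suff q0 : q = 0.
    have := qE y; rewrite q0 horner0 /Q.
    by move: (chi.[x, y]) (chi.[0, y]) => *; lra.
  apply: (@poly_decay_eq0 _ q 0 N) => b Nb; rewrite qE (step1 _ _ Nb) /Q.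
  rewrite [X in `|X|](_ : _ = 0) ?normr0 ?mul0r //.
  by move: (chi.[0, b%:R]) => *; lra.
have [m Hm] := Tge; pose a := maxn N m; have [e He] := Tle a.
pose p := chi.[0%:P] - (T%:R / 2) *: 'X^2.
(* The constant is a coarse majorant for the gap between T 'C(b + 2, 2) and T 'C(b + e + 2, 2)
   together with the lower order terms. *)
have [|k [l hp]] := @poly_linear_growth R p (T%:R * (e%:R + 3) ^+ 2 + (Q a.+1%:R 0 + 1 + a.+1%:R * D%:R)) N.
  move=> b Nb; have e1 : p.[b%:R] = (H a.+1 b)%:R - T%:R / 2 * b%:R ^+ 2
      - (Q a.+1%:R 0 - 1 + a.+1%:R * D%:R * b%:R).
    have <- : chi.[a.+1%:R, b%:R] = (H a.+1 b)%:R.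
      by rewrite hchi // (leq_trans (leq_maxl N m)).
    rewrite step2 /p !(hornerD, hornerN, hornerZ, hornerXn) /Q.
    by move: (chi.[0, b%:R]) => *; lra.
  have h1 : (T * 'C(b + 2, 2) <= H a.+1 b)%N by apply: Hm; rewrite (leq_trans (leq_maxr N m)).
  have h2 := He b; move: h1 h2; rewrite -2!(ler_nat R) !natrM !natr_bin2 natrD => h1 h2.
  rewrite {}e1.
  have b0 : (0 : R) <= b%:R by [].
  have T0 : (0 : R) <= T%:R by [].
  have E0 : (0 : R) <= e%:R by [].
  have D0 : (0 : R) <= D%:R by [].
  have A0 : (0 : R) <= a.+1%:R by [].
  have Q0 : 0 <= Q a.+1%:R 0 by rewrite /Q !(mulr_ge0, addr_ge0) // ?mul0r // invr_ge0.
  rewrite -[b.+1%:R]natr1.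
  move: (Q a.+1%:R 0) (H a.+1 b)%:R h1 h2 Q0 => q h h1 h2 Q0.
  set B : R := b%:R in b0 h1 h2 *; set U : R := T%:R in T0 h1 h2 *.
  set E : R := e%:R in E0 h1 h2 *; set AD := a.+1%:R * D%:R.
  have AD0 : 0 <= AD by apply: mulr_ge0.
  have UB : 0 <= U * B by apply: mulr_ge0.
  have UE : 0 <= U * E by apply: mulr_ge0.
  have UEE : 0 <= U * E * E by apply: mulr_ge0.
  have UEB : 0 <= U * E * B by apply: mulr_ge0.
  have UEEB : 0 <= U * E * E * B by apply: mulr_ge0.
  have ADB : 0 <= AD * B by apply: mulr_ge0.
  have qB : 0 <= q * B by apply: mulr_ge0.
  rewrite ler_norml; apply/andP; split.
    lra.
  lra.
exists k, l => x y; rewrite step2.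
have : p.[y] = l * y + k by rewrite hp !hornerE.
rewrite /p !(hornerD, hornerN, hornerZ, hornerXn).
by move: (chi.[0, y]) (Q x y) (Q 0 y) => *; lra.
Qed.

End HilbertPolynomial.

Section DynDeg.
Variable R : realType.
Variables (d : nat) (c : algC).
Hypotheses (d3 : (3 <= d)%N) (c0 : c != 0).

Local Notation F := (henon d c).

Lemma henon_mixed_degree n i : (1 <= i <= 2)%N ->
  mixed_degree (iterate F n) i ((if i == 1%N then d ^ n else 2 ^ n)%N%:R : R).
Proof.
move=> hi; have hG := iterate_homog c d3 n; have rG := iterate_ratmap c d3 n.
have [chi [N hchi]] := hilb_evpoly hG R.
have hge a b : (b * d ^ n <= a)%N ->
    ('C(a + 2, 2) * 2 <= hilb (iterate F n) (d ^ n) a b + 'C(a - b * d ^ n + 2, 2))%N.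
  by apply: hilb_ge_coprime => //; have [] := iterate_coprime d3 n c0.
have [k [l shape]] := @hilbert_poly_shape R (hilb (iterate F n) (d ^ n)) (d ^ n) (2 ^ n)
  (hilb_le _ _) hge (hilb_ge_topdeg c d3 n) (hilb_le_topdeg c d3 n) chi N hchi.
exists chi.
  exists N => a b Na Nb; exists (hilb (iterate F n) (d ^ n) a b); last exact: hchi.
  exact: hilb_coord_dim.
(* For i = 1 the second difference is the coefficient d^n of xy. For i = 2 it is twice the
   coefficient of y^2, that is 2^n, since Q x y - Q 0 y vanishes at x = 0. *)
by case: i hi => [|[|[|]]] //= _; rewrite /intersection /= !shape; field.
Qed.

Lemma expn_root (m : nat) : (fun n : nat => ((m ^ n)%:R : R) `^ n%:R^-1) @ \oo --> (m%:R : R).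
Proof.
apply: cvg_near_cst; exists 1%N => // n /= n1.
by rewrite natrX -powR_mulrn // -powRrM mulfV ?powRr1 // pnatr_eq0 -lt0n.
Qed.

Lemma henon_dominant : dominant F.
Proof.
have rF : is_ratmap F.
  have <- : iterate F 1 = F by apply: eq_from_tnth => i; rewrite tnth_mktuple comp_mpoly_id.
  exact: iterate_ratmap.
split=> //; apply/seteqP; split=> // Q _ phi [[b [q hq phiE]] h].
rewrite phiE; suff -> : q = 0 by rewrite /eval3 meval0.
apply: (@comp_henon_eq0 d c b) => //; have X0 : ('X_i0 : {mpoly algC[3]}) != 0.
  by rewrite -msupp_eq0 msuppX.
have [_ [j Fj0]] := rF; apply: (mulIf Fj0); apply: (mulIf X0); rewrite !mul0r.
apply: eval3_fun_eq0 => v; rewrite /eval3 !mevalM mevalXU -!/(eval3 _ _).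
have [->|v0] := eqVneq (v 0 i0) 0; first by rewrite mulr0.
have vN : v != 0 by apply: contra_neq v0 => ->; rewrite mxE.
have [->|Fv] := eqVneq (eval3 (tnth F j) v) 0; first by rewrite mulr0 mul0r.
have FvN : evalt F v != 0 by apply: contra_neq Fv => /rowP/(_ j); rewrite !mxE.
have [l l0 lE] := coords_P2of vN; have [r r0 rE] := coords_P2of FvN.
have hF := henon_homog c d3.
have := h (P2of FvN) _; rewrite phiE rE (eval3Z _ _ hq) => /(_ _)/eqP.
rewrite mulf_eq0 expf_eq0 (negbTE r0) andbF /= eval3_comp => h'.
suff /h'/eqP -> : exists P, maps_to F P (P2of FvN) by rewrite !mul0r.
exists (P2of vN); apply: maps_toP => //; rewrite lE (evaltZ _ _ hF).
  by rewrite scaler_eq0 expf_eq0 (negbTE l0) andbF.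
by exists (l ^+ d / r); rewrite rE scalerA divfK.
Qed.

Lemma henon_dynamical_degree i : (1 <= i <= 2)%N ->
  dynamical_degree F i ((if i == 1%N then d else 2)%:R : R).
Proof.
move=> hi; split; first exact: henon_dominant.
exists (fun n => (if i == 1%N then d ^ n else 2 ^ n)%N%:R) => [n _|].
  exact: henon_mixed_degree.
by case: ifP => _; apply: expn_root.
Qed.

Lemma henon_coh_hyperbolic : coh_hyperbolic R F 1.
Proof.
split=> //; exists (fun i => (if i == 1%N then d else 2)%:R); first exact: henon_dynamical_degree.
move=> j hj; split=> [h|->] //=; last first.
  by move=> [|[|[|]]] //= _; rewrite ler_nat ltnW.
case: j hj h => [|[|[|]]] //= _ /(_ 1%N isT) /=; rewrite ler_nat leqNgt d3 //.
Qed.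

End DynDeg.

Lemma fdpE d p : fdp d p = henon d (p%:R ^- (d - 3)).
Proof. by []. Qed.

(** * Polynomials in two variables *)

(** The outer variable is the second coordinate, so q is a polynomial in y. A general ring is
    allowed because in [tower_polynomial] the scalars are themselves polynomials. *)
Definition ev2 (S : comNzRingType) (q : {poly {poly S}}) (x y : S) : S := q.[y%:P].[x].

Section Ev2.
Variable S : comNzRingType.
Implicit Types (q : {poly {poly S}}) (a u v w x y : S).

Lemma ev2D q q' x y : ev2 (q + q') x y = ev2 q x y + ev2 q' x y.
Proof. by rewrite /ev2 !hornerD. Qed.

Lemma ev2N q x y : ev2 (- q) x y = - ev2 q x y.
Proof. by rewrite /ev2 !hornerN. Qed.

Lemma ev2M q q' x y : ev2 (q * q') x y = ev2 q x y * ev2 q' x y.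
Proof. by rewrite /ev2 !hornerM. Qed.

Lemma ev2C a x y : ev2 a%:P%:P x y = a.
Proof. by rewrite /ev2 !hornerC. Qed.

Lemma ev2X x y : ev2 'X%:P x y = x.
Proof. by rewrite /ev2 hornerC hornerX. Qed.

Lemma ev2Y x y : ev2 'X x y = y.
Proof. by rewrite /ev2 hornerX hornerC. Qed.

Lemma ev2_coef q x y : ev2 q x y = \sum_(i < size q) (q`_i).[x] * y ^+ i.
Proof.
rewrite /ev2 (horner_coef q) horner_sum; apply: eq_bigr => i _.
by rewrite hornerM -rmorphXn hornerC.
Qed.

Lemma ev2_exp q n x y : ev2 (q ^+ n) x y = ev2 q x y ^+ n.
Proof. by elim: n => [|n IH]; rewrite ?expr0 ?exprS ?ev2M ?IH // -polyC1 -polyC1 ev2C. Qed.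

Lemma ev2_sum (I : Type) (r : seq I) (P : pred I) (Q : I -> {poly {poly S}}) x y :
  ev2 (\sum_(i <- r | P i) Q i) x y = \sum_(i <- r | P i) ev2 (Q i) x y.
Proof. by rewrite /ev2 !horner_sum. Qed.

Lemma ev2_even_odd q x y :
  ev2 q x y = ev2 (even_poly q) x (y ^+ 2) + y * ev2 (odd_poly q) x (y ^+ 2).
Proof.
rewrite -{1}(poly_even_odd q) ev2D ev2M ev2Y [y * _]mulrC.
by rewrite /ev2 !horner_comp !hornerXn -!rmorphXn.
Qed.

Lemma ev2_clear (c : S) d q : exists m (q' : {poly {poly S}}), forall u v w,
  w * (u + c) = v ^+ d -> ev2 q' u v = (u + c) ^+ m * ev2 q v w.
Proof.
exists (size q), (\sum_(i < size q)
  map_poly polyC q`_i * ('X^d) ^+ i * (('X + c%:P) ^+ (size q - i))%:P) => u v w e.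
rewrite ev2_sum ev2_coef mulr_sumr; apply: eq_bigr => i _.
rewrite !ev2M !ev2_exp ev2Y.
have -> : ev2 (map_poly polyC q`_i) u v = (q`_i).[v] by rewrite /ev2 horner_map hornerC.
have -> : ev2 (('X + c%:P) ^+ (size q - i))%:P u v = (u + c) ^+ (size q - i).
  by rewrite /ev2 hornerC horner_exp !hornerE.
have -> : (u + c) ^+ size q = (u + c) ^+ (size q - i) * (u + c) ^+ i.
  by rewrite -exprD subnK // ltnW.
by rewrite -e exprMn; ring.
Qed.

(** The norm of the quadratic extension w^2 = v^d / (u + c): the product over w and -w is even in w,
    hence polynomial in u and v up to a power of u + c. *)
Lemma ev2_norm (c : S) d q : exists m (q' : {poly {poly S}}), forall u v w,
  w ^+ 2 * (u + c) = v ^+ d ->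
  ev2 q' u v = (u + c) ^+ m * (ev2 q v w * ev2 q v (- w)).
Proof.
have [m [q' h]] := ev2_clear c d (even_poly q ^+ 2 - 'X * odd_poly q ^+ 2).
exists m, q' => u v w /h ->; congr (_ * _).
rewrite !(ev2_even_odd q) sqrrN ev2D ev2N ev2M !ev2_exp ev2Y; ring.
Qed.

End Ev2.

(** Membership in the polynomial ring localized at the powers of l. *)
Definition quasipoly (l g : algC -> algC -> algC) : Prop :=
  exists m (q : {poly {poly algC}}), forall x y, l x y != 0 ->
    ev2 q x y = l x y ^+ m * g x y.

Definition ispoly2 (g : algC -> algC -> algC) : Prop :=
  exists q : {poly {poly algC}}, forall x y, g x y = ev2 q x y.

Section QuasiPoly.
Variable l : algC -> algC -> algC.
Hypothesis lp : ispoly2 l.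

Lemma quasipoly_ev2 q : quasipoly l (ev2 q).
Proof. by exists 0%N, q => x y _; rewrite expr0 mul1r. Qed.

Lemma quasipoly_inv : quasipoly l (fun x y => (l x y)^-1).
Proof.
exists 1%N, 1%:P%:P => x y l0; rewrite ev2C expr1 divff //.
Qed.

Lemma quasipolyM g g' : quasipoly l g -> quasipoly l g' ->
  quasipoly l (fun x y => g x y * g' x y).
Proof.
move=> [m [q h]] [m' [q' h']]; exists (m + m')%N, (q * q') => x y l0.
by rewrite ev2M h // h' // exprD; ring.
Qed.

Lemma quasipolyD g g' : quasipoly l g -> quasipoly l g' ->
  quasipoly l (fun x y => g x y + g' x y).
Proof.
move=> [m [q h]] [m' [q' h']]; have [L hL] := lp.
exists (m + m')%N, (q * L ^+ m' + q' * L ^+ m) => x y l0.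
by rewrite ev2D !ev2M !ev2_exp -hL h // h' // exprD; ring.
Qed.

Lemma quasipoly_ext g g' : (forall x y, l x y != 0 -> g x y = g' x y) ->
  quasipoly l g -> quasipoly l g'.
Proof. by move=> e [m [q h]]; exists m, q => x y l0; rewrite h // e. Qed.

Lemma quasipoly_const a : quasipoly l (fun _ _ => a).
Proof. by apply: (quasipoly_ext _ (quasipoly_ev2 a%:P%:P)) => x y _; rewrite ev2C. Qed.

Lemma quasipoly_exp g n : quasipoly l g -> quasipoly l (fun x y => g x y ^+ n).
Proof.
move=> hg; elim: n => [|n IH].
  exact: (quasipoly_ext (g := fun _ _ => 1) _ (quasipoly_const 1)).
by apply: quasipoly_ext (quasipolyM hg IH) => x y _; rewrite exprS.
Qed.

Lemma quasipoly_sum n (G : 'I_n -> algC -> algC -> algC) :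
  (forall i, quasipoly l (G i)) -> quasipoly l (fun x y => \sum_i G i x y).
Proof.
elim: n G => [|n IH] G hG.
  by apply: quasipoly_ext (quasipoly_const 0) => x y _; rewrite big_ord0.
apply: quasipoly_ext (quasipolyD (hG ord0) (IH _ (fun i => hG (lift ord0 i)))) => x y _.
by rewrite big_ord_recl.
Qed.

Lemma quasipoly_comp q g g' : quasipoly l g -> quasipoly l g' ->
  quasipoly l (fun x y => ev2 q (g x y) (g' x y)).
Proof.
move=> hg hg'.
have h1 (r : {poly algC}) : quasipoly l (fun x y => r.[g x y]).
  have h : forall i : 'I_(size r), quasipoly l (fun x y => r`_i * g x y ^+ i).
    by move=> i; apply: quasipolyM (quasipoly_exp _ hg); apply: quasipoly_const.
  by apply: quasipoly_ext (quasipoly_sum h) => x y _; rewrite horner_coef.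
have h : forall i : 'I_(size q), quasipoly l (fun x y => (q`_i).[g x y] * g' x y ^+ i).
  by move=> i; apply: quasipolyM (h1 _) (quasipoly_exp _ hg').
by apply: quasipoly_ext (quasipoly_sum h) => x y _; rewrite ev2_coef.
Qed.

End QuasiPoly.

Section Dehomogenize.

Lemma ispoly2D g g' : ispoly2 g -> ispoly2 g' -> ispoly2 (fun x y => g x y + g' x y).
Proof. by move=> [q h] [q' h']; exists (q + q') => x y; rewrite ev2D h h'. Qed.

Lemma ispoly2M g g' : ispoly2 g -> ispoly2 g' -> ispoly2 (fun x y => g x y * g' x y).
Proof. by move=> [q h] [q' h']; exists (q * q') => x y; rewrite ev2M h h'. Qed.

Lemma ispoly2C a : ispoly2 (fun _ _ => a).
Proof. by exists a%:P%:P => x y; rewrite ev2C. Qed.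

Lemma ispoly2X : ispoly2 (fun x _ => x).
Proof. by exists 'X%:P => x y; rewrite ev2X. Qed.

Lemma ispoly2Y : ispoly2 (fun _ y => y).
Proof. by exists 'X => x y; rewrite ev2Y. Qed.

Lemma ispoly2_exp g n : ispoly2 g -> ispoly2 (fun x y => g x y ^+ n).
Proof. by move=> [q h]; exists (q ^+ n) => x y; rewrite ev2_exp h. Qed.

Lemma ispoly2_sum (I : Type) (r : seq I) (G : I -> algC -> algC -> algC) :
  (forall i, ispoly2 (G i)) -> ispoly2 (fun x y => \sum_(i <- r) G i x y).
Proof.
move=> /choice[Q hQ]; exists (\sum_(i <- r) Q i) => x y.
by rewrite ev2_sum; apply: eq_bigr.
Qed.

Lemma ispoly2_coef (E : {poly {poly {poly algC}}}) i :
  ispoly2 (fun x y => (ev2 E x%:P y%:P)`_i).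
Proof.
have h (x y : algC) : (ev2 E x%:P y%:P)`_i =
    \sum_(j < size E) \sum_(k < size (E`_j)%R) ((E`_j)`_k)`_i * x ^+ k * y ^+ j.
  rewrite ev2_coef coef_sum; apply: eq_bigr => j _.
  rewrite -rmorphXn coefMC horner_coef coef_sum mulr_suml; apply: eq_bigr => k _.
  by rewrite -rmorphXn coefMC.
have [q hq] : ispoly2 (fun x y =>
    \sum_(j < size E) \sum_(k < size (E`_j)%R) ((E`_j)`_k)`_i * x ^+ k * y ^+ j).
  apply: ispoly2_sum => j; apply: ispoly2_sum => k; apply: ispoly2M.
    by apply: ispoly2M; [exact: ispoly2C|exact/ispoly2_exp/ispoly2X].
  exact/ispoly2_exp/ispoly2Y.
by exists q => x y; rewrite h hq.
Qed.

Lemma ispoly2_meval n (p : {mpoly algC[n]}) (G : 'I_n -> algC -> algC -> algC) :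
  (forall i, ispoly2 (G i)) -> ispoly2 (fun x y => p.@[fun i => G i x y]).
Proof.
move=> /choice[Q hQ].
exists (\sum_(m <- msupp p) (p@_m)%:P%:P * \prod_i Q i ^+ m i) => x y.
rewrite mevalE ev2_sum; apply: eq_bigr => m _; rewrite ev2M ev2C; congr (_ * _).
have -> : forall (r : seq 'I_n), ev2 (\prod_(i <- r) Q i ^+ m i) x y = \prod_(i <- r) ev2 (Q i) x y ^+ m i.
  elim=> [|i r IH]; first by rewrite !big_nil -polyC1 -polyC1 ev2C.
  by rewrite !big_cons ev2M ev2_exp IH.
by apply: eq_bigr => i _; rewrite hQ.
Qed.

Lemma dehomogenize (p : {mpoly algC[3]}) : ispoly2 (fun x y => eval3 p (vec x y 1)).
Proof.
pose G (i : 'I_3) (x y : algC) := [:: x; y; 1]`_i.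
have hG : forall i, ispoly2 (G i).
  by elim/ord3P; [apply: ispoly2X|apply: ispoly2Y|apply: ispoly2C].
have [q hq] := ispoly2_meval p hG; exists q => x y; rewrite -hq.
by apply: meval_eq => i; rewrite mxE.
Qed.

(** All large degrees are offered so that several polynomials can be homogenized in one common
    degree. *)
Lemma homogenize (q : {poly {poly algC}}) : exists N, forall m, (N <= m)%N ->
  exists2 p : {mpoly algC[3]}, p \is m.-homog &
    forall x y z, z != 0 -> eval3 p (vec (z * x) (z * y) z) = z ^+ m * ev2 q x y.
Proof.
exists (size q + \sum_(j < size q) size (q`_j)%R)%N => m hm.
have lem (j : 'I_(size q)) (k : 'I_(size (q`_j)%R)) : (k + j <= m)%N.
  have h1 := ltn_ord j; have h2 := ltn_ord k.
  have : (size (q`_j)%R <= \sum_(j < size q) size (q`_j)%R)%N by rewrite (bigD1 j) //= leq_addr.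
  by move: h1 h2 hm; lia.
exists (\sum_(j < size q) \sum_(k < size (q`_j)%R)
   (q`_j)`_k *: ('X_i0 ^+ k * 'X_i1 ^+ j * 'X_i2 ^+ (m - (k + j)))).
  apply: rpred_sum => j _; apply: rpred_sum => k _; apply: rpredZ.
  have X i n : ('X_i ^+ n : {mpoly algC[3]}) \is n.-homog.
    by rewrite -{2}[n]mul1n dhomogMn // dhomogX /= mdeg1.
  by have := dhomogM (dhomogM (X i0 k) (X i1 j)) (X i2 (m - (k + j))%N); rewrite subnKC.
move=> x y z z0; rewrite /eval3 raddf_sum ev2_coef mulr_sumr; apply: eq_bigr => j _ /=.
rewrite raddf_sum horner_coef mulr_suml mulr_sumr; apply: eq_bigr => k _ /=.
rewrite mevalZ !mevalM !rmorphXn /= !mevalXU !mxE /= !exprMn.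
have -> : z ^+ m = z ^+ (m - (k + j)) * z ^+ k * z ^+ j.
  by rewrite -!exprD -addnA subnK.
by ring.
Qed.

End Dehomogenize.

(** * The map in an affine chart *)

Section AffineDynamics.
Variables (d : nat) (c : algC).
Hypothesis d0 : (0 < d)%N.

Implicit Types (p : algC * algC) (S : set (algC * algC)).

Definition ft p : algC * algC := (p.1 ^+ d / p.2 ^+ 2 - c, p.1).

Lemma ft_root u v : u + c != 0 ->
  exists w : algC, w ^+ 2 * (u + c) = v ^+ d.
Proof. by move=> h; exists (sqrtC (v ^+ d / (u + c))); rewrite sqrtCK divfK. Qed.

Lemma ftE u v w : v != 0 -> u + c != 0 -> w ^+ 2 * (u + c) = v ^+ d ->
  w != 0 /\ ft (v, w) = (u, v).
Proof.
move=> v0 uc e; have w0 : w != 0.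
  by apply: contra_neq (expf_neq0 d v0) => w0; rewrite -e w0 expr0n mul0r.
by split=> //; rewrite /ft /= -e mulrC mulKf ?expf_neq0 // addrK.
Qed.

Lemma ft_rel p : p.2 != 0 -> p.2 ^+ 2 * ((ft p).1 + c) = (ft p).2 ^+ d.
Proof. by move=> h; rewrite /ft /= subrK mulrC divfK // expf_neq0. Qed.

(* All backward orbits of length [n] of [(u, v)] stay in the open set over which
   the map is finite. *)
Fixpoint good n (u v : algC) : Prop :=
  if n is n'.+1 then
    [/\ v != 0, u + c != 0 & forall w, w ^+ 2 * (u + c) = v ^+ d -> good n' v w]
  else True.

Lemma good_leS n u v : good n.+1 u v -> good n u v.
Proof.
elim: n u v => [//|n IH] u v [v0 uc h]; split=> // w /h; exact: IH.
Qed.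

(** The condition concerns both preimages (v, w) and (v, -w); the norm of the equation for n is
    nonzero exactly when it holds at both. *)
Lemma good_open n : exists g : {poly {poly algC}}, forall u v,
  good n u v <-> ev2 g u v != 0.
Proof.
elim: n => [|n [g hg]]; first by exists 1%:P%:P => u v; rewrite ev2C oner_neq0.
have [m [q hq]] := ev2_norm c d g.
exists ('X * ('X%:P + c%:P%:P) * q) => u v.
rewrite !ev2M ev2D ev2C ev2X ev2Y !mulf_eq0 !negb_or; split.
  move=> [v0 uc h]; rewrite v0 uc /=; have [w e] := ft_root v uc.
  by rewrite (hq _ _ _ e) !mulf_neq0 ?expf_neq0 //; apply/hg/h; rewrite ?sqrrN.
move=> /andP[/andP[v0 uc] q0]; split=> // w e; apply/hg.
by move: q0; rewrite (hq _ _ _ e) !mulf_eq0 !negb_or => /and3P[].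
Qed.

(** The inverse image of S under n steps. The condition on p.2 keeps the division in [ft]
    meaningful, that on p.1 makes the second coordinate of the image nonzero. *)
Fixpoint tower S n : set (algC * algC) :=
  if n is n'.+1 then [set p | [/\ p.1 != 0, p.2 != 0 & tower S n' (ft p)]] else S.

Lemma tower_setT S n p : tower S n p <-> tower setT n p /\ S (iter n ft p).
Proof.
elim: n p => [|n IH] p /=; first by split=> // -[].
rewrite -iterS iterSr; split=> [[x0 y0 /IH[]]|[[x0 y0 h] h']] //.
by split=> //; apply/IH.
Qed.

Lemma tower_last n p : tower setT n.+1 p <->
  [/\ tower setT n p, (iter n ft p).1 != 0 & (iter n ft p).2 != 0].
Proof.
elim: n p => [|n IH] p; first by split=> [[]|[]].
split=> [[x0 y0 /IH[h1 h2 h3]]|]; first by rewrite iterSr.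
by rewrite iterSr => -[[x0 y0 h1] h2 h3]; split=> //; apply/IH.
Qed.

Lemma good_tower_sub n k j p : (j + k <= n)%N ->
  tower (fun q => good n q.1 q.2) j p -> good k p.1 p.2.
Proof.
elim: j k p => [|j IH] k p /=.
  by rewrite add0n => kn; rewrite -(subnK kn); elim: (n - k)%N => // i IHi /good_leS.
rewrite addSnnS => h [x0 y0 /(IH _ _ h)] /= [_ _]; apply.
by rewrite subrK mulrC divfK // expf_neq0.
Qed.

(** Obtained from T - v by iterated norms. The degree is exact, so the leading coefficient does not
    vanish over the good locus, which makes y integral there; the nonzero constant term does the
    same for 1/y. The condition on v matters at n = 0, where [good] is empty. *)
Lemma tower_polynomial n : exists E : {poly {poly {poly algC}}},
  (forall p, tower setT n p ->
     root (ev2 E (iter n ft p).1%:P (iter n ft p).2%:P) p.2) /\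
  (forall u v, good n u v -> v != 0 ->
     size (ev2 E u%:P v%:P) = (2 ^ n).+1 /\ ~~ root (ev2 E u%:P v%:P) 0).
Proof.
elim: n => [|n [E [hr hs]]].
  exists ('X%:P%:P - 'X); split=> [p _|u v _ v0]; rewrite ev2D ev2N ev2C ev2Y.
    by rewrite root_XsubC.
  by rewrite size_XsubC root_XsubC eq_sym.
have [m [q hq]] := ev2_norm c%:P d E.
have hq' u v w : w ^+ 2 * (u + c) = v ^+ d ->
    ev2 q u%:P v%:P = (u + c)%:P ^+ m * (ev2 E v%:P w%:P * ev2 E v%:P (- w)%:P).
  by move=> e; rewrite polyCN polyCD (@hq _ _ w%:P) // -polyCD -!rmorphXn -rmorphM /= e.
exists q; split=> [p /tower_last[hp x0 y0]|u v [v0 uc h] _].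
  rewrite iterS; case: (iter n ft p) (hr p hp) x0 y0 => v w /= rw v0 w0.
  rewrite (@hq' _ _ w) /=; last by rewrite subrK mulrC divfK // expf_neq0.
  by rewrite !rootM rw orbT.
have [w e] := ft_root v uc; have [w0 _] := ftE v0 uc e.
have [s1 r1] := hs _ _ (h _ e) w0.
have [s2 r2] : size (ev2 E v%:P (- w)%:P) = (2 ^ n).+1 /\ ~~ root (ev2 E v%:P (- w)%:P) 0.
  by apply: hs; rewrite ?oppr_eq0 //; apply: h; rewrite sqrrN.
have n1 : ev2 E v%:P w%:P != 0 by rewrite -size_poly_gt0 s1.
have n2 : ev2 E v%:P (- w)%:P != 0 by rewrite -size_poly_gt0 s2.
rewrite (hq' _ _ _ e) -rmorphXn; split.
  rewrite size_Cmul ?expf_neq0 // size_mul // s1 s2 expnS mul2n -addnn /=; lia.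
by rewrite !rootM rootC !negb_or expf_neq0 // r1 r2.
Qed.

Definition ev2p (q : {poly {poly algC}}) p : algC := ev2 q p.1 p.2.

(* Cleared denominators: for a fraction [a / b] representing [phi] where
   [b != 0], the equation [phi * b ^ 2 = a * b] holds everywhere. *)
Definition aregular S (phi : algC * algC -> algC) : Prop :=
  forall p, S p -> exists a b : {poly {poly algC}},
    ev2p b p != 0 /\ forall p', S p' -> phi p' * ev2p b p' = ev2p a p'.

Lemma aregularM S phi psi : aregular S phi -> aregular S psi ->
  aregular S (fun p => phi p * psi p).
Proof.
move=> h h' p Sp; have [a [b [b0 e]]] := h p Sp; have [a' [b' [b0' e']]] := h' p Sp.
exists (a * a'), (b * b'); split=> [|q Sq]; rewrite /ev2p !ev2M; first by rewrite mulf_neq0.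
by rewrite mulrACA -!/(ev2p _ _) e // e'.
Qed.

Lemma aregular_poly S q : aregular S (ev2p q).
Proof.
move=> p Sp; exists q, 1%:P%:P; rewrite /ev2p ev2C oner_neq0; split=> // p' _.
by rewrite ev2C mulr1.
Qed.

Lemma quasipoly_ft q : quasipoly (fun _ y => y) (fun x y => ev2p q (ft (x, y))).
Proof.
have Y := ispoly2Y.
have hX : quasipoly (fun _ y => y) (fun x y => x).
  by apply: (quasipoly_ext _ (quasipoly_ev2 _ 'X%:P)) => x y _; rewrite ev2X.
apply: (quasipoly_ext (g := fun x y => ev2 q (x ^+ d * y^-1 ^+ 2 + - c) x)) => [x y _|].
  by rewrite /ev2p /ft /= exprVn.
apply: quasipoly_comp => //; apply: quasipolyD => //; last exact: quasipoly_const.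
by apply: quasipolyM; apply: quasipoly_exp => //; apply: quasipoly_inv.
Qed.

Lemma aregular_ft S phi : aregular S phi -> aregular (tower S 1) (phi \o ft).
Proof.
move=> h p [x0 y0 /h[a [b [b0 e]]]].
have [m [a' ha]] := quasipoly_ft a; have [m' [b' hb]] := quasipoly_ft b.
exists (a' * 'X ^+ m'), (b' * 'X ^+ m); split=> [|q [x0' y0' /e e']]; rewrite /ev2p !ev2M !ev2_exp ev2Y.
  case: p x0 y0 b0 => x y /= x0 y0 b0; rewrite hb //= !mulf_neq0 ?expf_neq0 //.
case: q x0' y0' e' => x y /= x0' y0' e'; rewrite ha //= hb //= -e'; ring.
Qed.

Section Step.
Variable S : set (algC * algC).
Hypothesis hS : forall p, S p -> p.2 != 0 /\ p.1 + c != 0.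

Let quasi_v2 q : quasipoly (fun u v => u + c) (fun u v => ev2 q v (v ^+ d / (u + c))).
Proof.
have L : ispoly2 (fun u _ => u + c) by apply: ispoly2D; [apply: ispoly2X|apply: ispoly2C].
have hV : quasipoly (fun u _ => u + c) (fun u v => v).
  by apply: (quasipoly_ext _ (quasipoly_ev2 _ 'X)) => x y _; rewrite ev2Y.
apply: quasipoly_comp => //; apply: quasipolyM; last exact: quasipoly_inv.
exact: quasipoly_exp.
Qed.

(* Average over the two preimages [(v, w)] and [(v, -w)] of [(u, v)], using a
   denominator that vanishes at neither of them. *)
Lemma aregular_step phi : aregular (tower S 1) phi -> exists b0 b1,
  [/\ aregular S b0, aregular S b1 &
      forall p, tower S 1 p -> phi p = b0 (ft p) + p.2 * b1 (ft p)].
Proof.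
move=> hphi; pose w p := sqrtC (p.2 ^+ d / (p.1 + c)).
have wE p : S p -> w p ^+ 2 * (p.1 + c) = p.2 ^+ d.
  by move=> /hS[_ uc]; rewrite /w sqrtCK divfK.
pose b0 p := (phi (p.2, w p) + phi (p.2, - w p)) / 2.
pose b1 p := (phi (p.2, w p) - phi (p.2, - w p)) / (2 * w p).
have two0 : (2 : algC) != 0 by rewrite pnatr_eq0.
have inT p x : S p -> x ^+ 2 * (p.1 + c) = p.2 ^+ d -> tower S 1 (p.2, x).
  move=> Sp e; have [v0 uc] := hS Sp; have [x0 xE] := ftE v0 uc e.
  by split=> //=; rewrite xE; case: (p) Sp.
have w0 p : S p -> w p != 0.
  by move=> Sp; have [v0 uc] := hS Sp; have [] := ftE v0 uc (wE _ Sp).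
have key p : S p -> exists A0 A1 N0 : {poly {poly algC}},
    ev2 N0 p.2 (w p ^+ 2) != 0 /\ forall q, S q ->
    b0 q * ev2 N0 q.2 (w q ^+ 2) = ev2 A0 q.2 (w q ^+ 2) /\
    b1 q * ev2 N0 q.2 (w q ^+ 2) = ev2 A1 q.2 (w q ^+ 2).
  move=> Sp; have T1 := inT _ _ Sp (wE _ Sp).
  have T2 : tower S 1 (p.2, - w p) by apply: inT => //; rewrite sqrrN wE.
  have [a1 [d1 [d10 e1]]] := hphi _ T1; have [a2 [d2 [d20 e2]]] := hphi _ T2.
  (* If the first denominator vanishes at the second preimage and the second one at the first, their
     sum vanishes at neither. *)
  have [a [b [bp bm e]]] : exists a b, [/\ ev2p b (p.2, w p) != 0, ev2p b (p.2, - w p) != 0 &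
      forall q, tower S 1 q -> phi q * ev2p b q = ev2p a q].
    have [z1|n1] := eqVneq (ev2p d1 (p.2, - w p)) 0; last by exists a1, d1.
    have [z2|n2] := eqVneq (ev2p d2 (p.2, w p)) 0; last by exists a2, d2.
    exists (a1 + a2), (d1 + d2); rewrite /ev2p !ev2D -!/(ev2p _ _) z1 z2 addr0 add0r.
    by split=> // q Tq; rewrite !ev2D mulrDr -!/(ev2p _ _) e1 // e2.
  (* The product with the conjugate denominator is even in y, hence a function of y^2, which
     descends. The even and odd parts of the new numerator give [b0] and [b1]. *)
  pose bb := b \Po (- 'X); pose N := b * bb; pose A := a * bb.
  have bbE x y : ev2 bb x y = ev2 b x (- y).
    by rewrite /ev2 horner_comp hornerN hornerX polyCN.
  have NE x y : ev2 N x y = ev2 (even_poly N) x (y ^+ 2).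
    apply: (mulfI two0); rewrite !mulr_natl !mulr2n {1}(ev2_even_odd N).
    have -> : ev2 N x y = ev2 N x (- y) by rewrite /N !ev2M !bbE opprK mulrC.
    by rewrite (ev2_even_odd N) sqrrN; ring.
  have AE q y : S q -> y ^+ 2 * (q.1 + c) = q.2 ^+ d ->
      phi (q.2, y) * ev2 (even_poly N) q.2 (y ^+ 2) = ev2 A q.2 y.
    move=> Sq hy; have := e _ (inT _ _ Sq hy); rewrite /ev2p /= -NE /N /A !ev2M => <-.
    by rewrite mulrA.
  exists (even_poly A), (odd_poly A), (even_poly N); split.
    by rewrite -NE /N ev2M bbE mulf_neq0.
  move=> q Sq; have h1 := AE _ _ Sq (wE _ Sq).
  have h2 := AE q (- w q) Sq; rewrite sqrrN in h2; have {}h2 := h2 (wE _ Sq).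
  have wq0 := w0 _ Sq.
  have o1 := ev2_even_odd A q.2 (w q); have o2 := ev2_even_odd A q.2 (- w q).
  rewrite sqrrN in o2; rewrite o1 in h1; rewrite o2 in h2; rewrite /b0 /b1; split.
    by rewrite mulrAC mulrDl h1 h2; field.
  by rewrite mulrAC mulrBl h1 h2; field; rewrite wq0.
have reg b A p : S p -> forall N0 : {poly {poly algC}}, ev2 N0 p.2 (w p ^+ 2) != 0 ->
   (forall q, S q -> b q * ev2 N0 q.2 (w q ^+ 2) = ev2 A q.2 (w q ^+ 2)) ->
   exists a b', ev2p b' p != 0 /\ forall q, S q -> b q * ev2p b' q = ev2p a q.
  move=> Sp N0 n0 h.
  have [m [N' hN]] := quasi_v2 N0; have [m' [A' hA]] := quasi_v2 A.
  have w2 q : S q -> w q ^+ 2 = q.2 ^+ d / (q.1 + c).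
    by move=> Sq; rewrite -(wE _ Sq) mulfK //; have [] := hS Sq.
  exists (A' * ('X%:P + c%:P%:P) ^+ m), (N' * ('X%:P + c%:P%:P) ^+ m').
  have E q : S q -> ev2p (N' * ('X%:P + c%:P%:P) ^+ m') q =
      ((q.1 + c) ^+ m * ev2 N0 q.2 (w q ^+ 2)) * (q.1 + c) ^+ m'.
    move=> Sq; have [_ uc] := hS Sq.
    by rewrite /ev2p ev2M ev2_exp ev2D ev2C ev2X hN // w2.
  have E' q : S q -> ev2p (A' * ('X%:P + c%:P%:P) ^+ m) q =
      ((q.1 + c) ^+ m' * ev2 A q.2 (w q ^+ 2)) * (q.1 + c) ^+ m.
    move=> Sq; have [_ uc] := hS Sq.
    by rewrite /ev2p ev2M ev2_exp ev2D ev2C ev2X hA // w2.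
  split=> [|q Sq]; first by rewrite E // !mulf_neq0 ?expf_neq0 //; have [] := hS Sp.
  by rewrite E // E' // -h //; ring.
exists b0, b1; split.
- move=> p Sp; have [A0 [A1 [N0 [n0 h]]]] := key p Sp.
  by apply: (reg _ A0 p Sp N0 n0) => q /h[].
- move=> p Sp; have [A0 [A1 [N0 [n0 h]]]] := key p Sp.
  by apply: (reg _ A1 p Sp N0 n0) => q /h[].
move=> [x y] [/= x0 y0 Sp]; have wy : w (ft (x, y)) ^+ 2 = y ^+ 2.
  have [_ uc] := hS Sp; apply: (mulIf uc); rewrite wE // /ft /=.
  by rewrite subrK mulrC divfK // expf_neq0.
have wq0 := w0 _ Sp; rewrite /b0 /b1 [(ft (x, y)).2]/= .
move/eqP: wy; rewrite eqf_sqr => /orP[]/eqP wy; rewrite wy in wq0 *.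
  by field.
by rewrite opprK; field; rewrite oppr_eq0 in wq0.
Qed.

End Step.

(** Each step doubles the generators: by [aregular_step], the pullbacks of the old ones are joined
    by their products with y. *)
Lemma tower_finite S k :
  (forall j p, (j < k)%N -> tower S j p -> p.2 != 0 /\ p.1 + c != 0) ->
  exists (n : nat) (e : 'I_n -> algC * algC -> algC),
    (forall i, aregular (tower S k) (e i)) /\
    forall phi, aregular (tower S k) phi -> exists b : 'I_n -> algC * algC -> algC,
      (forall i, aregular S (b i)) /\
      forall p, tower S k p -> phi p = \sum_i b i (iter k ft p) * e i p.
Proof.
elim: k => [|k IH] hS.
  exists 1%N, (fun _ _ => 1); split=> [i|phi hphi].
    move=> p Sp; exists 1%:P%:P, 1%:P%:P; rewrite /ev2p ev2C oner_neq0.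
    by split=> // q _; rewrite ev2C mul1r.
  by exists (fun _ => phi); split=> // p Sp; rewrite big_ord1 mulr1.
have [|n [e [he hb]]] := IH; first by move=> j p jk; apply: hS; apply: ltnW.
exists (n + n)%N, (fun i p => match fintype.split i with
  inl i => e i (ft p) | inr i => p.2 * e i (ft p) end); split=> [i|phi].
  case: (fintype.split i) => {}i; first exact: (aregular_ft (he i)).
  apply: aregularM (aregular_ft (he i)).
  move=> p Sp; have [a [b [b0 h]]] := @aregular_poly (tower S k.+1) 'X p Sp.
  by exists a, b; split=> // q Sq; rewrite -h // /ev2p ev2Y.
move=> /(@aregular_step (tower S k) (fun p => hS k p (ltnSn k)))[b0 [b1 [h0 h1 E]]].
have [B0 [hB0 E0]] := hb _ h0; have [B1 [hB1 E1]] := hb _ h1.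
exists (fun i => match fintype.split i with inl i => B0 i | inr i => B1 i end).
split=> [i|p Tp]; first by case: (fintype.split i).
have [_ _ Tfp] := Tp; rewrite E // E0 // E1 // big_split_ord /= mulr_sumr; congr (_ + _).
  by apply: eq_bigr => i _; rewrite (unsplitK (inl i)) -iterS iterSr.
by apply: eq_bigr => i _; rewrite (unsplitK (inr i)) -iterS iterSr mulrCA.
Qed.

Lemma tower_open (g : {poly {poly algC}}) n : exists h : {poly {poly algC}},
  forall p, tower (fun q => ev2p g q != 0) n p <-> ev2p h p != 0.
Proof.
elim: n => [|n [h hh]]; first by exists g.
have [m [q hq]] := quasipoly_ft h.
exists ('X%:P * 'X * q) => -[x y]; rewrite /ev2p !ev2M ev2X ev2Y !mulf_eq0 !negb_or /=.
split=> [[x0 y0 /hh h0]|/andP[/andP[x0 y0] q0]].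
  by rewrite x0 y0 hq //= mulf_neq0 // expf_neq0.
by split=> //; apply/hh; move: q0; rewrite hq //= mulf_eq0 negb_or => /andP[].
Qed.

End AffineDynamics.

(** * Regular functions on spaces *)

Record graded (X : Defs.space) : Prop := Graded {
  form_mul : exists op : Defs.degree X -> Defs.degree X -> Defs.degree X,
    forall d e (a b : X -> algC), Defs.form d a -> Defs.form e b ->
      Defs.form (op d e) (fun x => a x * b x);
  form_add : forall d (a b : X -> algC), Defs.form d a -> Defs.form d b ->
    Defs.form d (fun x => a x + b x);
  form_scale : forall d (a : X -> algC) k, Defs.form d a -> Defs.form d (fun x => k * a x);
  form_nonzero : forall x : X, exists d (a : X -> algC), Defs.form d a /\ a x != 0 }.

Section Regular.
Variable X : Defs.space.
Hypothesis gX : graded X.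
Implicit Types (S : set X) (phi psi : X -> algC).

Definition fraction S phi (d : Defs.degree X) (a b : X -> algC) : Prop :=
  [/\ Defs.form d a, Defs.form d b & forall y, S y -> phi y * b y = a y].

(** Replacing a / b by ab / b^2 makes the identity valid at the zeros of the denominator as well. *)
Lemma regularP S phi : Defs.regular S phi <->
  forall x, S x -> exists d a b, fraction S phi d a b /\ b x != 0.
Proof.
split=> h x Sx; have := h x Sx.
  move=> [d [a [b [ha hb bx e]]]]; have [op hop] := form_mul gX.
  exists (op d d), (fun y => a y * b y), (fun y => b y * b y).
  split; last by rewrite mulf_neq0.
  split=> [||y Sy]; [exact: hop|exact: hop|].
  have [->|by0] := eqVneq (b y) 0; first by rewrite !mulr0.
  by rewrite e // mulrA divfK.
move=> [d [a [b [[ha hb e] bx]]]]; exists d, a, b; split=> // y Sy by0.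
by rewrite -e // mulfK.
Qed.

Lemma regularD S phi psi : Defs.regular S phi -> Defs.regular S psi ->
  Defs.regular S (fun x => phi x + psi x).
Proof.
move=> /regularP h /regularP h'; apply/regularP => x Sx.
have [d [a [b [[ha hb e] bx]]]] := h x Sx; have [d' [a' [b' [[ha' hb' e'] bx']]]] := h' x Sx.
have [op hop] := form_mul gX.
exists (op d d'), (fun y => a y * b' y + b y * a' y), (fun y => b y * b' y).
split; last by rewrite mulf_neq0.
split=> [||y Sy]; [by apply: form_add => //; exact: hop|exact: hop|].
by rewrite -e // -e' //; ring.
Qed.

Lemma regularM S phi psi : Defs.regular S phi -> Defs.regular S psi ->
  Defs.regular S (fun x => phi x * psi x).
Proof.
move=> /regularP h /regularP h'; apply/regularP => x Sx.
have [d [a [b [[ha hb e] bx]]]] := h x Sx; have [d' [a' [b' [[ha' hb' e'] bx']]]] := h' x Sx.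
have [op hop] := form_mul gX.
exists (op d d'), (fun y => a y * a' y), (fun y => b y * b' y).
split; last by rewrite mulf_neq0.
split=> [||y Sy]; [exact: hop|exact: hop|].
by rewrite -e // -e' //; ring.
Qed.

Lemma regularC S k : Defs.regular S (fun _ => k).
Proof.
apply/regularP => x Sx; have [d [a [ha ax]]] := form_nonzero gX x.
by exists d, (fun y => k * a y), a; split=> //; split=> //; apply: form_scale.
Qed.

Lemma regularX S phi n : Defs.regular S phi -> Defs.regular S (fun x => phi x ^+ n).
Proof.
move=> h; elim: n => [|n IH]; first exact: regularC.
by have := regularM h IH; congr (Defs.regular S _); apply: funext => x; rewrite exprS.
Qed.

Lemma regular_sum S (I : Type) (r : seq I) (Phi : I -> X -> algC) :
  (forall i, Defs.regular S (Phi i)) -> Defs.regular S (fun x => \sum_(i <- r) Phi i x).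
Proof.
move=> h; elim: r => [|i r IH].
  by have := @regularC S 0; congr (Defs.regular S _); apply: funext => x; rewrite big_nil.
by have := regularD (h i) IH; congr (Defs.regular S _); apply: funext => x; rewrite big_cons.
Qed.

Lemma regular_meval S n (p : {mpoly algC[n]}) (Phi : 'I_n -> X -> algC) :
  (forall i, Defs.regular S (Phi i)) -> Defs.regular S (fun x => p.@[fun i => Phi i x]).
Proof.
move=> h; have hm (m : 'X_{1..n}) : Defs.regular S (fun x => p@_m * \prod_i Phi i x ^+ m i).
  apply: regularM; first exact: regularC.
  elim: (index_enum _) => [|i r IH].
    by have := @regularC S 1; congr (Defs.regular S _); apply: funext => x; rewrite big_nil.
  have := regularM (regularX (m i) (h i)) IH.
  by congr (Defs.regular S _); apply: funext => x; rewrite big_cons.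
have := regular_sum (msupp p) hm.
by congr (Defs.regular S _); apply: funext => x; rewrite mevalE.
Qed.

Lemma regular_ev2 S q phi psi : Defs.regular S phi -> Defs.regular S psi ->
  Defs.regular S (fun x => ev2 q (phi x) (psi x)).
Proof.
move=> h h'.
have h1 (r : {poly algC}) : Defs.regular S (fun x => r.[phi x]).
  have := regular_sum (index_enum _)
    (fun i : 'I_(size r) => regularM (@regularC S r`_i) (regularX i h)).
  by congr (Defs.regular S _); apply: funext => x; rewrite horner_coef.
have := regular_sum (index_enum _)
  (fun i : 'I_(size q) => regularM (h1 q`_i) (regularX i h')).
by congr (Defs.regular S _); apply: funext => x; rewrite ev2_coef.
Qed.

Lemma regular_local_quotient S phi :
  (forall x, S x -> exists alpha beta, [/\ Defs.regular S alpha, Defs.regular S beta,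
     beta x != 0 & forall y, S y -> phi y * beta y = alpha y]) -> Defs.regular S phi.
Proof.
move=> h; apply/regularP => x Sx.
have [alpha [beta [/regularP h1 /regularP h2 bx E]]] := h x Sx.
have [d [a [b [[ha hb e] bx0]]]] := h1 x Sx; have [d' [a' [b' [[ha' hb' e'] bx0']]]] := h2 x Sx.
have [op hop] := form_mul gX.
exists (op d d'), (fun y => a y * b' y), (fun y => b y * a' y); split.
  by split=> [||y Sy]; [exact: hop|exact: hop|rewrite -e // -e' // -E //; ring].
by rewrite -e' // !mulf_neq0.
Qed.

Lemma regular_inv S phi : Defs.regular S phi -> (forall x, S x -> phi x != 0) ->
  Defs.regular S (fun x => (phi x)^-1).
Proof.
move=> h n0; apply: regular_local_quotient => x Sx; exists (fun _ => 1), phi.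
by split=> //; [exact: regularC|exact: n0|move=> y /n0 y0; rewrite mulVf].
Qed.

(** The closed set is cut out by the numerators of all the local fractions of the given
    functions. *)
Lemma regular_zeros S (E : set (X -> algC)) : (forall phi, E phi -> Defs.regular S phi) ->
  exists2 C : set X, zclosed C & forall x, S x -> (C x <-> forall phi, E phi -> phi x = 0).
Proof.
move=> h; pose A := [set a | exists d b phi, E phi /\ fraction S phi d a b].
exists (zeros A); first by exists A; split=> // a [d [b [phi [_ [ha _ _]]]]]; exists d.
move=> x Sx; split=> [Zx phi Ephi|Zx a [d [b [phi [/Zx phi0 [_ _ e]]]]]]; last first.
  by rewrite -e // phi0 mul0r.
have [d [a [b [fr bx]]]] := (regularP _ _).1 (h phi Ephi) x Sx.
have := Zx a; rewrite /A /= => /(_ (ex_intro _ d (ex_intro _ b (ex_intro _ phi (conj Ephi fr))))).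
case: fr => _ _ e; rewrite -e // => /eqP; rewrite mulf_eq0 (negbTE bx) orbF.
by move/eqP.
Qed.

Lemma morphism_to_affine n S (T : set (affine_space n)) (u : X -> affine_space n) :
  (forall x, S x -> T (u x)) -> (forall i : 'I_n, Defs.regular S (fun x => u x i)) ->
  Defs.morphism S T u.
Proof.
move=> uT ur; split=> // [C [E [Ef ->]]|O phi _ hphi].
  have [|C' C'c hC'] := @regular_zeros S [set a \o u | a in E].
    move=> _ [a /Ef[d [p ap]] <-].
    have := regular_meval p ur; congr (Defs.regular S _); apply: funext => x.
    by rewrite /= ap; apply: meval_eq.
  exists C' => //; apply/seteqP; split=> x [Sx hx]; split=> //.
    by apply/(hC' x Sx) => _ [a Ea <-]; apply: hx.
  by move=> a Ea; apply: ((hC' x Sx).1 hx (a \o u)); exists a.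
apply: regular_local_quotient => x [Sx Ox].
have [d [a [b [[p pE] [q qE] bx e]]]] := hphi (u x) (conj (uT _ Sx) Ox).
pose r := p * q; pose s := q * q.
have sub phi' : Defs.regular S phi' -> Defs.regular (S `&` u @^-1` O) phi'.
  move=> h z [Sz _]; have [d' [a' [b' [ha hb bz e']]]] := h z Sz.
  by exists d', a', b'; split=> // y [Sy _]; apply: e'.
exists (fun y => r.@[u y]), (fun y => s.@[u y]); split.
- exact/sub/regular_meval.
- exact/sub/regular_meval.
- by rewrite mevalM -qE mulf_neq0.
move=> y [Sy Oy]; rewrite !mevalM -pE -qE.
have [->|by0] := eqVneq (b (u y)) 0; first by rewrite !mulr0.
by rewrite /= (e _ (conj (uT _ Sy) Oy) by0) mulrA divfK.
Qed.

End Regular.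

Lemma graded_P2 : graded P2.
Proof.
split.
- exists addn => d e a b [p hp pE] [q hq qE]; exists (p * q); first exact: dhomogM.
  by move=> P; rewrite pE qE /eval3 mevalM.
- move=> d a b [p hp pE] [q hq qE]; exists (p + q); first exact: rpredD.
  by move=> P; rewrite pE qE /eval3 mevalD.
- move=> d a k [p hp pE]; exists (k *: p); first exact: rpredZ.
  by move=> P; rewrite pE /eval3 mevalZ.
move=> P; have [i Pi] : exists i, coords P 0 i != 0.
  apply: contrapT => h; have := coords_neq0 P; rewrite (vecE (coords P)) vec_eq0.
  case/negP; apply/and3P; split; apply/eqP; apply: contrapT => /eqP n0; apply: h;
    [by exists i0|by exists i1|by exists i2].
exists 1%N, (fun Q => eval3 'X_i (coords Q)); split; last by rewrite /eval3 mevalXU.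
by exists 'X_i => //; rewrite dhomogX /= mdeg1.
Qed.

Lemma graded_prod (X Y : Defs.space) : graded X -> graded Y -> graded (prod_space X Y).
Proof.
move=> gX gY; have [opX hX] := form_mul gX; have [opY hY] := form_mul gY; split.
- exists (fun d e => (opX d.1 e.1, opY d.2 e.2)).
  move=> d e a b [m [u [v [hu hv aE]]]] [m' [u' [v' [hu' hv' bE]]]].
  pose I := ('I_m * 'I_m')%type; pose dec (k : 'I_#|{: I}|) : I := enum_val k.
  exists #|{: I}|, (fun k x => u (dec k).1 x * u' (dec k).2 x), (fun k y => v (dec k).1 y * v' (dec k).2 y).
  split=> [k|k|x y]; [exact: hX|exact: hY|].
  rewrite aE bE big_distrlr /= pair_bigA /= (reindex (@enum_val _ {: I})) /=.
    by apply: eq_bigr => k _; rewrite mulrACA.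
  by exists enum_rank => k _; rewrite ?enum_valK ?enum_rankK.
- move=> d a b [m [u [v [hu hv aE]]]] [m' [u' [v' [hu' hv' bE]]]].
  exists (m + m')%N, (fun k => match fintype.split k with inl k => u k | inr k => u' k end),
    (fun k => match fintype.split k with inl k => v k | inr k => v' k end).
  split=> [k|k|x y]; [by case: (fintype.split k)|by case: (fintype.split k)|].
  rewrite aE bE big_split_ord /=; congr (_ + _); apply: eq_bigr => k _.
    by rewrite (unsplitK (inl k)).
  by rewrite (unsplitK (inr k)).
- move=> d a k [m [u [v [hu hv aE]]]]; exists m, (fun i x => k * u i x), v.
  split=> // [i|x y]; first exact: form_scale.
  by rewrite aE mulr_sumr; apply: eq_bigr => i _; rewrite mulrA.
move=> [x y]; have [d [a [ha ax]]] := form_nonzero gX x.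
have [e [b [hb yb]]] := form_nonzero gY y.
exists (d, e), (fun z => a z.1 * b z.2); split; last by rewrite mulf_neq0.
by exists 1%N, (fun _ => a), (fun _ => b); split=> // x' y'; rewrite big_ord1.
Qed.

Lemma ev2_mpoly n (i j : 'I_n) (q : {poly {poly algC}}) :
  exists p : {mpoly algC[n]}, forall v, p.@[v] = ev2 q (v i) (v j).
Proof.
exists (\sum_(l < size q) \sum_(k < size (q`_l)%R) (q`_l)`_k *: ('X_i ^+ k * 'X_j ^+ l)) => v.
rewrite raddf_sum ev2_coef; apply: eq_bigr => l _ /=.
rewrite raddf_sum horner_coef mulr_suml; apply: eq_bigr => k _ /=.
by rewrite mevalZ !mevalM !rmorphXn /= !mevalXU mulrA.
Qed.

(* [gamma] parametrizes [S] by a principal open subset of the affine plane. *)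
Definition chart (X : Defs.space) (S : set X) (h : {poly {poly algC}})
    (gamma : algC * algC -> X) (del : X -> algC * algC) : Prop :=
  [/\ forall p, ev2p h p != 0 -> S (gamma p) /\ del (gamma p) = p,
      forall x, S x -> ev2p h (del x) != 0 /\ gamma (del x) = x,
      Defs.regular S (fun x => (del x).1) /\ Defs.regular S (fun x => (del x).2) &
      forall d, exists sg : algC * algC -> algC, (forall p, ev2p h p != 0 -> sg p != 0) /\ forall a : X -> algC, Defs.form d a -> exists q : {poly {poly algC}},
          forall p, ev2p h p != 0 -> a (gamma p) = sg p * ev2p q p].

Section Chart.
Variables (X : Defs.space) (S : set X) (h : {poly {poly algC}}).
Variables (gamma : algC * algC -> X) (del : X -> algC * algC).
Hypotheses (gX : graded X) (ch : chart S h gamma del).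

Lemma chart_aregular phi : Defs.regular S phi ->
  aregular [set p | ev2p h p != 0] (phi \o gamma).
Proof.
have [h1 h2 [h3 h3'] h4] := ch; move=> /(regularP gX) hphi p hp.
have [d [a [b [[ha hb e] bx]]]] := hphi _ (h1 p hp).1.
have [sg [sg0 hsg]] := h4 d; have [qa Ea] := hsg a ha; have [qb Eb] := hsg b hb.
exists qa, qb; split=> [|q hq].
  by move: bx; rewrite Eb // mulf_eq0 negb_or => /andP[].
apply: (mulfI (sg0 q hq)); rewrite mulrCA -Eb // -Ea // e //; exact: (h1 q hq).1.
Qed.

Lemma chart_regular psi : aregular [set p | ev2p h p != 0] psi ->
  Defs.regular S (psi \o del).
Proof.
have [h1 h2 [h3 h3'] h4] := ch; move=> hpsi; apply: (regular_local_quotient gX) => x Sx.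
have [a [b [bx e]]] := hpsi _ (h2 x Sx).1.
exists (fun y => ev2p a (del y)), (fun y => ev2p b (del y)).
by split=> //; [exact: regular_ev2|exact: regular_ev2|move=> y /h2[/e]].
Qed.

(** Rabinowitsch's trick: the open set h != 0 of the plane becomes the closed surface h(x, y) z = 1
    in affine 3-space. *)
Lemma chart_affine : Defs.affine S.
Proof.
have [h1 h2 [h3 h3'] h4] := ch.
pose j0 : 'I_3 := i0; pose j1 : 'I_3 := i1; pose j2 : 'I_3 := i2.
have [H HE] := ev2_mpoly j0 j1 h.
pose Z : set (affine_space 3) := [set z | (H * 'X_j2 - 1).@[z] = 0].
have ZE z : Z z <-> ev2p h (z j0, z j1) * z j2 = 1.
  rewrite /Z /= mevalB mevalM meval1 mevalXU HE.
  by split=> [/eqP|->]; rewrite ?subr_eq0 ?subrr // => /eqP.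
have Zn z : Z z -> ev2p h (z j0, z j1) != 0.
  by move=> /ZE e; apply: contra_eq_neq e => ->; rewrite mul0r eq_sym oner_neq0.
exists 3%N, Z; split.
  exists [set phi | forall v, phi v = (H * 'X_j2 - 1).@[v]]; split.
    by move=> phi hphi; exists tt, (H * 'X_j2 - 1).
  apply/seteqP; split=> z /= hz; first by move=> phi ->.
  exact: (hz (fun v => (H * 'X_j2 - 1).@[v])).
pose u (x : X) : affine_space 3 := fun i : 'I_3 => [:: (del x).1; (del x).2; (ev2p h (del x))^-1]`_i.
pose v (z : affine_space 3) : X := gamma (z j0, z j1).
have uZ x : S x -> Z (u x).
  by move=> /h2[n0 _]; apply/ZE; rewrite /u /= -surjective_pairing mulfV.
have vS z : Z z -> S (v z) by move=> /Zn/h1[].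
exists u, v; split; last 2 first.
- by move=> x Sx; have [_ e] := h2 x Sx; rewrite /v /u /= -surjective_pairing e.
- move=> z Zz; have [_ e] := h1 _ (Zn z Zz); have zE := (ZE z).1 Zz.
  apply: funext; elim/ord3P; rewrite /u /v /= e //=.
  by apply: (mulfI (Zn z Zz)); rewrite mulfV ?Zn.
- apply: (morphism_to_affine gX) => //; elim/ord3P; rewrite /u //=.
  apply: (regular_inv gX); first exact: regular_ev2.
  by move=> x /h2[].
split=> // [C [E [Ef ->]]|O phi _ hphi].
  pose E' := [set b : affine_space 3 -> algC | exists a q, [/\ E a, forall p, ev2p h p != 0 ->
     exists2 s, s != 0 & a (gamma p) = s * ev2p q p & forall z, b z = ev2 q (z j0) (z j1)]].
  exists (zeros E').
    exists E'; split=> // b [a [q [Ea _ bE]]]; exists tt.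
    by have [p pE] := ev2_mpoly j0 j1 q; exists p => z; rewrite bE pE.
  apply/seteqP; split=> z [Zz hz]; split=> //.
    move=> b [a [q [Ea aE ->]]]; have [s s0 e] := aE _ (Zn z Zz).
    have := hz a Ea; rewrite /v e => /eqP; rewrite mulf_eq0 (negbTE s0) /=.
    by move/eqP.
  move=> a Ea; have [d da] := Ef _ Ea; have [sg [sg0 hsg]] := h4 d.
  have [q qE] := hsg a da; rewrite /v qE; last exact: Zn.
  rewrite (_ : ev2p q _ = 0) ?mulr0 //.
  apply: (hz (fun z => ev2 q (z j0) (z j1))); exists a, q; split=> // p hp.
  by exists (sg p); [exact: sg0|exact: qE].
move=> z [Zz Oz]; have [d [a [b [ha hb bx e]]]] := hphi (v z) (conj (vS z Zz) Oz).
have [sg [sg0 hsg]] := h4 d; have [qa Ea] := hsg a ha; have [qb Eb] := hsg b hb.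
have [pa paE] := ev2_mpoly j0 j1 qa; have [pb pbE] := ev2_mpoly j0 j1 qb.
have nz y : Z y -> b (v y) != 0 <-> pb.@[y] != 0.
  move=> Zy; rewrite pbE /v Eb ?Zn // mulf_eq0 negb_or sg0 ?Zn //.
exists tt, (fun y => pa.@[y]), (fun y => pb.@[y]); split.
- by exists pa.
- by exists pb.
- exact/(nz z Zz).
move=> y [Zy Oy] /(nz y Zy) by0; rewrite /= e //.
rewrite /v Ea ?Zn // Eb ?Zn // paE pbE -mulf_div divff ?mul1r // sg0 ?Zn //.
by split=> //; apply: vS.
Qed.

End Chart.

(** * Finiteness of the iterates over the good locus *)

Section FiniteOver.
Variables (d : nat) (c : algC).
Hypothesis (d3 : (3 <= d)%N).

Local Notation F := (henon d c).
Local Notation ft := (ft d c).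
Local Notation G n := (iterate F n).
Implicit Types (p q : algC * algC) (P Q : P2).

Let d0 : (0 < d)%N. Proof. exact: leq_trans d3. Qed.

Definition pt p : P2 := affine_point p.1 p.2.

Definition del (P : P2) : algC * algC :=
  (coords P 0 i0 / coords P 0 i2, coords P 0 i1 / coords P 0 i2).

Lemma pt_coords : exists lam : algC * algC -> algC, forall p,
  lam p != 0 /\ coords (pt p) = lam p *: vec p.1 p.2 1.
Proof.
have /choice[lam h] : forall p, exists l, l != 0 /\ coords (pt p) = l *: vec p.1 p.2 1.
  by move=> p; have [l l0 e] := coords_affine p.1 p.2; exists l.
by exists lam.
Qed.

Lemma ptK p : del (pt p) = p.
Proof.
have [lam h] := pt_coords; have [l0 e] := h p.
by rewrite /del e !mxE /= mulr1 !(mulrC (lam p)) !mulfK // -surjective_pairing.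
Qed.

Lemma del_pt P : coords P 0 i2 != 0 -> pt (del P) = P.
Proof. by move=> z0; rewrite [RHS](affine_pointP z0). Qed.

Lemma evalt_ft p : p.2 != 0 ->
  evalt F (vec p.1 p.2 1) = p.2 ^+ 2 *: vec (ft p).1 (ft p).2 1.
Proof. by move=> y0; apply: henon_preimage; rewrite ft_rel. Qed.

Lemma evalt_iterate n p : tower d c setT n p -> exists2 nu, nu != 0 &
  evalt (G n) (vec p.1 p.2 1) = nu *: vec (iter n ft p).1 (iter n ft p).2 1.
Proof.
elim: n => [|n IH] => [_|/tower_last[/IH[nu nu0 e] x0 y0]].
  exists 1; rewrite ?oner_neq0 // scale1r; apply/rowP => i.
  by rewrite !mxE iterate0E /eval3 mevalXU mxE.
exists (nu ^+ d * (iter n ft p).2 ^+ 2); first by rewrite mulf_neq0 ?expf_neq0.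
rewrite iterateS evalt_comp e (evaltZ _ _ (henon_homog c d3)) evalt_ft //.
by rewrite scalerA.
Qed.

(** The second and third components of an iterate are monomials in the components before it, so
    their nonvanishing propagates back to all coordinates of the intermediate images. *)
Lemma tower_of_iterate n p (w := evalt (G n) (vec p.1 p.2 1)) :
  w 0 i1 != 0 -> w 0 i2 != 0 -> tower d c setT n p.
Proof.
rewrite {}/w; elim: n => [//|n IH].
have [_ e1 e2] := iterate_recl d c n.
rewrite !mxE e1 e2 /eval3 !mevalM !rmorphXn /= -!/(eval3 _ _) !mulf_eq0 !negb_or.
move=> /andP[/andP[g0 /andP[g1 _]] _] /andP[_ g2].
have {}g2 : eval3 (tnth (G n) i2) (vec p.1 p.2 1) != 0.
  by move: g2; rewrite expf_eq0 subn_gt0 d3.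
have hT : tower d c setT n p by apply: IH; rewrite !mxE.
apply/tower_last; split=> //; have [nu nu0 /rowP e] := evalt_iterate hT.
  by have := e i0; rewrite !mxE => h; move: g0; rewrite h mulf_eq0 negb_or => /andP[].
by have := e i1; rewrite !mxE => h; move: g1; rewrite h mulf_eq0 negb_or => /andP[].
Qed.

Definition goodP2 n : set P2 := [set Q | exists2 q, Q = pt q & good d c n q.1 q.2].

Let goodset n : set (algC * algC) := fun q => good d c n q.1 q.2.

Definition graph_good n : set (prod_space P2 P2) :=
  [set x | exists2 p, x = (pt p, pt (iter n ft p)) & tower d c (goodset n) n p].

(** A form vanishing on the graph of the iterate n vanishes on that of the iterate n + 1 once F is
    substituted for its source variables. *)
Lemma graph_shift n P Q (FP : evalt F (coords P) != 0) :
  graph (G n.+1) (P, Q) -> graph (G n) (P2of FP, Q).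
Proof.
move=> gPQ phi [[[a b] /prod_formP[m [u [v [hu hv phiE]]]]] van].
have hGn := iterate_homog c d3 n; have rGn := iterate_ratmap c d3 n.
have hGS := iterate_homog c d3 n.+1; have rGS := iterate_ratmap c d3 n.+1.
have : \sum_k u k * (v k \mPo G n) = 0.
  apply/(graph_formP hGn rGn hu hv) => x gx.
  rewrite -phiE -surjective_pairing; apply: ((zclosure_formP _ _).2 van x gx).
  by exists (a, b); apply/prod_formP; exists m, u, v.
move/(congr1 (comp_mpoly F)); rewrite comp_mpoly0 raddf_sum /=.
under eq_bigr do rewrite rmorphM /= comp_mpolyA.
have -> : [tuple tnth (G n) i \mPo F | i < 3] = G n.+1 by rewrite iterateSr.
have huF k : (u k \mPo F) \is (a * d)%N.-homog by apply: comp_homog => //; apply: henon_homog.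
move/(graph_formP hGS rGS huF hv)/(_ _ gPQ) => /= e.
have [l l0 lE] := coords_P2of FP.
move/(congr1 ( *%R (l ^+ a))): e; rewrite mulr0 mulr_sumr => e.
rewrite phiE lE -[RHS]e; apply: eq_bigr => k _.
by rewrite (eval3Z _ _ (hu k)) eval3_comp mulrA.
Qed.

(* The point [P] is not one of the two indeterminacy points of [F], because the
   coordinate [y] of [P] satisfies an integral equation over the good locus, whose
   constant term is invertible. *)
Lemma graph_not_indet n P u v : good d c n.+1 u v ->
  graph (G n.+1) (P, pt (u, v)) -> evalt F (coords P) != 0.
Proof.
move=> guv gPQ; apply/eqP => FP0.
have [E [Er Es]] := tower_polynomial c d0 n.+1; set K := (2 ^ n.+1)%N in Es.
have v0 : v != 0 by case: guv.
pose e i x y := (ev2 E x%:P y%:P)`_i.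
have [g gE] := good_open d c n.+1.
have /choice[Nf hN] : forall i, exists N, forall m, (N <= m)%N ->
    exists2 V : {mpoly algC[3]}, V \is m.-homog &
    forall x y z, z != 0 -> eval3 V (vec (z * x) (z * y) z) = z ^+ m * e i x y.
  move=> i; have [q qE] := ispoly2_coef E i; have [N hN] := homogenize q; exists N => m /hN[V hV VE].
  by exists V => // x y z z0; rewrite VE // -qE.
pose m := (\max_(i < K.+1) Nf i)%N.
have /choice[V hV] : forall i : 'I_K.+1, exists V : {mpoly algC[3]}, V \is m.-homog /\
    forall x y z, z != 0 -> eval3 V (vec (z * x) (z * y) z) = z ^+ m * e i x y.
  move=> i; have im : (Nf i <= m)%N by exact: (@leq_bigmax _ (fun i : 'I_K.+1 => Nf i) i).
  by have [W hW WE] := hN i m im; exists W.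
have hG := iterate_homog c d3 n.+1; have rG := iterate_ratmap c d3 n.+1.
(* The U_i homogenize the powers of the second coordinate, the V_i the coefficients of E; the sum of
   U_i V_i is the integral equation as a bihomogeneous form. *)
pose U (i : 'I_K.+1) : {mpoly algC[3]} := 'X_i1 ^+ i * 'X_i2 ^+ (K - i).
have hU i : U i \is K.-homog.
  have X j k : ('X_j ^+ k : {mpoly algC[3]}) \is k.-homog.
    by rewrite -{2}[k]mul1n dhomogMn // dhomogX /= mdeg1.
  by have := dhomogM (X i1 i) (X i2 (K - i)%N); rewrite subnKC // -ltnS.
have UE (i : 'I_K.+1) w : eval3 (U i) w = w 0 i1 ^+ i * w 0 i2 ^+ (K - i).
  by rewrite /eval3 mevalM !rmorphXn /= !mevalXU.
have hV1 i : V i \is m.-homog by case: (hV i).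
have W0 : \sum_i U i * (V i \mPo G n.+1) = 0.
  have [N /(_ N (leqnn N))[gh hgh ghE]] := homogenize g.
  have gh0 : gh != 0.
    apply/eqP => z; have := ghE u v 1 (oner_neq0 _).
    rewrite z /eval3 meval0 expr1n mul1r => /esym/eqP.
    by apply/negP; apply/gE.
  have ghG : gh \mPo G n.+1 != 0.
    by apply: contra_neq gh0; apply: (@comp_iterate_eq0 d c d3 _ _ _ hgh).
  pose b := tnth (G n.+1) i1 * tnth (G n.+1) i2 * (gh \mPo G n.+1).
  apply: (@homog_chart_eq0 (K + m * d ^ n.+1)%N _ b).
  - by apply: rpred_sum => i _; apply: dhomogM (hU i) _; apply: comp_homog.
  - by rewrite !mulf_neq0 // iterate_neq0.
  - move=> w w1; rewrite /b /eval3 !mevalM -!/(eval3 _ _) !mulf_eq0 !negb_or.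
    move=> /andP[/andP[b1 b2] b3]; pose p := (w 0 i0, w 0 i1).
    have wE : w = vec p.1 p.2 1 by rewrite {1}(vecE w) w1.
    have Tp : tower d c setT n.+1 p by apply: tower_of_iterate; rewrite -wE mxE.
    have [nu nu0 nuE] := evalt_iterate Tp; rewrite -wE in nuE.
    case Eit: (iter n.+1 ft p) nuE (Er p Tp) => [u' v'] nuE rt.
    have gd : good d c n.+1 u' v'.
      apply/gE; move: b3; rewrite eval3_comp -/(evalt _ _) nuE scale_vec mulr1 ghE //.
      by rewrite mulf_eq0 negb_or => /andP[].
    have v'0 : v' != 0 by case: gd.
    have [sz _] := Es _ _ gd v'0.
    rewrite /eval3 raddf_sum /=; transitivity (nu ^+ m * (ev2 E u'%:P v'%:P).[p.2]); last first.
      by have /rootP -> := rt; rewrite mulr0.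
    rewrite horner_coef sz mulr_sumr; apply: eq_bigr => i _.
    rewrite mevalM -/(eval3 (U i) w) -/(eval3 (V i \mPo _) w) UE w1 expr1n mulr1.
    rewrite eval3_comp -/(evalt _ _) nuE scale_vec mulr1 (hV i).2 // /e /=.
    by rewrite /=; ring.
  exists (d ^ n.+1 + d ^ n.+1 + N * d ^ n.+1)%N.
  exact: (dhomogM (dhomogM (hG _) (hG _)) (comp_homog hgh hG)).
have := (graph_formP hG rG hU hV1).2 W0 _ gPQ.
have [lam hlam] := pt_coords; have [l0 lE] := hlam (u, v).
have EQ (i : 'I_K.+1) : eval3 (V i) (coords (pt (u, v))) = lam (u, v) ^+ m * e i u v.
  by rewrite lE scale_vec mulr1 (hV i).2.
have [sz r0] := Es _ _ guv v0.
rewrite (vecE (coords P)) evalt_henon in FP0.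
have := coords_neq0 P; rewrite (vecE (coords P)).
move: FP0; set x := coords P 0 i0; set y := coords P 0 i1; set z := coords P 0 i2.
rewrite -(vecE (coords P)) => /eqP; rewrite vec_eq0 => /and3P[/eqP e1 _ /eqP e2].
rewrite e2 mulr0 subr0 in e1.
have x0 : x = 0 by move/eqP: e1; rewrite expf_eq0 => /andP[_ /eqP].
rewrite (vecE (coords P)) vec_eq0 -/x -/y -/z x0 eqxx /= => yz.
rewrite /=; under eq_bigr do rewrite UE EQ !mxE /=.
(* Two points remain. At y = 0 only the constant coefficient of the equation survives, at z = 0 only
   the leading one; neither is zero over the good locus. *)
move: e2 => /eqP; rewrite mulf_eq0 !expf_eq0 /= subn_gt0 d3 /= => /orP[]/eqP yz0.
  rewrite big_ord_recl big1 => [|i _]; last by rewrite yz0 expr0n mul0r mul0r.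
  rewrite yz0 eqxx /= in yz; rewrite expr0 mul1r addr0 => /eqP.
  rewrite !mulf_eq0 !expf_eq0 (negbTE yz) (negbTE l0) !andbF /= => /eqP h.
  by case/negP: r0; rewrite rootE horner_coef0; apply/eqP.
rewrite big_ord_recr big1 => [|i _]; last first.
  by rewrite /= yz0 expr0n subn_eq0 leqNgt ltn_ord /= mulr0 mul0r.
rewrite yz0 eqxx andbT in yz; rewrite /= subnn expr0 mulr1 add0r => /eqP.
rewrite !mulf_eq0 !expf_eq0 (negbTE yz) (negbTE l0) !andbF /= => /eqP h.
have : lead_coef (ev2 E u%:P v%:P) = 0 by rewrite lead_coefE sz.
by move/eqP; rewrite lead_coef_eq0 -size_poly_eq0 sz.
Qed.

(** [graph_not_indet] allows one application of F and [graph_shift] then lowers n; the monomial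
    shape of F forces the coordinates y and z of P to be nonzero, so P lies in the chart. *)
Lemma graph_tower n P q : good d c n q.1 q.2 -> graph (G n) (P, pt q) ->
  exists p, [/\ tower d c setT n p, P = pt p & iter n ft p = q].
Proof.
elim: n P q => [|n IH] P [u v] gq gPQ.
  exists (u, v); split=> //.
  have hG := iterate_homog c d3 0; have rG := iterate_ratmap c d3 0.
  pose Q := pt (u, v).
  have X1 k : ('X_k : {mpoly algC[3]}) \is 1.-homog by rewrite dhomogX /= mdeg1.
  (* The forms x_i y_j - x_j y_i cut out the diagonal, which is the graph of the identity. *)
  have cross i j : coords P 0 i * coords Q 0 j = coords P 0 j * coords Q 0 i.
    pose U (k : 'I_2) : {mpoly algC[3]} := if k == ord0 then 'X_i else - 'X_j.
    pose V (k : 'I_2) : {mpoly algC[3]} := if k == ord0 then 'X_j else 'X_i.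
    have hU k : U k \is 1.-homog by rewrite /U; case: ifP; rewrite ?rpredN.
    have hV k : V k \is 1.-homog by rewrite /V; case: ifP.
    have := (graph_formP hG rG hU hV).2 _ _ gPQ.
    rewrite !big_ord_recl !big_ord0 /U /V /= !addr0 !comp_mpoly_id => h.
    apply/eqP; rewrite -subr_eq0; apply/eqP; rewrite -mulNr -[RHS]h; last by ring.
    by rewrite /eval3 mevalN !mevalXU.
  have [lam hlam] := pt_coords; have [l0 lE] := hlam (u, v).
  have Q2 : coords Q 0 i2 != 0 by rewrite lE !mxE /= mulr1.
  apply: (@P2point_eq _ _ (coords P 0 i2 / coords Q 0 i2)); apply/rowP => i.
  by rewrite mxE -/Q mulrAC -cross mulfK.
have FP := graph_not_indet gq gPQ; have gR := graph_shift FP gPQ.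
have [p1 [T1 RE it1]] := IH _ _ (good_leS gq) gR.
have [lam hlam] := pt_coords; have [l0 lE] := hlam p1.
have [r r0 rE] := coords_P2of FP.
rewrite RE lE in rE.
have FE := evalt_henon d c (coords P 0 i0) (coords P 0 i1) (coords P 0 i2).
rewrite -vecE in FE; rewrite FE !scale_vec mulr1 in rE; have [e0 e1 e2] := vec_inj rE.
have : coords P 0 i1 ^+ 2 * coords P 0 i2 ^+ (d - 2) != 0.
  by apply: contra_neq l0 => h; rewrite e2 h mulr0.
rewrite mulf_eq0 negb_or !expf_eq0 /= subn_gt0 d3 /= => /andP[y0 z0].
pose p := del P; have pE : pt p = P by apply: del_pt.
have py : p.2 != 0 by rewrite mulf_neq0 // invr_eq0.
have [lp0 lpE] := hlam p; rewrite pE in lpE.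
have fE : p1 = ft p.
  have : P2of FP = pt (ft p).
    rewrite /pt affine_pointE.
    have [r' r'0 r'E] := coords_P2of FP.
    apply: (@P2of_eq _ _ _ (r' * lam p ^+ d * p.2 ^+ 2)).
    rewrite r'E lpE (evaltZ _ _ (henon_homog c d3)) evalt_ft // !scalerA.
    by rewrite mulrA.
  by rewrite RE => /affine_point_inj[h1 h2]; rewrite [p1]surjective_pairing h1 h2 -surjective_pairing.
exists p; split=> //; last by rewrite -iterS iterSr -fE.
split=> //; last by rewrite -fE.
(* The first coordinate of p is the second one of its image: nonzero by [tower] if n > 0, and by the
   goodness of q if n = 0. *)
have -> : p.1 = p1.2 by rewrite fE.
case: n {IH gPQ gR FP RE rE} gq T1 it1 => [|n] gq T1 it1; last by case: T1.
by move: it1 => /= ->; case: gq.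
Qed.

Lemma graph_goodE n : [set x | graph (G n) x /\ goodP2 n x.2] = graph_good n.
Proof.
have rG := iterate_ratmap c d3 n; have hG := iterate_homog c d3 n.
have [lam hlam] := pt_coords.
apply/seteqP; split=> [[P Q] /= [gPQ [q QE gq]]|_ [p -> Tp]].
  rewrite QE in gPQ; have [p [Tp PE it]] := graph_tower gq gPQ.
  by exists p; [rewrite PE it -QE|apply/tower_setT; split=> //; rewrite it].
have [Tp' gp] := (tower_setT _ _ _ _ _).1 Tp.
split; last by exists (iter n ft p).
move=> phi [_]; apply; have [nu nu0 nuE] := evalt_iterate Tp'.
have [l0 lE] := hlam p; have [l1 lE'] := hlam (iter n ft p).
have E : evalt (G n) (coords (pt p)) = (lam p ^+ (d ^ n) * nu) *: vec (iter n ft p).1 (iter n ft p).2 1.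
  by rewrite lE (evaltZ _ _ hG) nuE scalerA.
apply: maps_toP => //=; rewrite E.
  by rewrite scaler_eq0 mulf_eq0 expf_eq0 (negbTE l0) (negbTE nu0) andbF /= affine_vec_neq0.
by exists (lam p ^+ (d ^ n) * nu / lam (iter n ft p)); rewrite lE' scalerA divfK.
Qed.

Lemma form_pt k : exists sg : algC * algC -> algC, (forall p, sg p != 0) /\
  forall a : P2 -> algC, @Defs.form P2 k a -> exists q : {poly {poly algC}},
    forall p, a (pt p) = sg p * ev2p q p.
Proof.
have [lam hlam] := pt_coords; exists (fun p => lam p ^+ k).
split=> [p|a [w hw aE]]; first by rewrite expf_neq0 //; case: (hlam p).
have [q hq] := dehomogenize w; exists q => p.
by rewrite aE (hlam p).2 (eval3Z _ _ hw) hq.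
Qed.

Lemma form_coord i : @Defs.form P2 1%N (fun P => coords P 0 i).
Proof.
by exists 'X_i; [rewrite dhomogX /= mdeg1|move=> P; rewrite /eval3 mevalXU].
Qed.

Lemma form_fst (X Y : Defs.space) (k : Defs.degree X) (l : Defs.degree Y) a :
  Defs.form k a -> Defs.form l (fun _ : Y => 1) ->
  @Defs.form (prod_space X Y) (k, l) (fun x => a x.1).
Proof.
move=> ha h1; exists 1%N, (fun _ => a), (fun _ _ => 1).
by split=> // x y; rewrite big_ord1 mulr1.
Qed.

Lemma form_snd (X Y : Defs.space) (k : Defs.degree X) (l : Defs.degree Y) a :
  Defs.form l a -> Defs.form k (fun _ : X => 1) ->
  @Defs.form (prod_space X Y) (k, l) (fun x => a x.2).
Proof.
move=> ha h1; exists 1%N, (fun _ _ => 1), (fun _ => a).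
by split=> // x y; rewrite big_ord1 mul1r.
Qed.

Lemma form_one : @Defs.form P2 0%N (fun _ => 1).
Proof. by exists 1; [exact: dhomog1|move=> P; rewrite /eval3 meval1]. Qed.

Lemma coords_pt_neq0 p : coords (pt p) 0 i2 != 0.
Proof. by have [lam h] := pt_coords; have [l0 ->] := h p; rewrite !mxE /= mulr1. Qed.

Lemma chart_P2 n (g : {poly {poly algC}}) :
  (forall u v, good d c n u v <-> ev2 g u v != 0) -> chart (goodP2 n : set P2) g pt del.
Proof.
move=> gE; split.
- by move=> p gp; split; [exists p => //; apply/gE|rewrite ptK].
- by move=> _ [p -> gp]; rewrite ptK; split=> //; apply/gE.
- by split; apply/(regularP graded_P2) => x [p -> _];
    exists 1%N; [exists (fun P => coords P 0 i0)|exists (fun P => coords P 0 i1)];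
    exists (fun P => coords P 0 i2); (split; last exact: coords_pt_neq0);
    (split=> [||_ [q -> _]]; [exact: form_coord|exact: form_coord|]);
    rewrite /del /= divfK ?coords_pt_neq0.
move=> k; have [sg [sg0 h]] := form_pt k; exists sg; split=> // a ha.
by have [q hq] := h a ha; exists q.
Qed.

(** The source point alone parametrizes this part of the graph. The factor between forms and
    polynomials combines the scalars of the chosen representatives with the scalar [nu] of the
    iterate. *)
Lemma chart_graph n (h : {poly {poly algC}}) :
  (forall p, tower d c (goodset n) n p <-> ev2p h p != 0) ->
  chart (graph_good n) h (fun p => (pt p, pt (iter n ft p)) : prod_space P2 P2)
    (fun x => del x.1).
Proof.
move=> hE; split.
- by move=> p hp; split; [exists p => //; apply/hE|rewrite ptK].
- by move=> _ [p -> Tp]; rewrite ptK; split=> //; apply/hE.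
- by split; apply/(regularP (graded_prod graded_P2 graded_P2)) => x [p -> _];
    exists (1%N, 0%N); [exists (fun x => coords x.1 0 i0)|exists (fun x => coords x.1 0 i1)];
    exists (fun x => coords x.1 0 i2); (split; last exact: coords_pt_neq0);
    (split=> [||_ [q -> _]]; [exact: (form_fst (form_coord _) form_one)|
       exact: (form_fst (form_coord _) form_one)|]);
    rewrite /del /= divfK ?coords_pt_neq0.
move=> [k l]; have [lam hlam] := pt_coords.
have /choice[nu hnu] : forall p, exists nu, tower d c setT n p -> nu != 0 /\
    evalt (G n) (vec p.1 p.2 1) = nu *: vec (iter n ft p).1 (iter n ft p).2 1.
  move=> p; have [/evalt_iterate[x x0 xE]|nT] := pselect (tower d c setT n p).
    by exists x.
  by exists 0.
have hT p : ev2p h p != 0 -> tower d c setT n p by move=> /hE/tower_setT[].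
exists (fun p => lam p ^+ k * (lam (iter n ft p) / nu p) ^+ l); split=> [p hp|a].
  have [nu0 _] := hnu p (hT p hp).
  by rewrite mulf_neq0 ?expf_neq0 ?mulf_neq0 ?invr_eq0 //; case: (hlam p); case: (hlam (iter n ft p)).
move=> /prod_formP[m [u [v [hu hv aE]]]].
have [q hq] := dehomogenize (\sum_i u i * (v i \mPo G n)).
exists q => p hp; have [nu0 nuE] := hnu p (hT p hp).
rewrite /ev2p -hq aE /eval3 raddf_sum mulr_sumr; apply: eq_bigr => i _ /=.
rewrite mevalM -!/(eval3 _ _) eval3_comp -/(evalt _ _) nuE.
rewrite (hlam p).2 (hlam (iter n ft p)).2 (eval3Z _ _ (hu i)) !(eval3Z _ _ (hv i)).
by rewrite exprMn exprVn; field; rewrite expf_neq0.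
Qed.

Lemma goodP2_open n : zopen (goodP2 n).
Proof.
have [g gE] := good_open d c n.
have [N /(_ N (leqnn N))[gh hgh ghE]] := homogenize g.
exists [set fun P => eval3 (gh * 'X_i2) (coords P)]; split.
  move=> _ ->; exists (N + 1)%N; exists (gh * 'X_i2) => //.
  by apply: dhomogM => //; rewrite dhomogX /= mdeg1.
apply/seteqP; split=> P.
  move=> nU _ ->; rewrite /eval3 mevalM mevalXU -/(eval3 _ _); apply/eqP; apply: contrapT => /negP.
  rewrite mulf_eq0 negb_or => /andP[gn z0]; apply: nU; exists (del P); first by rewrite del_pt.
  apply/gE; move: gn; rewrite {1}(vecE (coords P)).
  have -> : vec (coords P 0 i0) (coords P 0 i1) (coords P 0 i2) =
    vec (coords P 0 i2 * (del P).1) (coords P 0 i2 * (del P).2) (coords P 0 i2).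
    by rewrite /del /= !(mulrC (coords P 0 i2)) !divfK.
  by rewrite ghE // mulf_eq0 negb_or => /andP[].
move=> /(_ _ erefl) e [p PE /gE gp]; move/eqP: e; apply/negP.
have [lam hlam] := pt_coords; have [l0 lE] := hlam p.
rewrite PE lE scale_vec mulr1 /eval3 mevalM mevalXU mxE /= -/(eval3 _ _) ghE //.
by rewrite !mulf_neq0 // expf_neq0.
Qed.

(** The locus is a principal open set of the chart, and so is its preimage; both are affine, and the
    locus itself serves as the only member of the cover. *)
Lemma finite_over_good n : finite_over (G n) (goodP2 n).
Proof.
have rG := iterate_ratmap c d3 n; have hG := iterate_homog c d3 n.
rewrite /finite_over graph_goodE.
have [g gE] := good_open d c n.
have gE' : goodset n = (fun q => ev2p g q != 0) by apply/funext => q; apply/propext; apply: gE.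
have [h hE] := tower_open d c g n; rewrite -gE' in hE.
have chU := chart_P2 gE; have chW := chart_graph hE.
have gP := graded_P2; have gPP := graded_prod gP gP.
have opU := goodP2_open n.
split; last first.
  move=> _ [p -> Tp] /=; have [Tp' _] := (tower_setT _ _ _ _ _).1 Tp.
  apply: not_indet => //; have [lam hlam] := pt_coords; have [l0 lE] := hlam p.
  have [nu nu0 nuE] := evalt_iterate Tp'.
  rewrite lE (evaltZ _ _ hG) nuE !scaler_eq0 expf_eq0 (negbTE l0) (negbTE nu0) andbF /=.
  exact: affine_vec_neq0.
have WU x : graph_good n x -> goodP2 n x.2.
  by move=> [p -> /tower_setT[_ gp]]; exists (iter n ft p).
split.
  split=> // [C [E [Ef ->]]|O phi _ hphi].
    exists (zeros [set (fun x : prod_space P2 P2 => a x.2) | a in E]).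
      exists [set (fun x : prod_space P2 P2 => a x.2) | a in E]; split=> //.
      by move=> _ [a /Ef[k ha] <-]; exists (0%N, k); apply: (form_snd ha form_one).
    apply/seteqP; split=> x [Wx hx]; split=> //; first by move=> _ [a Ea <-]; apply: hx.
    by move=> a Ea; apply: (hx (fun x => a x.2)); exists a.
  move=> x [Wx Ox]; have [k [a [b [ha hb bx e]]]] := hphi x.2 (conj (WU _ Wx) Ox).
  exists (0%N, k), (fun x => a x.2), (fun x => b x.2); split=> //.
  - exact: (form_snd ha form_one).
  - exact: (form_snd hb form_one).
  by move=> y [Wy Oy] by0; apply: e => //; split=> //; apply: WU.
move=> y Uy; exists (goodP2 n); rewrite setIid.
have -> : graph_good n `&` snd @^-1` goodP2 n = graph_good n.
  by apply/seteqP; split=> x; [case|move=> Wx; split=> //; apply: WU].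
split=> //; [exact: (chart_affine gP chU)|exact: (chart_affine gPP chW)|].
have [|m [e [he hb]]] := @tower_finite d c (goodset n) n.
  move=> j p jn Tp; have : good d c 1 p.1 p.2.
    by apply: (@good_tower_sub d c n 1 j p) Tp; rewrite addn1.
  by case.
have TE : tower d c (goodset n) n = [set p | ev2p h p != 0].
  by apply/funext => p; apply/propext; apply: hE.
rewrite TE in he hb.
exists m, (fun k x => e k (del x.1)); split=> [k|phi /(chart_aregular gPP chW)/hb[b [hb1 hb2]]].
  exact: (chart_regular gPP chW).
exists (fun k P => b k (del P)); split=> [k|_ [p -> Tp]].
  by apply: (chart_regular gP chU); have := hb1 k; rewrite gE'.
by rewrite /= !ptK; apply: hb2; rewrite -TE.
Qed.

Lemma back_good P : (forall n, goodP2 n P) -> back F P.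
Proof.
move=> h n n0; exists (goodP2 n); split=> //; first exact: goodP2_open.
exact: finite_over_good.
Qed.

End FiniteOver.

(** * Extension of the p-adic absolute values to the algebraic numbers *)

Lemma algC_int_root (x : algC) : exists2 q : {poly int}, q != 0 & root (map_poly intr q) x.
Proof.
have [r [rE rm] _] := minCpolyP x; have [q [a a0 qE]] := rat_poly_scale r.
exists q; first by apply/eqP => q0; move: rm; rewrite qE q0 rmorph0 scaler0 monicE lead_coef0 eq_sym oner_eq0.
have := root_minCpoly x; rewrite rE qE map_polyZ rootZ ?fmorph_eq0 ?invr_eq0 ?intr_eq0 //.
by rewrite -map_poly_comp (eq_map_poly (g := intr)) // => m /=; rewrite ratr_int.
Qed.

Section ValuationRing.
Variable p : nat.
Hypothesis pr_p : prime p.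

Let p0 : (p%:R : algC) != 0.
Proof. by rewrite pnatr_eq0 -lt0n prime_gt0. Qed.

Definition subring_no_pinv (B : set algC) : Prop :=
  [/\ B 1, forall x y, B x -> B y -> B (x - y),
      forall x y, B x -> B y -> B (x * y) & ~ B p%:R^-1].

Lemma maximal_subring : exists B, subring_no_pinv B /\
  forall C, subring_no_pinv C -> B `<=` C -> C `<=` B.
Proof.
have intB : subring_no_pinv [set x | x \in Num.int].
  split=> [|x y xi yi|x y xi yi|]; [exact: rpred1|exact: rpredB|exact: rpredM|].
  move=> /= /intrP[m e]; have : (1 : algC) = (p%:Z * m)%:~R by rewrite intrM -e mulfV.
  rewrite -[1]/(1%:~R) => /intr_inj/esym/(congr1 absz); rewrite abszM /= => /eqP.
  by rewrite muln_eq1 => /andP[/eqP p1 _]; move: pr_p; rewrite p1.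
have [F FP Ftot|B [BP Bmax]] := @Zorn_bigcup algC [set B | B = set0 \/ subring_no_pinv B].
  have [[B0 [FB0 [b Bb]]]|Fempty] := pselect (exists B, F B /\ B !=set0); last first.
    left; apply/seteqP; split=> // x [B FB Bx]; case: Fempty; exists B; split=> //.
    by exists x.
  have sub B : F B -> B !=set0 -> subring_no_pinv B.
    by move=> /FP[-> [x]|//].
  right; split.
  - by exists B0 => //; have [] := sub _ FB0 (ex_intro _ b Bb).
  - move=> x y [B FB Bx] [C FC Cy]; have [BC|CB] := Ftot _ _ FB FC.
      exists C => //; have [_ h _ _] := sub _ FC (ex_intro _ y Cy).
      by apply: h => //; apply: BC.
    exists B => //; have [_ h _ _] := sub _ FB (ex_intro _ x Bx).
    by apply: h => //; apply: CB.
  - move=> x y [B FB Bx] [C FC Cy]; have [BC|CB] := Ftot _ _ FB FC.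
      exists C => //; have [_ _ h _] := sub _ FC (ex_intro _ y Cy).
      by apply: h => //; apply: BC.
    exists B => //; have [_ _ h _] := sub _ FB (ex_intro _ x Bx).
    by apply: h => //; apply: CB.
  by move=> [B FB Bp]; have [_ _ _] := sub _ FB (ex_intro _ _ Bp).
have BS : subring_no_pinv B.
  case: BP => // B0; exfalso; apply: (Bmax _ _ (or_intror intB)).
  split; first by rewrite B0.
  by rewrite B0 => /(_ 1 (rpred1 _)).
exists B; split=> // C hC BC x Cx; apply: contrapT => nBx.
apply: (Bmax C _ (or_intror hC)); split=> // CB; exact/nBx/CB.
Qed.

Variable B : set algC.
Hypothesis hB : subring_no_pinv B.
Hypothesis maxB : forall C, subring_no_pinv C -> B `<=` C -> C `<=` B.

Let B1 : B 1. Proof. by case: hB. Qed.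
Let BB x y : B x -> B y -> B (x - y). Proof. by case: hB => _ h _ _; apply: h. Qed.
Let BM x y : B x -> B y -> B (x * y). Proof. by case: hB => _ _ h _; apply: h. Qed.
Let Bp : ~ B p%:R^-1. Proof. by case: hB. Qed.
Let B0 : B 0. Proof. by rewrite -(subrr 1); apply: BB. Qed.
Let BN x : B x -> B (- x). Proof. by rewrite -sub0r; apply: BB. Qed.
Let BD x y : B x -> B y -> B (x + y).
Proof. by move=> hx hy; rewrite -[y]opprK; apply: BB => //; apply: BN. Qed.
Let BX x n : B x -> B (x ^+ n).
Proof. by move=> hx; elim: n => [|n IH]; rewrite ?expr0 // exprS; apply: BM. Qed.
Let Bsum (I : Type) (r : seq I) (F : I -> algC) : (forall i, B (F i)) -> B (\sum_(i <- r) F i).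
Proof. by move=> h; elim/big_ind: _. Qed.
Let Bnat n : B n%:R.
Proof. by elim: n => [|n IH] //; rewrite -natr1; apply: BD. Qed.

(** The fractions with denominator in 1 + pB form a ring that still omits 1/p, so maximality puts
    them into B. *)
Lemma ring_unit1 b : B b -> B (1 + p%:R * b)^-1.
Proof.
move=> hb; pose C := [set z | exists x s, [/\ B x, B s & z = x / (1 + p%:R * s)]].
have nz s : B s -> 1 + p%:R * s != 0.
  move=> hs; apply/eqP => /eqP; rewrite addrC addr_eq0 => /eqP e; apply: Bp.
  have -> : p%:R^-1 = - s by apply: (mulfI p0); rewrite mulfV // mulrN e opprK.
  exact: BN.
have hC : subring_no_pinv C.
  split.
  - by exists 1, 0; rewrite mulr0 addr0 divr1.
  - move=> _ _ [x [s [hx hs ->]]] [y [t [hy ht ->]]].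
    exists (x * (1 + p%:R * t) - y * (1 + p%:R * s)), (s + t + p%:R * s * t).
    have Bp' : B p%:R by exact: Bnat.
    split; first by apply: BB; apply: BM => //; apply: BD => //; apply: BM.
      by do 2?apply: BD => //; apply: BM => //; apply: BM.
    have -> : 1 + p%:R * (s + t + p%:R * s * t) = (1 + p%:R * s) * (1 + p%:R * t) by ring.
    by field; rewrite !nz.
  - move=> _ _ [x [s [hx hs ->]]] [y [t [hy ht ->]]].
    exists (x * y), (s + t + p%:R * s * t).
    have Bp' : B p%:R by exact: Bnat.
    split; first exact: BM.
      by do 2?apply: BD => //; apply: BM => //; apply: BM.
    have -> : 1 + p%:R * (s + t + p%:R * s * t) = (1 + p%:R * s) * (1 + p%:R * t) by ring.
    by field; rewrite !nz.
  move=> [x [s [hx hs e]]]; apply: Bp.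
  have xE : x = p%:R^-1 * (1 + p%:R * s) by rewrite e divfK // nz.
  have -> : p%:R^-1 = x - s by rewrite xE mulrDr mulr1 mulKf // addrK.
  exact: BB.
apply: (maxB hC); last by exists 1, b; rewrite mul1r.
by move=> x hx; exists x, 0; rewrite mulr0 addr0 divr1.
Qed.

Let rep z n := exists q : {poly algC},
  [/\ (size q <= n)%N, forall i, B q`_i & q.[z] = p%:R^-1].

Let adjoin z : ~ B z -> exists n, rep z n.
Proof.
move=> nz; pose C := [set x | exists q : {poly algC}, (forall i, B q`_i) /\ q.[z] = x].
have CB : B `<=` C.
  move=> x hx; exists x%:P; rewrite hornerC; split=> // i; rewrite coefC; by case: ifP.
have [hC|] := pselect (subring_no_pinv C).
  have zC : C z by exists 'X; rewrite hornerX; split=> // i; rewrite coefX; case: eqP.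
  by case: nz; apply: (maxB hC).
move=> nC; have [[q [hq e]]|nq] := pselect (C p%:R^-1).
  by exists (size q), q.
case: nC; split=> //; first exact: CB.
  move=> _ _ [q [hq <-]] [r [hr <-]]; exists (q - r); rewrite hornerD hornerN; split=> // i.
  by rewrite coefB; apply: BB.
move=> _ _ [q [hq <-]] [r [hr <-]]; exists (q * r); rewrite hornerM; split=> // i.
by rewrite coefM; apply: Bsum => j; apply: BM.
Qed.

(** The equation for 1/z reads 1 = u^-1 p (b_1 z^-1 + b_2 z^-2 + ...) with u = 1 - p b_0 a unit of
    B. Multiplied by the top term of the equation for z, it replaces that term by lower ones. *)
Let descent z n m : z != 0 -> (m <= n)%N -> rep z n -> rep z^-1 m -> rep z n.-1.
Proof.
move=> z0 mn [a [sa ha ea]] [b [sb hb eb]].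
case: n mn sa => [|n] mn sa /=.
  by exists a; split=> //; rewrite (leq_trans sa).
pose u := 1 - p%:R * b`_0.
have hu : B u^-1.
  by rewrite /u -mulrN; apply: ring_unit1; apply: BN.
have u0 : u != 0.
  apply/eqP => e; apply: Bp; suff -> : p%:R^-1 = b`_0 by [].
  by apply: (mulfI p0); rewrite mulfV //; apply/eqP; rewrite -subr_eq0 -/u e.
pose r : {poly algC} := \sum_(i < m.-1) b`_i.+1 *: 'X^(n - i.+1).
exists (a - a`_n *: 'X^n + (a`_n * u^-1 * p%:R) *: r).
have sr : (size r <= n)%N.
  apply: (leq_trans (size_sum _ _ _)); apply/bigmax_leqP => i _.
  apply: (leq_trans (size_scale_leq _ _)); rewrite size_polyXn.
  by have := ltn_ord i; move: mn; lia.
have rE : r.[z] = z ^+ n * \sum_(i < m.-1) b`_i.+1 * z^-1 ^+ i.+1.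
  rewrite horner_sum mulr_sumr; apply: eq_bigr => i _; rewrite hornerZ hornerXn.
  have li : (i.+1 <= n)%N by have := ltn_ord i; move: mn; lia.
  rewrite mulrCA; congr (_ * _); rewrite -{2}(subnK li) exprD exprVn mulfK // expf_neq0 //.
split.
- apply: (leq_trans (size_polyD _ _)); rewrite geq_max (leq_trans (size_scale_leq _ _) sr) andbT.
  apply/leq_sizeP => j nj; rewrite coefB coefZ coefXn.
  have [->|jn] := eqVneq j n; first by rewrite mulr1 subrr.
  by rewrite mulr0 subr0 nth_default // (leq_trans sa) // ltn_neqAle eq_sym jn.
- move=> i; rewrite !coefD coefN !coefZ coefXn coef_sum; apply: BD.
    by apply: BB => //; apply: BM => //; case: eqP.
  apply: BM; first by apply: BM => //; apply: BM.
  by apply: Bsum => j; rewrite coefZ coefXn; apply: BM => //; case: eqP.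
rewrite !(hornerD, hornerN, hornerZ, hornerXn) rE ea.
have -> : \sum_(i < m.-1) b`_i.+1 * z^-1 ^+ i.+1 = p%:R^-1 - b`_0.
  rewrite -eb; case: m mn sb {r sr rE} => [|m] mn sb.
    by move: sb eb; rewrite leqn0 size_poly_eq0 => /eqP-> _; rewrite big_ord0 horner0 coef0 subr0.
  by rewrite (horner_coef_wide _ sb) big_ord_recl /= expr0 mulr1 addrC addKr.
by rewrite /u; field; rewrite p0 -/u u0.
Qed.

(** If both failed, adjoining z or 1/z would each express 1/p; [descent] keeps shortening the longer
    expression until one has length 0. *)
Lemma valuation_ringP z : z != 0 -> B z \/ B z^-1.
Proof.
move=> z0; have [|nz] := pselect (B z); first by left.
have [|nz'] := pselect (B z^-1); first by right.
exfalso; have [n rn] := adjoin nz; have [m rm] := adjoin nz'.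
have rep0 y : ~ rep y 0.
  move=> [q [sq _ e]]; move: sq; rewrite leqn0 size_poly_eq0 => /eqP q0.
  by move: e; rewrite q0 horner0 => /esym/eqP; rewrite invr_eq0 (negbTE p0).
have [N] := ubnP (n + m); elim: N n m rn rm => // N IH n m rn rm.
have [mn|nm] := leqP m n.
  case: n mn rn => [|n] mn rn; first by move=> _; apply: (rep0 z).
  rewrite addSn ltnS => nmN; apply: (IH n m) => //; first exact: (descent z0 mn rn rm).
case: m nm rm => [//|m] nm rm; rewrite addnS ltnS => nmN; apply: (IH n m) => //.
by apply: (@descent z^-1 m.+1 n _ (ltnW nm)) => //; rewrite ?invr_eq0 ?invrK.
Qed.

Definition vunit u := [/\ u != 0, B u & B u^-1].

Lemma vunitM u v : vunit u -> vunit v -> vunit (u * v).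
Proof.
by move=> [u0 hu hu'] [v0 hv hv']; split; rewrite ?mulf_neq0 // ?invfM; apply: BM.
Qed.

Lemma vunitV u : vunit u -> vunit u^-1.
Proof. by move=> [u0 hu hu']; split; rewrite ?invr_eq0 ?invrK. Qed.

Lemma vunitX u n : vunit u -> vunit (u ^+ n).
Proof.
move=> hu; elim: n => [|n IH]; last by rewrite exprS; apply: vunitM.
by rewrite expr0; split; rewrite ?oner_neq0 ?invr1.
Qed.

Lemma vunit_pexp (k : int) : vunit (p%:R ^ k) -> k = 0.
Proof.
have h (n : nat) : ~ B (p%:R^-1 ^+ n.+1).
  move=> hn; apply: Bp; have -> : p%:R^-1 = p%:R ^+ n * p%:R^-1 ^+ n.+1 :> algC.
    by rewrite exprVn exprS invfM mulrCA mulfV ?mulr1 // expf_neq0.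
  by apply: BM => //; apply/BX/Bnat.
case: k => [[|n]|n] // [_ h1 h2]; exfalso; last by apply: (h n); rewrite exprVn.
by apply: (h n); rewrite exprVn.
Qed.

Lemma vunit_coprime (m : nat) : coprime p m -> vunit m%:R.
Proof.
move=> co; have m0 : (m%:R : algC) != 0.
  rewrite pnatr_eq0; apply/eqP => m0; move: co; rewrite m0 /coprime gcdn0 => /eqP p1.
  by move: pr_p; rewrite p1.
split=> //; have p_gt0 := prime_gt0 pr_p.
have m_gt0 : (0 < m)%N by rewrite lt0n -(pnatr_eq0 algC).
have [u v e _] := egcdnP p m_gt0; have := co; rewrite coprime_sym /coprime => /eqP g1.
rewrite g1 in e; have -> : m%:R^-1 = u%:R * (1 + p%:R * v%:R)^-1 :> algC.
  have nz : 1 + p%:R * v%:R != 0 :> algC by rewrite -natrM -[1]/(1%:R) -natrD pnatr_eq0.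
  apply: (mulfI m0); rewrite mulfV // mulrA -[m%:R * _]natrM mulnC e.
  by rewrite natrD natrM addrC [v%:R * _]mulrC mulfV.
by apply: BM => //; apply: ring_unit1.
Qed.

Lemma int_pexp (m : int) : m != 0 -> exists2 u, vunit u & m%:~R = p%:R ^+ logn p `|m|%N * u.
Proof.
move=> m0; have am : (0 < `|m|)%N by rewrite absz_gt0.
have [m' co e] := pfactor_coprime pr_p am; have um := vunit_coprime co.
have [h|h] : m = `|m|%N%:Z \/ m = - (`|m|%N%:Z) by lia.
  by exists m'%:R => //; rewrite {1}h -pmulrn {1}e natrM natrX mulrC.
exists (- m'%:R); last by rewrite {1}h mulrNz -pmulrn {1}e natrM natrX mulrN mulrC.
by case: um => n0 h1 h2; split; rewrite ?oppr_eq0 ?invrN //; apply: BN.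
Qed.

(** The maximal ideal. As 0^-1 = 0 belongs to B, zero has to be exempted from the condition on
    inverses. *)
Definition vmax y := B y /\ (B y^-1 -> y = 0).

Lemma vmaxD y z : vmax y -> vmax z -> vmax (y + z).
Proof.
move=> [hy y0] [hz z0]; split; first exact: BD.
move=> h; apply: contrapT => /eqP yz0.
have [ye|yn] := eqVneq y 0.
  by move: yz0 h; rewrite ye add0r => zn /z0 ze; rewrite ze eqxx in zn.
have [ze|zn] := eqVneq z 0.
  by move: h; rewrite ze addr0 => /y0 ye; rewrite ye eqxx in yn.
have [hyz|hyz] : B (y / z) \/ B (z / y).
  have [|//] := valuation_ringP (mulf_neq0 yn (invr_neq0 zn)); first by left.
  by rewrite invf_div; right.
  have hz' : B z^-1.
    have -> : z^-1 = (y + z)^-1 * (1 + y / z) by field; rewrite yz0 zn.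
    by apply: BM => //; apply: BD.
  by rewrite (z0 hz') eqxx in zn.
have hy' : B y^-1.
  have -> : y^-1 = (y + z)^-1 * (1 + z / y) by field; rewrite yz0 yn.
  by apply: BM => //; apply: BD.
by rewrite (y0 hy') eqxx in yn.
Qed.

Lemma vmaxM b y : B b -> vmax y -> vmax (b * y).
Proof.
move=> hb [hy y0]; split; first exact: BM.
have [->|b0] := eqVneq b 0; first by rewrite mul0r.
move=> h; rewrite y0 ?mulr0 //.
have -> : y^-1 = b * (b * y)^-1 by rewrite invfM mulVKf.
exact: BM.
Qed.

Lemma vmax_nonunit y : y != 0 -> B y -> ~ vunit y -> vmax y.
Proof. by move=> y0 hy nu; split=> // hy'; case: nu. Qed.

(** Distinct valuations are expressed by non-unit ratios, since the valuation is yet to be defined.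
    A new term is either absorbed by the dominant one or becomes dominant itself. *)
Lemma sum_dominant (t : nat -> algC) (I : seq nat) : uniq I -> I != [::] ->
  (forall i, i \in I -> t i != 0) ->
  (forall i j, i \in I -> j \in I -> i != j -> ~ vunit (t i / t j)) ->
  exists2 j, j \in I & exists2 m, vmax m & \sum_(i <- I) t i = t j * (1 + m).
Proof.
elim: I => // i I IH /= /andP[iI uI] _ t0 nu.
have [->|I0] := eqVneq I [::].
  exists i; first exact: mem_head.
  by exists 0; [split|rewrite big_seq1 addr0 mulr1].
have [j jI [m hm e]] : exists2 j, j \in I & exists2 m, vmax m & \sum_(i <- I) t i = t j * (1 + m).
  apply: IH => // [k kI|k l kI lI]; first by apply: t0; rewrite inE kI orbT.
  by apply: nu; rewrite inE ?kI ?lI orbT.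
have ti : t i != 0 by apply: t0; exact: mem_head.
have jiI : j \in i :: I by rewrite inE jI orbT.
have tj : t j != 0 by apply: t0.
have ij : i != j by apply: contraNneq iI => ->.
rewrite big_cons e; have [h|h] : B (t i / t j) \/ B (t j / t i).
- have [|//] := valuation_ringP (mulf_neq0 ti (invr_neq0 tj)); first by left.
  by rewrite invf_div; right.
- exists j => //; exists (t i / t j + m); last by field; rewrite tj.
  by apply: vmaxD => //; apply: vmax_nonunit; rewrite ?mulf_neq0 ?invr_eq0 //; apply: nu => //; exact: mem_head.
exists i; first exact: mem_head.
exists ((1 + m) * (t j / t i)); last by field; rewrite ti.
apply: vmaxM; first by apply: BD => //; case: hm.
apply: vmax_nonunit; rewrite ?mulf_neq0 ?invr_eq0 //; apply: nu => //; last by rewrite eq_sym.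
exact: mem_head.
Qed.

(* In an integer equation for [x], two of the nonzero terms have the same valuation. *)
Lemma value_exists x : x != 0 -> exists n (k : int) u,
  [/\ (0 < n)%N, vunit u & x ^+ n = p%:R ^ k * u].
Proof.
move=> x0; have [q q0 rq] := algC_int_root x.
pose t i := (q`_i)%:~R * x ^+ i; pose I := [seq i <- iota 0 (size q) | q`_i != 0].
have cE i : i \in I -> q`_i != 0 by rewrite mem_filter => /andP[].
have t0 i : i \in I -> t i != 0.
  by move=> /cE qi; rewrite mulf_neq0 ?expf_neq0 // intr_eq0.
have I0 : I != [::].
  apply/eqP => I0; have : (size q).-1 \in I.
    rewrite mem_filter -lead_coefE lead_coef_eq0 q0 mem_iota /= add0n.
    by rewrite prednK // size_poly_gt0.
  by rewrite I0.
have sum0 : \sum_(i <- I) t i = 0.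
  move/rootP: rq; rewrite horner_coef size_map_inj_poly //; last exact: intr_inj.
  rewrite -(big_mkord xpredT (fun i => (map_poly intr q)`_i * x ^+ i)) => h.
  have sE : iota 0 (size q) = index_iota 0 (size q) by rewrite /index_iota subn0.
  rewrite big_filter sE -[RHS]h.
  rewrite [RHS](bigID (fun i => q`_i != 0)) /= [X in _ = _ + X]big1 ?addr0 => [|i].
    by apply: eq_bigr => i _; rewrite coef_map.
  by rewrite negbK coef_map => /eqP->; rewrite mul0r.
(* If no two terms had a unit ratio, the dominant term would force 1 + m = 0 with m in the maximal
   ideal. *)
have [[i [j [iI jI ij hu]]]|nu] := pselect (exists i j,
    [/\ i \in I, j \in I, i != j & vunit (t i / t j)]); last first.
  have [||j jI [m [hm m0] e]] := sum_dominant _ I0 t0.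
  - by rewrite filter_uniq // iota_uniq.
  - by move=> i j iI jI ij hu; apply: nu; exists i, j.
  move: sum0; rewrite e => /eqP; rewrite mulf_eq0 (negbTE (t0 j jI)) addrC addr_eq0 /= => /eqP mE.
  have := m0; rewrite mE invrN invr1 => /(_ (BN B1))/eqP.
  by rewrite oppr_eq0 oner_eq0.
have key k l : k \in I -> l \in I -> vunit (t k / t l) -> (l < k)%N -> exists n (e : int) u,
    [/\ (0 < n)%N, vunit u & x ^+ n = p%:R ^ e * u].
  move=> kI lI hkl lk; have [wi hi Ei] := int_pexp (cE k kI).
  have [wj hj Ej] := int_pexp (cE l lI).
  have xp : x ^+ k = x ^+ (k - l) * x ^+ l by rewrite -exprD subnK // ltnW.
  have pn0 (n : nat) : p%:R ^+ n != 0 :> algC by rewrite expf_neq0.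
  exists (k - l)%N, ((logn p `|(q`_l)%R|)%:Z - (logn p `|(q`_k)%R|)%:Z), (t k / t l * wj / wi).
  split; [by rewrite subn_gt0|by apply: vunitM; [exact: vunitM|exact: vunitV]|].
  have [wi0 _ _] := hi; have [wj0 _ _] := hj.
  rewrite /t Ei Ej xp expfzDr // -exprnN -!exprnP.
  by field; rewrite !pn0 wi0 wj0 expf_neq0.
have [h|h|h] := ltngtP i j; last by rewrite h eqxx in ij.
  by apply: (key j i) => //; rewrite -invf_div; apply: vunitV.
exact: (key i j).
Qed.

(** The valuation normalized by v(p) = 1; it is rational because a power of x is a power of p up to
    a unit. *)
Definition has_value (x : algC) (r : rat) := exists n (k : int) u,
  [/\ (0 < n)%N, vunit u, x ^+ n = p%:R ^ k * u & r = k%:~R / n%:R].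

Let pn0 (k : int) : p%:R ^ k != 0 :> algC.
Proof. by rewrite expfz_neq0. Qed.

Lemma has_value_uniq x r s : has_value x r -> has_value x s -> r = s.
Proof.
move=> [n [k [u [n0 hu e ->]]]] [m [l [v [m0 hv e' ->]]]].
have kl : k * m%:Z = l * n%:Z.
  apply/eqP; rewrite -subr_eq0; apply/eqP/vunit_pexp.
  have -> : p%:R ^ (k * m%:Z - l * n%:Z) = v ^+ n * (u ^+ m)^-1 :> algC.
    have [u0 _ _] := hu; rewrite expfzDr // -invr_expz.
    have h : p%:R ^ (k * m%:Z) * u ^+ m = v ^+ n * p%:R ^ (l * n%:Z).
      by rewrite -!exprz_exp -!exprnP -!exprMn -e [v * _]mulrC -e' -!exprM mulnC.
    by apply/eqP; rewrite eqr_div ?pn0 ?expf_neq0 // h.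
  by apply: vunitM; [apply: vunitX|apply/vunitV/vunitX].
have n1 : (n%:R : rat) != 0 by rewrite pnatr_eq0 -lt0n.
have m1 : (m%:R : rat) != 0 by rewrite pnatr_eq0 -lt0n.
apply/eqP; rewrite eqr_div // -[n%:R]/(n%:Z%:~R) -[m%:R]/(m%:Z%:~R) -!intrM kl //.
Qed.

Lemma has_valueM x y r s : has_value x r -> has_value y s -> has_value (x * y) (r + s).
Proof.
move=> [n [k [u [n0 hu e ->]]]] [m [l [v [m0 hv e' ->]]]].
exists (n * m)%N, (k * m%:Z + l * n%:Z), (u ^+ m * v ^+ n); split.
- by rewrite muln_gt0 n0.
- by apply: vunitM; apply: vunitX.
- rewrite exprMn exprM e mulnC exprM e' !exprMn expfzDr // -!exprz_exp -!exprnP; ring.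
have n1 : (n%:R : rat) != 0 by rewrite pnatr_eq0 -lt0n.
have m1 : (m%:R : rat) != 0 by rewrite pnatr_eq0 -lt0n.
by rewrite intrD !intrM natrM -[n%:Z%:~R]/(n%:R) -[m%:Z%:~R]/(m%:R); field; rewrite n1 m1.
Qed.

Lemma has_value_ge0 x r : B x -> has_value x r -> 0 <= r.
Proof.
move=> hx [n [k [u [n0 hu e ->]]]]; rewrite divr_ge0 // ler0z leNgt.
apply/negP => k0; have hk : B (p%:R ^ k).
  have [u0 _ hu'] := hu; have -> : p%:R ^ k = x ^+ n * u^-1 :> algC by rewrite e mulfK.
  by apply: BM => //; apply: BX.
suff /vunit_pexp kE : vunit (p%:R ^ k) by rewrite kE ltxx in k0.
split=> //; case: k k0 {e hk} => // j _.
by rewrite NegzE -exprnN invrK; apply/BX/Bnat.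
Qed.

Lemma has_value_int (m : int) : m != 0 -> has_value m%:~R (logn p `|m|%N)%:R.
Proof.
move=> m0; have [u hu e] := int_pexp m0.
by exists 1%N, (logn p `|m|%N)%:Z, u; rewrite expr1 divr1 e.
Qed.

Variable R : realType.

Lemma padic_absval : exists w : algC -> R,
  absval w /\ forall q : rat, w (ratr q) = padic_abs R p q.
Proof.
have /choice[v hv] : forall x : algC, exists r, x != 0 -> has_value x r.
  move=> x; have [->|x0] := eqVneq x 0; first by exists 0.
  have [n [k [u [n0 hu e]]]] := value_exists x0.
  by exists (k%:~R / n%:R) => _; exists n, k, u.
have p1 : (1 : R) < p%:R by rewrite ltr1n prime_gt1.
have lp : 0 < ln (p%:R : R) by apply: ln_gt0.
pose w x : R := if x == 0 then 0 else expR (- ratr (v x) * ln p%:R).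
have w0 x : x != 0 -> w x = expR (- ratr (v x) * ln p%:R) by rewrite /w => /negbTE ->.
have w_int m (m0 : m != 0) : w m%:~R = (p%:R ^+ logn p `|m|%N)^-1.
  rewrite w0 ?intr_eq0 //; have m0' : (m%:~R : algC) != 0 by rewrite intr_eq0.
  rewrite (has_value_uniq (hv _ m0') (has_value_int m0)) ratr_nat mulNr expRN; congr (_^-1).
  by rewrite -{2}[p%:R](@lnK R) ?posrE ?ltr0n ?prime_gt0 // -expRM_natl mulrC.
have wM x y : w (x * y) = w x * w y.
  have [->|x0] := eqVneq x 0; first by rewrite /w mul0r eqxx mul0r.
  have [->|y0] := eqVneq y 0; first by rewrite /w mulr0 eqxx mulr0.
  have xy0 : x * y != 0 by rewrite mulf_neq0.
  rewrite !w0 // -expRD (has_value_uniq (hv _ xy0) (has_valueM (hv x x0) (hv y y0))).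
  by congr expR; rewrite rmorphD /=; ring.
have wge0 x : 0 <= w x by rewrite /w; case: ifP => // _; apply: expR_ge0.
have wle1 x : B x -> w x <= 1.
  move=> hx; have [->|x0] := eqVneq x 0; first by rewrite /w eqxx ler01.
  rewrite w0 // -[leRHS]expR0 ler_expR mulNr oppr_le0; apply: mulr_ge0; last exact: ltW.
  by rewrite ler0q; apply: (has_value_ge0 hx (hv x x0)).
have key x y : y != 0 -> B (x / y) -> w (x + y) <= w x + w y.
  move=> y0 hxy; have -> : x + y = y * (1 + x / y) by field.
  rewrite wM; apply: (@le_trans _ _ (w y)).
    by rewrite -[leRHS]mulr1 ler_wpM2l // wle1 //; apply: BD.
  by rewrite lerDr.
exists w; split; last first.
  move=> q; rewrite /padic_abs; have [->|q0] := eqVneq q 0; first by rewrite rmorph0 /w eqxx.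
  have n0 : numq q != 0 by rewrite numq_eq0.
  have dq0 := denq_neq0 q.
  have d0 : w (denq q)%:~R != 0 by rewrite w_int // invr_eq0 expf_neq0 // gt_eqF // (lt_trans ltr01).
  have E : ratr q * (denq q)%:~R = (numq q)%:~R :> algC.
    rewrite -(ratr_int _ (denq q)) -(ratr_int _ (numq q)) -rmorphM /=; congr ratr.
    by rewrite -[X in X * _ = _](divq_num_den q) divfK // intr_eq0.
  apply: (mulIf d0); rewrite -wM E !w_int // mulrAC divff ?mul1r //.
  by rewrite expf_neq0 // gt_eqF // (lt_trans ltr01).
split=> // [x|x y].
  split=> [|->]; last by rewrite /w eqxx.
  by rewrite /w; case: eqP => // _ /eqP; rewrite gt_eqF // expR_gt0.
have [->|x0] := eqVneq x 0; first by rewrite add0r /w eqxx add0r.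
have [->|y0] := eqVneq y 0; first by rewrite addr0 lerDl.
have [h|h] : B (x / y) \/ B (y / x).
- have [|//] := valuation_ringP (mulf_neq0 x0 (invr_neq0 y0)); first by left.
  by rewrite invf_div; right.
- exact: key.
by rewrite addrC [leRHS]addrC; apply: key.
Qed.

End ValuationRing.

(** [extend_abs] picks by [xget] with the zero function as default; existence makes the choice a
    true extension. *)
Lemma padic_extension (R : realType) (p : nat) : prime p ->
  exists w : algC -> R, absval w /\ forall q : rat, w (ratr q) = padic_abs R p q.
Proof.
by move=> pr_p; have [B [hB maxB]] := maximal_subring pr_p; apply: (padic_absval pr_p hB maxB).
Qed.

(** * Absolute values on the algebraic numbers *)

Section ArchimedeanExtension.
Variable R : realType.

(** The modulus on algC has values in algC, not in R; nonnegative algebraic reals are carried to R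
    by their Dedekind cuts. *)
Let below (x : algC) : set R := [set ratr q | q in [set q : rat | ratr q <= x]].
Let rho (x : algC) : R := sup (below x).

Let rat_above (x : algC) : 0 <= x -> exists n : nat, x <= n%:R.
Proof. by move=> x0; exists (Num.bound x); apply: ltW; apply: archi_boundP. Qed.

Let has_sup_below x : 0 <= x -> has_sup (below x).
Proof.
move=> x0; split; first by exists 0, 0; rewrite /= ?rmorph0.
have [n hn] := rat_above x0; exists n%:R => _ [q hq <-].
by rewrite -(ratr_nat R) ler_rat -(ler_rat algC) (le_trans hq) // ratr_nat.
Qed.

Let rho_ge x q : 0 <= x -> ratr q <= x -> ratr q <= rho x.
Proof. by move=> x0 hq; apply: sup_upper_bound; [exact: has_sup_below|exists q]. Qed.

Let rho_le x q : 0 <= x -> x <= ratr q -> rho x <= ratr q.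
Proof.
move=> x0 hq; apply: ge_sup; first by have [] := has_sup_below x0.
by move=> _ [r hr <-]; rewrite ler_rat -(ler_rat algC) (le_trans hr).
Qed.

Let rat_real q : (ratr q : algC) \is Num.real.
Proof. by rewrite Creal_Crat // Crat_rat. Qed.

Let rho_lt x q : 0 <= x -> rho x < ratr q -> x <= ratr q.
Proof.
move=> x0; rewrite ltNge; apply: contraNT.
by rewrite -real_ltNge ?rat_real ?ger0_real // => /ltW; apply: rho_ge.
Qed.

Let rho_gt x q : 0 <= x -> ratr q < rho x -> ratr q <= x.
Proof.
move=> x0; rewrite ltNge; apply: contraNT.
by rewrite -real_ltNge ?rat_real ?ger0_real // => /ltW; apply: rho_le.
Qed.

Let rho_rat q : 0 <= q -> rho (ratr q) = ratr q.
Proof.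
move=> q0; have h : 0 <= (ratr q : algC) by rewrite ler0q.
by apply/le_anti/andP; split; [exact: rho_le|exact: rho_ge].
Qed.

Let rho_ge0 x : 0 <= x -> 0 <= rho x.
Proof. by move=> x0; rewrite -(rmorph0 (ratr : rat -> R)) rho_ge // rmorph0. Qed.

Let rho_gt0 x : 0 < x -> 0 < rho x.
Proof.
move=> x0; have x0' : 0 < x^-1 by rewrite invr_gt0.
have [n hn] := rat_above (ltW x0').
have n0 : (0 < n)%N by rewrite -(ltr0n algC) (lt_le_trans _ hn).
apply: (@lt_le_trans _ _ (ratr n%:R^-1)); first by rewrite ltr0q invr_gt0 ltr0n.
apply: rho_ge; first exact: ltW.
by rewrite fmorphV /= ratr_nat invf_ple ?posrE ?ltr0n.
Qed.

Let rho_mono x y : 0 <= x -> x <= y -> rho x <= rho y.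
Proof.
move=> x0 xy; have y0 := le_trans x0 xy; apply: ge_sup; first by have [] := has_sup_below x0.
by move=> _ [r hr <-]; apply: rho_ge => //; apply: le_trans xy.
Qed.

Let rhoD x y : 0 <= x -> 0 <= y -> rho (x + y) <= rho x + rho y.
Proof.
move=> x0 y0; have xy0 := addr_ge0 x0 y0; rewrite leNgt; apply/negP => h.
have [|q] := @rat_in_itvoo R (rho x) (rho (x + y) - rho y); first by lra.
rewrite in_itv /= => /andP[q1 q2].
have [|r] := @rat_in_itvoo R (rho y) (rho (x + y) - ratr q); first by lra.
rewrite in_itv /= => /andP[r1 r2].
have := @rho_le (x + y) (q + r) xy0; rewrite !rmorphD /= lerD ?rho_lt // => /(_ isT).
lra.
Qed.

Let rhoM x y : 0 <= x -> 0 <= y -> rho (x * y) = rho x * rho y.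
Proof.
move=> x0 y0; have xy0 := mulr_ge0 x0 y0.
have rho0 : rho 0 = 0 by have := @rho_rat 0 (lexx _); rewrite !rmorph0.
have [->|xn] := eqVneq x 0; first by rewrite mul0r rho0 mul0r.
have [->|yn] := eqVneq y 0; first by rewrite mulr0 rho0 mulr0.
have rx : 0 < rho x by apply: rho_gt0; rewrite lt_def xn.
have ry : 0 < rho y by apply: rho_gt0; rewrite lt_def yn.
have [h|h|//] := ltgtP (rho (x * y)) (rho x * rho y); exfalso.
- have [|q] := @rat_in_itvoo R (rho (x * y) / rho y) (rho x); first by rewrite ltr_pdivrMr.
  rewrite in_itv /= => /andP[q1 q2].
  have q0 : 0 < (ratr q : R) by rewrite (le_lt_trans _ q1) // divr_ge0 ?rho_ge0.
  have [|r] := @rat_in_itvoo R (rho (x * y) / ratr q) (rho y).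
    by rewrite ltr_pdivrMr // [rho y * _]mulrC -ltr_pdivrMr.
  rewrite in_itv /= => /andP[r1 r2].
  have r0 : 0 < (ratr r : R) by rewrite (le_lt_trans _ r1) // divr_ge0 ?rho_ge0 // ltW.
  have := @rho_ge (x * y) (q * r) xy0; rewrite !rmorphM /= ler_pM ?rho_gt //.
  + by move=> /(_ isT); rewrite leNgt [ratr q * _]mulrC -ltr_pdivrMr // r1.
  + by move: q0; rewrite ltr0q ler0q => /ltW.
  + by move: r0; rewrite ltr0q ler0q => /ltW.
have [|q] := @rat_in_itvoo R (rho x) (rho (x * y) / rho y); first by rewrite ltr_pdivlMr.
rewrite in_itv /= => /andP[q1 q2].
have q0 : 0 < (ratr q : R) by rewrite (lt_trans rx).
have [|r] := @rat_in_itvoo R (rho y) (rho (x * y) / ratr q).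
  by rewrite ltr_pdivlMr // [rho y * _]mulrC -ltr_pdivlMr.
rewrite in_itv /= => /andP[r1 r2].
have := @rho_le (x * y) (q * r) xy0; rewrite !rmorphM /= ler_pM ?rho_lt //.
by move=> /(_ isT); rewrite leNgt [ratr q * _]mulrC -ltr_pdivlMr // r2.
Qed.

Lemma archimedean_extension : exists w : algC -> R,
  absval w /\ forall q : rat, w (ratr q) = usual_abs R q.
Proof.
exists (fun x => rho `|x|); split; last by move=> q; rewrite -ratr_norm rho_rat.
split=> [x|x|x y|x y]; first exact: rho_ge0.
- split=> [h|->]; last by rewrite normr0; have := @rho_rat 0 (lexx _); rewrite !rmorph0.
  apply/eqP; rewrite -normr_eq0 eq_le normr_ge0 andbT; apply: contraT.
  rewrite -real_ltNge ?normr_real ?real0 // => /rho_gt0.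
  by rewrite h ltxx.
- by rewrite normrM rhoM.
by apply: le_trans (rhoD _ _) => //; apply: rho_mono => //; exact: ler_normD.
Qed.

End ArchimedeanExtension.

Section AbsoluteValue.
Variables (R : realType) (w : algC -> R).
Hypothesis hw : absval w.

Lemma absval_ge0 x : 0 <= w x. Proof. by case: hw. Qed.

Lemma absval_eq0 x : (w x == 0) = (x == 0).
Proof. by case: hw => _ h _ _; apply/eqP/eqP => /h. Qed.

Lemma absvalM x y : w (x * y) = w x * w y. Proof. by case: hw. Qed.

Lemma absvalD x y : w (x + y) <= w x + w y. Proof. by case: hw. Qed.

Lemma absval0 : w 0 = 0. Proof. by apply/eqP; rewrite absval_eq0. Qed.

Lemma absval_gt0 x : (0 < w x) = (x != 0).
Proof. by rewrite lt_def absval_eq0 absval_ge0 andbT. Qed.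

Lemma absval1 : w 1 = 1.
Proof.
have h : w 1 != 0 by rewrite absval_eq0 oner_eq0.
by apply: (mulfI h); rewrite -absvalM !mulr1.
Qed.

Lemma absvalX x n : w (x ^+ n) = w x ^+ n.
Proof. by elim: n => [|n IH]; rewrite ?expr0 ?absval1 // !exprS absvalM IH. Qed.

Lemma absvalN x : w (- x) = w x.
Proof.
have h : w (-1) = 1.
  by apply/eqP; rewrite -(@eqrXn2 _ 2) ?absval_ge0 // -absvalX sqrrN !expr1n absval1.
by rewrite -mulN1r absvalM h mul1r.
Qed.

Lemma absvalV x : w x^-1 = (w x)^-1.
Proof.
have [->|x0] := eqVneq x 0; first by rewrite invr0 absval0 invr0.
have h : w x != 0 by rewrite absval_eq0.
by apply: (mulfI h); rewrite -absvalM !mulfV // absval1.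
Qed.

Lemma absval_div x y : w (x / y) = w x / w y.
Proof. by rewrite absvalM absvalV. Qed.

Lemma absval_prod (I : Type) (r : seq I) (F : I -> algC) :
  w (\prod_(i <- r) F i) = \prod_(i <- r) w (F i).
Proof. exact: (big_morph w absvalM absval1). Qed.

Hypothesis w_nat : forall n, w n%:R <= 1.

(* Apply the triangle inequality to the binomial expansion of (x + y)^n. *)
Lemma absval_ultra x y : w (x + y) <= Num.max (w x) (w y).
Proof.
set M := Num.max _ _; have M0 : 0 <= M by rewrite le_max absval_ge0.
have key n : w (x + y) ^+ n <= n.+1%:R * M ^+ n.
  rewrite -absvalX exprDn; have h : w (\sum_(i < n.+1) x ^+ (n - i) * y ^+ i *+ 'C(n, i)) <= \sum_(i < n.+1) M ^+ n.
    apply: (@le_trans _ _ (\sum_(i < n.+1) w (x ^+ (n - i) * y ^+ i *+ 'C(n, i)))).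
      by apply: (big_ind2 (fun a b => w a <= b)) => [|a a' b b' ha hb|//]; rewrite ?absval0 //;
         apply: (le_trans (absvalD _ _)); apply: lerD.
    apply: ler_sum => i _; rewrite -mulr_natl !absvalM !absvalX.
    have -> : M ^+ n = 1 * (M ^+ (n - i) * M ^+ i) by rewrite mul1r -exprD subnK // -ltnS.
    apply: ler_pM; rewrite ?absval_ge0 ?w_nat ?mulr_ge0 ?exprn_ge0 ?absval_ge0 //.
    by apply: ler_pM; rewrite ?exprn_ge0 ?absval_ge0 // lerXn2r ?nnegrE ?absval_ge0 // le_max lexx ?orbT.
  by rewrite sumr_const card_ord -mulr_natl in h.
rewrite leNgt; apply/negP => h.
have Mp : 0 < M.
  rewrite lt_def M0 andbT; apply/eqP => Me; have := key 1%N.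
  by rewrite Me expr0n mulr0 expr1 => /(lt_le_trans h); rewrite Me ltxx.
pose e := w (x + y) / M - 1.
have e0 : 0 < e by rewrite subr_gt0 ltr_pdivlMr // mul1r.
have bern n : 1 + n%:R * e <= (w (x + y) / M) ^+ n.
  elim: n => [|n IH]; first by rewrite mul0r addr0 expr0.
  have wE : w (x + y) / M = 1 + e by rewrite /e; ring.
  rewrite exprS; apply: (@le_trans _ _ ((1 + e) * (1 + n%:R * e))).
    rewrite -[n.+1%:R]natr1; have := mulr_ge0 (ler0n R n) (sqr_ge0 e).
    by move: (n%:R) => m; nra.
  by rewrite {1}wE ler_pM2l // addr_gt0.
(* With n e^2 > 2, (1 + e)^(2n) >= (1 + n e)^2 > 2n + 1, against the bound [key] at the exponent
   2n. *)
pose n := (Num.truncn (2 / e ^+ 2)).+1.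
have hn : 2 / e ^+ 2 < n%:R by apply: truncnS_gt.
have := key (n * 2)%N; rewrite -ler_pdivrMr ?exprn_gt0 // -expr_div_n exprM => hk.
have : (1 + n%:R * e) ^+ 2 <= (n * 2).+1%:R.
  apply: le_trans hk; rewrite lerXn2r ?nnegrE ?bern ?exprn_ge0 ?divr_ge0 ?absval_ge0 //.
  by rewrite addr_ge0 // mulr_ge0 // ltW.
move: hn; rewrite ltr_pdivrMr ?exprn_gt0 // -[(n * 2).+1%:R]natr1 natrM.
have : (0 : R) < n%:R by rewrite ltr0n.
move: (n%:R) => m m0 h1; nra.
Qed.

Lemma absval_dominant x y : w y < w x -> w (x + y) = w x.
Proof.
move=> yx; apply/le_anti; rewrite (le_trans (absval_ultra _ _)) ?ge_max ?lexx ?(ltW yx) //=.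
have := absval_ultra (x + y) (- y); rewrite addrK absvalN le_max => /orP[//|h].
by have := lt_le_trans yx h; rewrite ltxx.
Qed.

Lemma absval_sum_lt (I : eqType) (r : seq I) (F : I -> algC) (M : R) : 0 < M ->
  (forall i, i \in r -> w (F i) < M) -> w (\sum_(i <- r) F i) < M.
Proof.
move=> M0; elim: r => [|i r IH] h; first by rewrite big_nil absval0.
rewrite big_cons (le_lt_trans (absval_ultra _ _)) // gt_max h ?mem_head //=.
by apply: IH => j jr; apply: h; rewrite inE jr orbT.
Qed.

Lemma absval_int_le1 (m : int) : w m%:~R <= 1.
Proof. by case: m => n; [exact: w_nat|rewrite NegzE mulrNz absvalN w_nat]. Qed.

Lemma absval_root_le1 (q : {poly int}) x : w (lead_coef q)%:~R = 1 ->
  root (map_poly intr q) x -> w x <= 1.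
Proof.
move=> lc /rootP; rewrite horner_coef size_map_inj_poly //; last exact: intr_inj.
case s : (size q) => [|n].
  by move: lc; rewrite lead_coefE s nth_default ?s // absval0 => /eqP; rewrite eq_sym oner_eq0.
rewrite big_ord_recr /= coef_map addrC => e; rewrite leNgt; apply/negP => x1.
have x0 : 0 < w x by apply: lt_trans x1.
have lcE : w (q`_n)%:~R = 1 by rewrite -lc lead_coefE s.
have h := @absval_sum_lt _ (index_enum 'I_n) (fun i => (map_poly intr q)`_i * x ^+ i) (w x ^+ n).
move: e => /eqP; rewrite addr_eq0 => /eqP/(congr1 w).
rewrite absvalN absvalM lcE mul1r absvalX => e.
suff : w x ^+ n < w x ^+ n by rewrite ltxx.
rewrite {1}e; apply: h => [|i _]; first by rewrite exprn_gt0.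
rewrite absvalM absvalX coef_map /=.
apply: (@le_lt_trans _ _ (w x ^+ i)); last by rewrite ltr_eXn2l.
by rewrite ler_piMl ?exprn_ge0 ?absval_ge0 // absval_int_le1.
Qed.

End AbsoluteValue.

(** * Embeddings of number fields *)

(** A norm: the product is symmetric in the roots, hence a rational polynomial in their elementary
    symmetric functions, which are the coefficients of m up to sign. *)
Lemma prod_roots_rat (m q : {poly rat}) (rs : seq algC) :
  map_poly ratr m = \prod_(z <- rs) ('X - z%:P) ->
  \prod_(z <- rs) (map_poly ratr q).[z] \in Crat.
Proof.
move=> mE; pose n := size rs; pose v := tnth (in_tuple rs).
pose ev : {mpoly rat[n]} -> algC := mmap (ratr : rat -> algC) v.
have evC a : ev a%:MP = ratr a by rewrite /ev mmapC.
have evX i : ev 'X_i = v i by rewrite /ev mmapX mmap1U.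
pose P : {mpoly rat[n]} := \prod_(i < n) (map_poly (@mpolyC n rat) q).['X_i].
have symP : P \is symmetric.
  apply/issymP => s; rewrite /P rmorph_prod [RHS](reindex_inj (@perm.perm_inj _ s)) /=.
  apply: eq_bigr => i _; rewrite !horner_coef rmorph_sum /=.
  apply: eq_bigr => j _; rewrite rmorphM rmorphXn /= coef_map /=.
  by rewrite /msym mmapC mmapX mmap1U.
have [t [tE _]] := sym_fundamental symP.
have -> : \prod_(z <- rs) (map_poly ratr q).[z] = ev P.
  rewrite /ev /P rmorph_prod /= (big_nth 0) big_mkord; apply: eq_bigr => i _.
  rewrite !horner_coef rmorph_sum /= !size_map_inj_poly ?rmorph0 //.
  - apply: eq_bigr => j _; rewrite rmorphM rmorphXn /= !coef_map /=.
    by rewrite -/(ev _) -/(ev 'X_i) evC evX /v (tnth_nth 0).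
  - by move=> a b /eqP; rewrite mpolyC_eq => /eqP.
  exact: fmorph_inj.
rewrite -tE comp_mpolyE /ev rmorph_sum; apply: rpred_sum => k _ /=.
rewrite mmapZ rmorph_prod /=; apply: rpredM; first exact: Crat_rat.
apply: rpred_prod => i _; rewrite rmorphXn /= rpredX // tnth_mktuple.
have -> : mmap ratr v (mesym n rat i.+1) = (mesym n algC i.+1).@[v].
  rewrite /mesym rmorph_sum raddf_sum /=; apply: eq_bigr => h _.
  rewrite !rmorph_prod /=; apply: eq_bigr => j _.
  by rewrite -/(ev 'X_j) evX mevalXU.
have := mroots_coeff (in_tuple rs) (lift ord0 i); rewrite -mE coef_map /= => e.
have -> : (mesym n algC i.+1).@[v] = (-1) ^+ i.+1 * ratr m`_(n - i.+1) :> algC.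
  by rewrite e mulrA -exprD addnn -mul2n exprM sqrrN !expr1n mul1r.
by rewrite rpredM ?Crat_rat // rpredX // rpredN rpred1.
Qed.

Section Embeddings.
Variable K : fieldExtType rat.

Let morph_poly (g : {rmorphism K -> algC}) (q : {poly rat}) x :
  g (map_poly (in_alg K) q).[x] = (map_poly ratr q).[g x].
Proof.
rewrite -horner_map -map_poly_comp /=; congr (_.[_]); apply: eq_map_poly => a /=.
by rewrite alg_num_field fmorph_rat.
Qed.

(** By the primitive element theorem an embedding is given by the image of [th], which can be any
    root of its minimal polynomial; separability makes the roots distinct. The last clause is the
    rationality of norms. *)
Lemma embeddings_enum : exists S : seq (K -> algC),
  [/\ uniq S, size S = \dim {:K}, forall f, @embeddings K f <-> f \in S &
      forall x, \prod_(f <- S) f x \in Crat].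
Proof.
have sep : separable 1%AS {:K}%AS.
  apply/separableP => y _; apply/negP => /negP/separablePn_pchar [p].
  by rewrite pchar_lalg pchar_num.
have genE := eq_adjoin_separable_generator sep (sub1v _).
set th := separable_generator _ _ in genE.
have [m mE] := polyOver1P (minPolyOver 1%AS th).
have repr y : exists q : {poly rat}, (map_poly (in_alg K) q).[th] = y.
  have [q qE] := polyOver1P (Fadjoin_polyOver 1%AS th y).
  by exists q; rewrite -qE Fadjoin_poly_eq // -genE memvf.
have [q qP] := choice repr.
have dvd_m (r : {poly rat}) z : (map_poly (in_alg K) r).[th] = 0 ->
    root (map_poly ratr m : {poly algC}) z -> (map_poly ratr r).[z] = 0.
  move=> rth rz; have : minPoly 1%AS th %| map_poly (in_alg K) r.
    by rewrite minPoly_dvdp ?/root ?rth //; apply/polyOver1P; exists r.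
  rewrite mE dvdp_map => /dvdpP[s ->].
  by rewrite rmorphM hornerM (rootP rz) mulr0.
have mm : m \is monic by rewrite -(map_monic (in_alg K)) -mE monic_minPoly.
have [rs rsE] := closed_field_poly_normal (map_poly ratr m : {poly algC}).
rewrite lead_coef_map (monicP mm) rmorph1 scale1r in rsE.
have urs : uniq rs.
  rewrite -separable_prod_XsubC -rsE separable_map -(separable_map (in_alg K)) -mE.
  by have := separable_generatorP {:K}%AS 1%AS.
have rootE z : root (map_poly ratr m) z = (z \in rs) by rewrite rsE root_prod_XsubC.
have srs : size rs = \dim {:K}.
  have := size_minPoly 1%AS th; rewrite adjoin_degreeE -genE dimv1 divn1 mE size_map_poly.
  by rewrite -(size_map_poly (ratr : rat -> algC)) rsE size_prod_XsubC => -[].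
pose e z (y : K) : algC := (map_poly ratr (q y)).[z].
have eP z : z \in rs -> forall r y, (map_poly (in_alg K) r).[th] = y -> e z y = (map_poly ratr r).[z].
  move=> zrs r y ry; apply/eqP; rewrite -subr_eq0 -hornerN -hornerD -rmorphB /=.
  by apply/eqP/dvd_m; rewrite ?rootE // rmorphB hornerD hornerN qP ry subrr.
exists (map e rs); split.
- rewrite map_inj_in_uniq // => z z' zr zr' h.
  have eX y : y \in rs -> e y th = y.
    by move=> yr; rewrite (eP _ yr 'X) map_polyX hornerX.
  by rewrite -(eX z zr) h eX.
- by rewrite size_map.
- move=> f; split=> [[g gE]|/mapP[z zr ->]].
    apply/mapP; exists (g th).
      by rewrite -rootE /root -morph_poly -mE minPolyxx rmorph0.
    by apply/funext => y; rewrite gE /e -morph_poly qP.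
  have eB : zmod_morphism (e z).
    move=> x y; rewrite (eP _ zr (q x - q y)) ?rmorphB ?hornerD ?hornerN ?qP //.
  have eM : monoid_morphism (e z).
    split; first by rewrite (eP _ zr 1) rmorph1 hornerC.
    by move=> x y; rewrite (eP _ zr (q x * q y)) ?rmorphM ?hornerM ?qP.
  pose aM := GRing.isZmodMorphism.Build K algC (e z) eB.
  pose mM := GRing.isMonoidMorphism.Build K algC (e z) eM.
  pose g : {rmorphism K -> algC} := HB.pack (e z) aM mM.
  by exists g.
by move=> x; rewrite big_map; apply: prod_roots_rat rsE.
Qed.

End Embeddings.

(** * Lower bound for the height *)

Section Places.
Variable R : realType.
Implicit Types (p : nat) (x : algC).

Local Notation wp p := (extend_abs (padic_abs R p)).
Local Notation woo := (extend_abs (@usual_abs R)).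

Lemma padic_extP p : prime p -> absval (wp p) /\ forall q, wp p (ratr q) = padic_abs R p q.
Proof.
move=> /(padic_extension R)[w wP].
by apply: (@xgetPex _ _ [set w | absval w /\ forall q, w (ratr q) = padic_abs R p q]); exists w.
Qed.

Lemma usual_extP : absval woo /\ forall q, woo (ratr q) = usual_abs R q.
Proof.
have [w wP] := archimedean_extension R.
by apply: (@xgetPex _ _ [set w | absval w /\ forall q, w (ratr q) = usual_abs R q]); exists w.
Qed.

Lemma padic_ext_nat p n : prime p -> (0 < n)%N -> wp p n%:R = (p%:R ^+ logn p n)^-1.
Proof.
move=> pr_p n0; have [_ wE] := padic_extP pr_p.
rewrite -(ratr_nat algC) wE /padic_abs pnatr_eq0 (gtn_eqF n0).
by rewrite -[n%:R]/(n%:Z%:~R) denq_int numq_int /= logn1 expr0 div1r.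
Qed.

Lemma padic_ext_nat_le1 p n : prime p -> wp p n%:R <= 1.
Proof.
move=> pr_p; have [hw _] := padic_extP pr_p.
case: n => [|n]; first by rewrite absval0.
by rewrite padic_ext_nat // invf_le1 ?exprn_gt0 ?ltr0n ?prime_gt0 // exprn_ege1 // ler1n prime_gt0.
Qed.

Lemma padic_ext_coprime p n : prime p -> ~~ (p %| n)%N -> wp p n%:R = 1.
Proof.
move=> pr_p pn; have n0 : (0 < n)%N by case: n pn => //; rewrite dvdn0.
by rewrite padic_ext_nat // lognE pr_p n0 (negbTE pn) expr0 invr1.
Qed.

(** Take the primes beyond the leading coefficients of integer equations for x and for 1/x: both
    sizes are then at most 1, whichever extension was picked. *)
Lemma padic_ext_large x : x != 0 -> exists N, forall p, prime p -> (N <= p)%N -> wp p x = 1.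
Proof.
have le1 y : exists N, forall p, prime p -> (N <= p)%N -> wp p y <= 1.
  have [q q0 rq] := algC_int_root y; exists `|lead_coef q|.+1 => p pr_p Np.
  have [hw _] := padic_extP pr_p; apply: (absval_root_le1 hw _ _ rq) => [n|].
    exact: padic_ext_nat_le1.
  have a0 : (0 < `|lead_coef q|)%N by rewrite absz_gt0 lead_coef_eq0.
  have h : wp p (`|lead_coef q|%N)%:R = 1.
    by rewrite padic_ext_coprime // gtnNdvd.
  have [->|->] : lead_coef q = `|lead_coef q|%N%:Z \/ lead_coef q = - (`|lead_coef q|%N%:Z) by lia.
    exact: h.
  by rewrite mulrNz absvalN.
move=> x0; have [N hN] := le1 x; have [M hM] := le1 x^-1.
exists (maxn N M) => p pr_p; rewrite geq_max => /andP[Np Mp].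
have [hw _] := padic_extP pr_p; apply/le_anti; rewrite hN //=.
have := hM p pr_p Mp; rewrite absvalV // invf_le1 // absval_gt0 //.
Qed.

Lemma ln_nat_primes (n M : nat) : (0 < n)%N -> (n <= M)%N ->
  ln (n%:R : R) = \sum_(0 <= p < M.+1 | prime p) (logn p n)%:R * ln p%:R.
Proof.
move=> n0 nM; rewrite -{1}(partnT n0) (widen_partn _ nM) natr_prod.
rewrite [in RHS]big_mkcond /=.
have h (r : seq nat) : (0 : R) < \prod_(p <- r) (p ^ logn p n)%:R /\
    ln (\prod_(p <- r) (p ^ logn p n)%:R : R) = \sum_(p <- r) if prime p then (logn p n)%:R * ln p%:R else 0.
  elim: r => [|p r [IH1 IH2]]; first by rewrite !big_nil ln1.
  have pp : (0 : R) < (p ^ logn p n)%:R.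
    rewrite ltr0n expn_gt0; case: (posnP p) => //= ->; by rewrite lognE.
  rewrite !big_cons mulr_gt0 //; split=> //; rewrite lnM ?posrE // IH2; congr (_ + _).
  case: ifP => pr_p; last by rewrite lognE pr_p expn0 ln1.
  by rewrite natrX lnXn ?ltr0n ?prime_gt0 // mulr_natl.
by have [_ <-] := h (index_iota 0 M.+1).
Qed.

Lemma product_formula (c : rat) : c != 0 -> exists N, forall M, (N <= M)%N ->
  ln (usual_abs R c) + \sum_(0 <= p < M.+1 | prime p) ln (padic_abs R p c) = 0.
Proof.
move=> c0; pose a := `|numq c|%N; pose b := `|denq c|%N.
have a0 : (0 < a)%N by rewrite absz_gt0 numq_eq0.
have b0 : (0 < b)%N by rewrite absz_gt0 denq_neq0.
exists (maxn a b) => M; rewrite geq_max => /andP[aM bM].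
have -> : ln (usual_abs R c) = ln a%:R - ln b%:R.
  rewrite -lnV ?posrE ?ltr0n // -lnM ?posrE ?invr_gt0 ?ltr0n //; congr ln.
  rewrite /usual_abs -{1}[c]divq_num_den normrM normfV rmorphM fmorphV /=.
  by rewrite -!intr_norm !ratr_int /a /b -!abszE -!pmulrn.
rewrite (ln_nat_primes a0 aM) (ln_nat_primes b0 bM) -sumrB -big_split /=.
rewrite big1 // => p pr_p; have pp : (0 : R) < p%:R by rewrite ltr0n prime_gt0.
rewrite /padic_abs (negbTE c0) -/a -/b lnM ?posrE ?invr_gt0 ?exprn_gt0 //.
by rewrite lnV ?posrE ?exprn_gt0 // !lnXn // !mulr_natl; ring.
Qed.

Lemma sum_primesE (F : nat -> R) M : (forall p, prime p -> (M < p)%N -> F p = 0) ->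
  \sum_(p \in [set p | prime p]) F p = \sum_(0 <= p < M.+1 | prime p) F p.
Proof.
move=> F0; rewrite -[RHS]big_filter [RHS]fsbig_seq ?filter_uniq ?iota_uniq //.
symmetry; apply: fsbig_widen => [p|p [pr_p pn]].
  by rewrite /mkset mem_filter => /andP[].
suff : F p = 0 by []; apply: F0 => //; rewrite ltnNge; apply/negP => h; apply: pn.
by rewrite /mkset mem_filter mem_index_iota ltnS h pr_p.
Qed.

Lemma log_max_ge nu (x : seq algC) t : absval (@extend_abs R nu) -> t \in x -> t != 0 ->
  ln (extend_abs nu t) <= log_max nu x.
Proof.
move=> hw tx t0; have h : 0 < extend_abs nu t by rewrite absval_gt0.
have le : extend_abs nu t <= \big[Num.max/0]_(u <- x) extend_abs nu u.
  by apply: le_bigmax_seq.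
by rewrite /log_max ler_ln ?posrE // (lt_le_trans h).
Qed.

(** Each local term is at least log |s(b)|, and at p it is at least log |s(a)|, which is l more. The
    logarithms of |s(b)| add up over s to that of the norm of b, and over all places to 0. *)
Lemma field_height_ge (K : fieldExtType rat) (x : seq K) (a b : K) p (l : R) :
  prime p -> a \in x -> b \in x -> a != 0 -> b != 0 ->
  (forall g : {rmorphism K -> algC}, l <= ln (wp p (g (a / b)))) ->
  l <= field_height R x.
Proof.
move=> pr_p ax bx a0 b0 hl; have [S [uS sS SP prodS]] := embeddings_enum K.
have SE : @embeddings K = [set` S] by apply/seteqP; split=> f /SP.
have SM f : f \in S -> exists g : {rmorphism K -> algC}, f = g.
  by move=> /SP[g gE]; exists g; apply/funext.
have [c cE] := CratP _ (prodS b).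
have fb0 f : f \in S -> f b != 0 by move=> /SM[g ->]; rewrite fmorph_eq0.
have c0 : c != 0.
  apply: contraTneq isT => c0; move: cE; rewrite c0 rmorph0 => /eqP.
  by rewrite prodf_seq_eq0 => /hasP[f fS /= /eqP h]; move: (fb0 f fS); rewrite h eqxx.
have lnS nu : absval (@extend_abs R nu) -> (forall q, extend_abs nu (ratr q) = nu q) ->
    \sum_(f <- S) ln (extend_abs nu (f b)) = ln (nu c).
  move=> hw wE; rewrite -wE -cE absval_prod //.
  have h (r : seq (K -> algC)) : {subset r <= S} -> (0 : R) < \prod_(f <- r) extend_abs nu (f b) /\
      \sum_(f <- r) ln (extend_abs nu (f b)) = ln (\prod_(f <- r) extend_abs nu (f b)).
    elim: r => [|f r IH] sr; first by rewrite !big_nil ln1.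
    have [h1 h2] := IH (fun g gr => sr g (mem_behead (s := f :: r) gr)).
    have fS := sr f (mem_head _ _); have h3 : 0 < extend_abs nu (f b) by rewrite absval_gt0 // fb0.
    by rewrite !big_cons mulr_gt0 //; split=> //; rewrite lnM ?posrE // h2.
  by have [_ ->] := h S (fun f => id).
have [N1 hN1] := product_formula c0.
have [N2 hN2] : exists N, forall q, prime q -> (N <= q)%N -> forall f t, f \in S -> t \in x ->
    t != 0 -> wp q (f t) = 1.
  pose L := [seq f t | f <- S, t <- [seq t <- x | t != 0]].
  have L0 z : z \in L -> z != 0.
    move=> /allpairsP[[f t] /= [/SM[g ->] + ->]]; rewrite mem_filter fmorph_eq0.
    by case/andP.
  have [N hN] : exists N, forall q, prime q -> (N <= q)%N -> forall z, z \in L -> wp q z = 1.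
    elim: L L0 => [|z L IH] L0; first by exists 0%N.
    have [N hN] := IH (fun y yL => L0 y (mem_behead (s := z :: L) yL)).
    have [M hM] := padic_ext_large (L0 z (mem_head _ _)).
    exists (maxn N M) => q pr_q; rewrite geq_max => /andP[Nq Mq] y.
    by rewrite inE => /orP[/eqP->|]; [exact: hM|exact: hN].
  exists N => q pr_q Nq f t fS tx t0; apply: hN => //.
  by apply/allpairsP; exists (f, t); rewrite mem_filter t0.
(* Beyond M the local terms of the height vanish; M is also large enough for the product formula and
   to include p. *)
pose M := maxn p (maxn N1 N2); have pM : (p <= M)%N by rewrite leq_maxl.
have N1M : (N1 <= M)%N by rewrite !leq_max leqnn ?orbT.
have N2M : (N2 <= M)%N by rewrite !leq_max leqnn ?orbT.
have lm q f : prime q -> (M < q)%N -> f \in S -> log_max (padic_abs R q) (map f x) = 0.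
  move=> pr_q Mq fS; have N2q : (N2 <= q)%N by rewrite (leq_trans N2M) // ltnW.
  have [hw _] := padic_extP pr_q; apply/le_anti/andP; split; last first.
    by rewrite -(ln1 R) -(hN2 q pr_q N2q f b fS bx b0) log_max_ge ?map_f ?fb0.
  rewrite /log_max ln_le0 // big_map big_seq; apply: bigmax_le => // t tx.
  have [->|t0] := eqVneq t 0; last by rewrite hN2.
  by have [g ->] := SM f fS; rewrite rmorph0 absval0 ?ler01.
have n0 : (0 : R) < (\dim {:K})%:R by rewrite ltr0n adim_gt0.
rewrite /field_height ler_pdivlMl // -sS SE -fsbig_seq //.
rewrite (@sum_primesE _ M) => [|q pr_q Mq]; last first.
  by rewrite -fsbig_seq // big_seq big1 // => f fS; apply: lm.
have low nu : absval (@extend_abs R nu) ->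
    \sum_(f <- S) ln (extend_abs nu (f b)) <= \sum_(f <- S) log_max nu (map f x).
  move=> hw; rewrite !big_seq; apply: ler_sum => f fS.
  by apply: log_max_ge; rewrite ?map_f ?fb0.
have [ho oE] := usual_extP; have := low _ ho; rewrite (lnS _ ho oE) => h1.
have h2 : \sum_(0 <= q < M.+1 | prime q) ln (padic_abs R q c) + (size S)%:R * l <=
    \sum_(0 <= q < M.+1 | prime q) \sum_(s \in [set` S]) log_max (padic_abs R q) [seq s i | i <- x].
  rewrite -[X in X + _ <= _]big_filter -[leRHS]big_filter; set r := [seq q <- _ | prime q].
  have pr : p \in r by rewrite mem_filter pr_p mem_index_iota ltnS pM.
  have ur : uniq r by rewrite filter_uniq ?iota_uniq.
  rewrite (bigD1_seq p) //= [leRHS](bigD1_seq p) //= addrAC; apply: lerD; last first.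
    rewrite big_seq_cond [leRHS]big_seq_cond; apply: ler_sum => q /andP[].
    rewrite mem_filter => /andP[pr_q _] _; have [hw wE] := padic_extP pr_q.
    by rewrite -fsbig_seq // -(lnS _ hw wE); apply: low.
  have [hw wE] := padic_extP pr_p; rewrite -fsbig_seq // -(lnS _ hw wE).
  rewrite -sum1_size natr_sum mulr_suml -big_split /= !big_seq; apply: ler_sum => f fS.
  rewrite mul1r; have [g fE] := SM f fS.
  apply: le_trans (log_max_ge (t := f a) hw _ _); rewrite ?map_f // fE ?fmorph_eq0 //.
  have := hl g; rewrite fmorph_div absval_div // lnM ?lnV ?posrE ?invr_gt0 ?absval_gt0 ?fmorph_eq0 //.
  lra.
have := hN1 M N1M; lra.
Qed.

End Places.

(** The field and the embedding [i] inside [height] come from a choice, so the hypothesis covers all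
    of them; [g] runs over the conjugates. *)
Lemma height_ge (R : realType) (P : P2) (p : nat) (l : R) : prime p ->
  coords P 0 i1 != 0 -> coords P 0 i2 != 0 ->
  (forall (K : fieldExtType rat) (i g : {rmorphism K -> algC}) y z,
    i y = coords P 0 i0 / coords P 0 i2 -> i z = coords P 0 i1 / coords P 0 i2 ->
    l <= ln (extend_abs (padic_abs R p) (g z))) ->
  l <= height R P.
Proof.
move=> pr_p y0 z0 hl; rewrite /height.
case: num_field_exists => K [i [x xE _]].
have xi (j : 'I_3) : exists2 a, a \in x & i a = coords P 0 j.
  have : coords P 0 j \in [seq i a | a <- x] by rewrite xE map_f // mem_enum.
  by move=> /mapP[a ax ->]; exists a.
have [a ax aE] := xi i0; have [b bx bE] := xi i1; have [c cx cE] := xi i2.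
apply: (field_height_ge (a := b) (b := c) pr_p bx cx).
- by rewrite -(fmorph_eq0 i) bE.
- by rewrite -(fmorph_eq0 i) cE.
move=> g; apply: (hl K i g (a / c)); by rewrite fmorph_div ?aE ?bE cE.
Qed.

(** * Sizes at 2 and 3 along backward orbits *)

Section BackwardOrbit.
Variable R : realType.

(* The logarithms of the 3-adic sizes along the backward orbit, in units of (ln 3) / 4. *)
Fixpoint lsize (k : nat) : R :=
  match k with
  | 0 => 0
  | k'.+1 => match k' with 0 => 1 | k''.+1 => 2 * lsize k' - lsize k'' / 2 end
  end.

Lemma lsizeSS k : lsize k.+2 = 2 * lsize k.+1 - lsize k / 2. Proof. by []. Qed.

Lemma lsize_growth k : [/\ 0 <= lsize k, 1 <= lsize k.+1 & 3 / 2 * lsize k <= lsize k.+1].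
Proof.
elim: k => [|k [h1 h2 h3]]; first by rewrite /= ; split; lra.
by rewrite lsizeSS; split; lra.
Qed.

Lemma lsize_ge k : 1 + k%:R / 2 <= lsize k.+1.
Proof.
elim: k => [|k IH]; first by rewrite mul0r addr0.
have [_ h1 _] := lsize_growth k; have [_ _ h2] := lsize_growth k.+1.
by rewrite -natr1; lra.
Qed.

Variable t : algC.
Hypothesis tE : t ^+ 2 = t + 2^-1.

(** The product t (t - 1) = 1/2 is a unit, which excludes every size of t but 1; and (1/2 - t)^2 =
    3/4. *)
Lemma golden3 (w : algC -> R) : absval w -> (forall n, w n%:R <= 1) ->
  w 3%:R = 3^-1 -> w 2%:R = 1 -> w t = 1 /\ w (2^-1 - t) ^+ 2 = 3^-1.
Proof.
move=> hw wn w3 w2.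
have h1 : w t * w (t - 1) = 1.
  rewrite -absvalM //; have -> : t * (t - 1) = 2^-1 by rewrite mulrBr mulr1 -expr2 tE; ring.
  by rewrite absvalV // w2 invr1.
have w1 := absval1 hw; have wN1 : w (-1) = 1 by rewrite absvalN.
split; last first.
  rewrite -absvalX //; have -> : (2^-1 - t) ^+ 2 = 3%:R / 2%:R ^+ 2.
    by rewrite sqrrB tE; field.
  by rewrite absval_div // absvalX // w2 expr1n divr1.
have [h|h|//] := ltgtP (w t) 1.
  have h2 : w (t - 1) = 1 by rewrite addrC absval_dominant ?wN1.
  by move: h1; rewrite h2 mulr1.
have h2 : w (t - 1) = w t by rewrite absval_dominant ?wN1.
move: h1; rewrite h2 => e; exfalso; move: (w t) h e => r h e; nra.
Qed.

(** The Newton polygon of t^2 - t - 1/2 at 2 has a single slope. *)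
Lemma golden2 (w : algC -> R) : absval w -> (forall n, w n%:R <= 1) ->
  w 2%:R = 2^-1 -> w t ^+ 2 = 2.
Proof.
move=> hw wn w2; have wh : w 2^-1 = 2 by rewrite absvalV // w2 invrK.
rewrite -absvalX // tE; have [h|h|h] := ltgtP (w t) 2.
- by rewrite addrC absval_dominant ?wh.
- have : w (t ^+ 2) = w t by rewrite tE absval_dominant ?wh.
  by rewrite absvalX // => e; exfalso; move: (w t) h e => r h e; nra.
have := absval_ultra hw wn t 2^-1; rewrite -tE absvalX // wh h maxxx expr2 => e; exfalso; lra.
Qed.

Lemma chain_size2 (w : algC -> R) u v y : absval w -> (forall n, w n%:R <= 1) ->
  w 2%:R = 2^-1 -> w u ^+ 2 = 2 -> w v ^+ 2 = 2 ->
  [/\ v != 0, u + 2^-1 != 0 & y ^+ 2 * (u + 2^-1) = v ^+ 4 -> w y ^+ 2 = 2].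
Proof.
move=> hw wn w2 hu hv; have wh : w 2^-1 = 2 by rewrite absvalV // w2 invrK.
have u2 : w u < w 2^-1.
  by rewrite wh; move: (w u) (absval_ge0 hw u) hu => r r0 e; nra.
have hs : w (u + 2^-1) = 2 by rewrite addrC absval_dominant.
split; rewrite -?(absval_eq0 hw) ?hs ?pnatr_eq0 //.
  by apply/eqP => v0; move: hv; rewrite v0 expr0n /= => /eqP; rewrite eq_sym pnatr_eq0.
move=> /(congr1 w); rewrite absvalM // hs !absvalX // (exprM _ 2 2) hv => e; move: (w y ^+ 2) e => r e; lra.
Qed.

Lemma good_size2 (w : algC -> R) n u v : absval w -> (forall n, w n%:R <= 1) ->
  w 2%:R = 2^-1 -> w u ^+ 2 = 2 -> w v ^+ 2 = 2 -> good 4 2^-1 n u v.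
Proof.
move=> hw wn w2; elim: n u v => //= n IH u v hu hv.
have [h1 h2 _] := chain_size2 0 hw wn w2 hu hv; split=> // y yE.
by apply: IH => //; have [_ _] := chain_size2 y hw wn w2 hu hv; apply.
Qed.

(** Stated for any sequence with the same relations, because it is applied to all conjugates of the
    orbit. From |u_2 + 1/2| = 3^(-1/2) one gets |u_4| = 3^(1/4), whence the unit (ln 3) / 4. *)
Lemma chain_size3 (w : algC -> R) (u : nat -> algC) n : absval w -> (forall n, w n%:R <= 1) ->
  w 3%:R = 3^-1 -> w 2%:R = 1 -> u 2%N = - t -> u 3%N = t ->
  (forall k, (k.+4 <= n)%N -> u k.+4 ^+ 2 * (u k.+2 + 2^-1) = u k.+3 ^+ 4) ->
  forall k, (k.+3 <= n)%N -> 0 < w (u k.+3) /\ ln (w (u k.+3)) = lsize k * (ln 3 / 4).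
Proof.
move=> hw wn w3 w2 u2 u3 rel; have [wt wt'] := golden3 hw wn w3 w2.
have wh : w 2^-1 = 1 by rewrite absvalV // w2 invr1.
have lnX (x : R) m : 0 < x -> ln (x ^+ m) = m%:R * ln x.
  by move=> x0; rewrite lnXn // mulr_natl.
have step k : (k.+4 <= n)%N -> 0 < w (u k.+3) -> 0 < w (u k.+2 + 2^-1) ->
    0 < w (u k.+4) /\ 2 * ln (w (u k.+4)) + ln (w (u k.+2 + 2^-1)) = 4 * ln (w (u k.+3)).
  move=> kn h1 h2; have /(congr1 w) := rel k kn; rewrite absvalM // !absvalX // => e.
  have h3 : 0 < w (u k.+4).
    rewrite lt_def absval_ge0 // andbT; apply/eqP => h3.
    by have := exprn_gt0 4 h1; rewrite -e h3 expr0n mul0r ltxx.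
  split=> //; move/(congr1 (@ln R)): e.
  by rewrite lnM ?posrE ?exprn_gt0 // (lnX _ 2) // (lnX _ 4).
have pos k : lsize k.+1 * (ln 3 / 4) > 0 :> R.
  have [_ h _] := lsize_growth k; apply: mulr_gt0; first by rewrite (lt_le_trans _ h).
  by rewrite divr_gt0 // ln_gt0 // ltr1n.
have key k : (k.+4 <= n)%N -> [/\ 0 < w (u k.+3), ln (w (u k.+3)) = lsize k * (ln 3 / 4),
    0 < w (u k.+4) & ln (w (u k.+4)) = lsize k.+1 * (ln 3 / 4)].
  elim: k => [|k IH] kn.
    have h0 : 0 < w (u 3%N) by rewrite u3 wt.
    have h1 : 0 < w (u 2%N + 2^-1).
      rewrite u2 lt_def absval_ge0 // andbT; apply/eqP => h; move: wt'.
      by rewrite addrC h expr0n /= => /esym/eqP; rewrite invr_eq0 pnatr_eq0.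
    have [h2 e] := step 0%N kn h0 h1; split=> //.
      by rewrite u3 wt ln1 mul0r.
    move: wt' => /(congr1 (@ln R)); rewrite lnV ?posrE // addrC -u2 lnX //.
    by move: e; rewrite u3 wt ln1 /=; lra.
  have [h1 e1 h2 e2] := IH (ltnW kn).
  (* At index 3, t + 1/2 = t^2 is a unit; later the size of the term exceeds |1/2| = 1, so adding
     1/2 does not change it. *)
  have [h3 e3] : 0 < w (u k.+3 + 2^-1) /\ ln (w (u k.+3 + 2^-1)) = lsize k * (ln 3 / 4).
    case: k {IH kn h2 e2 step} h1 e1 => [|k] h1 e1.
      by rewrite u3 -tE absvalX // wt expr1n ln1 mul0r.
    have h : 1 < w (u k.+4).
      by rewrite ltNge; apply/negP => /ln_le0; rewrite e1 leNgt pos.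
    by rewrite absval_dominant ?wh.
  have [h4 e4] := step k.+1 kn h2 h3; split=> //.
  by move: e4; rewrite e3 e2 lsizeSS; lra.
case=> [|k] kn; first by rewrite u3 wt ln1 mul0r.
by have [_ _] := key k kn.
Qed.

End BackwardOrbit.

(** * The backward orbit of the fixed point *)

Definition golden : algC := (1 + sqrtC 3) / 2.

Lemma golden_sqr : golden ^+ 2 = golden + 2^-1.
Proof.
rewrite /golden expr_div_n sqrrD sqrtCK expr1n mul1r; by field.
Qed.

Definition orbit_step (q : algC * algC) : algC * algC :=
  (q.2, sqrtC (q.2 ^+ 4 / (q.1 + 2^-1))).

(** Consecutive terms form the points: (t, t), its other preimage (t, -t), then (-t, t), from which
    [orbit_step] starts. *)
Definition orbit (n : nat) : algC :=
  if n is m.+2 then (iter m orbit_step (- golden, golden)).1 else golden.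

Arguments orbit : simpl never.

Lemma orbit_sqrt n : orbit n.+4 = sqrtC (orbit n.+3 ^+ 4 / (orbit n.+2 + 2^-1)).
Proof. by []. Qed.

Section Orbit.
Variable R : realType.

Lemma padic_ext3 : let w := extend_abs (padic_abs R 3) in
  [/\ absval w, forall n, w n%:R <= 1, w 3%:R = 3^-1 & w 2%:R = 1].
Proof.
have pr3 : prime 3 by []; have [hw _] := padic_extP R pr3; split=> //.
- by move=> n; apply: padic_ext_nat_le1.
- by rewrite padic_ext_nat.
by rewrite padic_ext_coprime.
Qed.

Lemma padic_ext2 : let w := extend_abs (padic_abs R 2) in
  [/\ absval w, forall n, w n%:R <= 1 & w 2%:R = 2^-1].
Proof.
have pr2 : prime 2 by []; have [hw _] := padic_extP R pr2; split=> //.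
- by move=> n; apply: padic_ext_nat_le1.
by rewrite padic_ext_nat.
Qed.

(** These sizes also show that no term is 0 or -1/2, so the divisions in [orbit_step] are
    genuine. *)
Lemma orbit_size2 n : extend_abs (padic_abs R 2) (orbit n) ^+ 2 = 2.
Proof.
have [hw wn w2] := padic_ext2; set w := extend_abs _ in hw wn w2 *.
have ht := golden2 golden_sqr hw wn w2.
suff h m : w (orbit m.+2) ^+ 2 = 2 /\ w (orbit m.+3) ^+ 2 = 2.
  by case: n => [|[|n]] //; have [] := h n.
elim: m => [|m [h1 h2]]; first by rewrite /= absvalN.
have [_ c0 h3] := chain_size2 (orbit m.+4) hw wn w2 h1 h2; split=> //.
by apply: h3; rewrite orbit_sqrt sqrtCK divfK.
Qed.

Lemma orbit_neq0 n : orbit n != 0 /\ orbit n + 2^-1 != 0.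
Proof.
have [hw wn w2] := padic_ext2.
by have [] := chain_size2 0 hw wn w2 (orbit_size2 n) (orbit_size2 n).
Qed.

Lemma orbit_rel n : orbit n.+2 ^+ 2 * (orbit n + 2^-1) = orbit n.+1 ^+ 4.
Proof.
case: n => [|[|n]]; rewrite ?(exprM _ 2 2).
- by rewrite /= sqrrN -golden_sqr.
- by rewrite /= sqrrN -golden_sqr.
by rewrite orbit_sqrt sqrtCK divfK -?exprM //; case: (orbit_neq0 n.+2).
Qed.

Definition orbit_pt (n : nat) : P2 := pt (orbit n, orbit n.+1).

Lemma orbit_pt_good n m : goodP2 4 2^-1 m (orbit_pt n).
Proof.
have [hw wn w2] := padic_ext2; exists (orbit n, orbit n.+1) => //=.
exact: good_size2 hw wn w2 (orbit_size2 n) (orbit_size2 n.+1).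
Qed.

Let henonP : is_ratmap (henon 4 2^-1).
Proof.
have := iterate_ratmap 2^-1 (isT : (2 < 4)%N) 1.
congr is_ratmap; apply: eq_from_tnth => i.
by rewrite tnth_mktuple comp_mpoly_id.
Qed.

Lemma henon_maps_pt (u v x : algC) : v != 0 -> u + 2^-1 != 0 ->
  x ^+ 2 * (u + 2^-1) = v ^+ 4 ->
  ~ indet (henon 4 2^-1) (pt (v, x)) /\ maps_to (henon 4 2^-1) (pt (v, x)) (pt (u, v)).
Proof.
move=> v0 c0 rel; have [x0 fE] := ftE v0 c0 rel; have [lam lamP] := pt_coords.
have [l0 lE] := lamP (v, x); have [m0 mE] := lamP (u, v).
have eE : evalt (henon 4 2^-1) (coords (pt (v, x))) = (lam (v, x) ^+ 4 * x ^+ 2) *: vec u v 1.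
  by rewrite lE (evaltZ _ _ (henon_homog 2^-1 (isT : (2 < 4)%N))) (@evalt_ft 4 2^-1 (v, x)) // fE scalerA.
have e0 : evalt (henon 4 2^-1) (coords (pt (v, x))) != 0.
  by rewrite eE scaler_eq0 negb_or mulf_neq0 ?expf_neq0 //=; exact: affine_vec_neq0.
split; first exact: not_indet.
apply: maps_toP => //; exists (lam (v, x) ^+ 4 * x ^+ 2 / lam (u, v)).
by rewrite eE mE scalerA divfK.
Qed.

Lemma orbit_maps n : ~ indet (henon 4 2^-1) (orbit_pt n.+1) /\
  maps_to (henon 4 2^-1) (orbit_pt n.+1) (orbit_pt n).
Proof.
apply: henon_maps_pt (orbit_rel n); first by case: (orbit_neq0 n.+1).
by case: (orbit_neq0 n).
Qed.

Lemma golden_fixed : maps_to (henon 4 2^-1) (orbit_pt 0) (orbit_pt 0).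
Proof.
have [t0 c0] := orbit_neq0 0; have [|_ ] := @henon_maps_pt golden golden golden t0 c0; last by [].
by rewrite -golden_sqr -exprD.
Qed.

Lemma orbit_height k : lsize R k * (ln 3 / 4) <= height R (orbit_pt k.+2).
Proof.
have [hw wn w3 w2] := padic_ext3.
have [lam lamP] := pt_coords; have [l0 lE] := lamP (orbit k.+2, orbit k.+3).
have [o0 _] := orbit_neq0 k.+3.
have cE j : coords (orbit_pt k.+2) 0 j = lam (orbit k.+2, orbit k.+3) * [:: orbit k.+2; orbit k.+3; 1]`_j.
  by rewrite /orbit_pt lE !mxE.
apply: (@height_ge R _ 3) => //; rewrite ?cE ?mulf_neq0 ?oner_neq0 //.
move=> K i g y z; rewrite /= mulr1 ![lam _ * _]mulrC !mulfK // => yE zE.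
(* The map has rational coefficients, so applying it forward recovers all earlier terms inside K;
   the relations then pass to the conjugates by g. *)
have desc m (a b : K) : i a = orbit m -> i b = orbit m.+1 ->
    forall j, (j <= m.+1)%N -> exists x, i x = orbit j.
  elim: m a b => [|m IH] a b aE bE j.
    by case: j => [|[|//]] _; [exists a|exists b].
  rewrite leq_eqVlt => /orP[/eqP->|]; first by exists b.
  rewrite ltnS; apply: (IH (a ^+ 4 / b ^+ 2 - 2^-1) a) => //.
  rewrite rmorphB fmorph_div !rmorphXn fmorphV rmorph_nat aE bE -orbit_rel.
  by rewrite mulrC mulKf ?addrK // expf_neq0 //; case: (orbit_neq0 m.+2).
have /choice[v vP] : forall j, exists x, (j <= k.+3)%N -> i x = orbit j.
  move=> j; have [h|h] := leqP j k.+3; last by exists 0; lia.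
  by have [x xE] := desc k.+2 _ _ yE zE j h; exists x.
have inj := fmorph_inj i.
have gi a b : i a = i b -> g a = g b by move=> /inj ->.
have -> : z = v k.+3 by apply: inj; rewrite vP.
have tE' : g (v 0%N) ^+ 2 = g (v 0%N) + 2^-1.
  rewrite -(rmorph_nat g) -fmorphV -rmorphXn -rmorphD; apply: gi.
  by rewrite rmorphXn rmorphD fmorphV rmorph_nat vP //; exact: golden_sqr.
have [|||_ ->//] := @chain_size3 R (g (v 0%N)) tE' _ (g \o v) k.+3 hw wn w3 w2 _ _ _ k (leqnn _).
- by rewrite /= -rmorphN; apply: gi; rewrite rmorphN !vP.
- by apply: gi; rewrite !vP.
- move=> j jk /=; rewrite -(rmorph_nat g) -fmorphV -!rmorphXn -rmorphD -rmorphM; apply: gi.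
  rewrite rmorphM !rmorphXn rmorphD fmorphV rmorph_nat !vP ?orbit_rel //; lia.
Qed.

Lemma orbit_height_cvg : (fun n => height R (orbit_pt n)) @ \oo --> +oo.
Proof.
have q0 : 0 < ln 3 / 4 :> R by rewrite divr_gt0 // ln_gt0 // ltr1n.
apply/cvgryPge => A.
exists (Num.bound `|2 * (A / (ln 3 / 4))|).+3 => //= n hn.
case: n hn => [|[|[|k]]] //; set N := Num.bound _ => hn.
have {}hn : (N%:R <= k%:R :> R) by rewrite ler_nat.
apply: le_trans (orbit_height k.+1); rewrite -ler_pdivrMr //.
apply: le_trans (lsize_ge _ _).
have h1 := real_ler_norm (num_real (2 * (A / (ln 3 / 4)))).
have h2 := archi_boundP (normr_ge0 (2 * (A / (ln 3 / 4)))).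
have := le_trans (ltW (le_lt_trans h1 h2)) hn.
by move: (A / _) (k%:R) => x y h; lra.
Qed.

End Orbit.

(** * Density of the backward orbit *)

Lemma sqrt2_irrational (a b : int) : 2 * a ^+ 2 = b ^+ 2 -> b = 0.
Proof.
move=> e; have {}e : (2 * `|a| ^ 2 = `|b| ^ 2)%N.
  by have := congr1 absz e; rewrite abszM !abszX.
apply/eqP; rewrite -absz_eq0; apply/negPn/negP; rewrite -lt0n => b0.
have a0 : (0 < `|a|)%N.
  by rewrite lt0n; apply/eqP => a0; move: e b0; rewrite a0; lia.
have := congr1 (logn 2) e; rewrite lognM ?expn_gt0 ?a0 // !lognX logn_prime //; lia.
Qed.

Section Density.
Variable R : realType.

Let s : R := Num.sqrt 2 / 2.
Let s2 : s ^+ 2 = 2^-1.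
Proof. by rewrite /s expr_div_n sqr_sqrtr //; field. Qed.
Let s0 : 0 < s. Proof. by rewrite divr_gt0 // sqrtr_gt0. Qed.
Let s1 : s < 1. Proof. by have := s0; have := s2; move: s => x; nra. Qed.

(* The recurrence for lsize has the characteristic roots 1 + s and 1 - s. *)
Lemma lsize_comb_unbounded (I J : int) (M : R) : (I != 0) || (J != 0) ->
  exists N, forall k, (N <= k)%N -> M < `|I%:~R * lsize R k + J%:~R * lsize R k.+1|.
Proof.
move=> IJ; pose D k : R := I%:~R * lsize R k + J%:~R * lsize R k.+1.
have DSS k : D k.+2 = 2 * D k.+1 - D k / 2.
  by rewrite /D !lsizeSS; field.
(* Up to the factor 2s, E0 and -F0 are the components of D along the characteristic roots 1 + s and
   1 - s. *)
pose E0 := D 1%N - (1 - s) * D 0%N; pose F0 := D 1%N - (1 + s) * D 0%N.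
have EE k : D k.+1 - (1 - s) * D k = (1 + s) ^+ k * E0.
  elim: k => [|k IH]; first by rewrite expr0 mul1r.
  rewrite exprS -mulrA -IH DSS.
  suff : s ^+ 2 * D k = D k / 2 by move: (D k.+1) (D k) => x y h; nra.
  by rewrite s2 mulrC.
have FE k : D k.+1 - (1 + s) * D k = (1 - s) ^+ k * F0.
  elim: k => [|k IH]; first by rewrite expr0 mul1r.
  rewrite exprS -mulrA -IH DSS.
  suff : s ^+ 2 * D k = D k / 2 by move: (D k.+1) (D k) => x y h; nra.
  by rewrite s2 mulrC.
(* E0 = I + J + s J, and s = 1 / sqrt 2 is irrational, so E0 = 0 would force I = J = 0. *)
have E0n : E0 != 0.
  apply/eqP; rewrite /E0 /D /= => e.
  have {}e : (I + J)%:~R = - s * J%:~R :> R by rewrite intrD; lra.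
  have e2 : 2 * (I + J) ^+ 2 = J ^+ 2.
    apply: (@intr_inj R); rewrite intrM !rmorphXn /= e exprMn sqrrN s2.
    by rewrite -[2%:~R]/(2 : R) mulrA mulfV ?mul1r // pnatr_eq0.
  have J0 := sqrt2_irrational e2; move: IJ e; rewrite J0 eqxx orbF addr0 mulr0 => /negP I0 /eqP.
  by rewrite intr_eq0.
have bern k : 1 + k%:R * s <= (1 + s) ^+ k.
  elim: k => [|k IH]; first by rewrite mul0r addr0 expr0.
  rewrite exprS; apply: (@le_trans _ _ ((1 + s) * (1 + k%:R * s))).
    by rewrite -natr1; have := mulr_ge0 (ler0n R k) (sqr_ge0 s); move: (k%:R) s => m x; nra.
  by rewrite ler_pM2l // addr_gt0.
pose B := (2 * s * `|M| + `|F0|) / (s * `|E0|).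
have sE : 0 < s * `|E0| by rewrite mulr_gt0 // normr_gt0.
exists (Num.bound `|B|) => k hk.
have Bk : B < k%:R.
  apply: (le_lt_trans (real_ler_norm (num_real B))).
  by apply: (lt_le_trans (archi_boundP (normr_ge0 B))); rewrite ler_nat.
have DE : 2 * s * D k = (1 + s) ^+ k * E0 - (1 - s) ^+ k * F0 by rewrite -EE -FE; ring.
have h1 : (1 + k%:R * s) * `|E0| <= `|(1 + s) ^+ k * E0|.
  rewrite normrM ler_pM2r ?normr_gt0 //; apply: le_trans (bern k) _; exact: ler_norm.
have h2 : `|(1 - s) ^+ k * F0| <= `|F0|.
  rewrite normrM ler_piMl // normrX exprn_ile1 // ger0_norm; have := s0; have := s1; lra.
have h3 := lerB_dist ((1 + s) ^+ k * E0) ((1 - s) ^+ k * F0).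
have nD : `|2 * s * D k| = 2 * s * `|D k| by rewrite normrM gtr0_norm // mulr_gt0.
rewrite -DE nD in h3.
move: Bk; rewrite ltr_pdivrMr // => Bk.
rewrite -/(D k); have ss : 0 < 2 * s by rewrite mulr_gt0.
rewrite -(ltr_pM2l ss); apply: lt_le_trans h3.
have h4 := real_ler_norm (num_real M); have h5 := ler_wpM2l (ltW ss) h4.
have := normr_ge0 E0; have := s0.
move: `|E0| `|F0| `|(1 + s) ^+ k * E0| `|(1 - s) ^+ k * F0| (2 * s * M) (k%:R) h1 h2 Bk h5 => *; lra.
Qed.

End Density.

Lemma absval_sum_distinct (R : realType) (w : algC -> R) (I : eqType) (r : seq I) (F : I -> algC) :
  absval w -> (forall n, w n%:R <= 1) -> uniq r -> r != [::] ->
  (forall i j, i \in r -> j \in r -> i != j -> w (F i) != w (F j)) ->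
  exists2 j, j \in r & w (\sum_(i <- r) F i) = w (F j).
Proof.
move=> hw wn; elim: r => // i r IH /= /andP[ir ur] _ Fd.
have [->|r0] := eqVneq r [::]; first by exists i; rewrite ?mem_head // big_seq1.
have [j jr e] := IH ur r0 (fun a b ha hb => Fd a b (mem_behead (s := i :: r) ha) (mem_behead (s := i :: r) hb)).
have jir : j \in i :: r by rewrite inE jr orbT.
have ij : i != j by apply: contraNneq ir => ->.
rewrite big_cons; have := Fd i j (mem_head _ _) jir ij; rewrite neq_lt => /orP[h|h].
  by exists j => //; rewrite addrC absval_dominant ?e.
by exists i; rewrite ?mem_head // absval_dominant ?e.
Qed.

Lemma eventually_all (T : eqType) (L : seq T) (P : T -> nat -> Prop) :
  (forall x, x \in L -> exists N, forall k, (N <= k)%N -> P x k) ->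
  exists N, forall x k, x \in L -> (N <= k)%N -> P x k.
Proof.
elim: L => [|x L IH] h; first by exists 0%N.
have [N hN] := IH (fun y yL => h y (mem_behead (s := x :: L) yL)).
have [M hM] := h x (mem_head _ _); exists (maxn N M) => y k.
by rewrite inE geq_max => /orP[/eqP-> /andP[_]|yL /andP[+ _]]; [exact: hM|exact: hN].
Qed.

Lemma orbit_size3 (R : realType) k : let w := extend_abs (padic_abs R 3) in
  0 < w (orbit k.+3) /\ ln (w (orbit k.+3)) = lsize R k * (ln 3 / 4).
Proof.
have [hw wn w3 w2] := padic_ext3 R.
by apply: (chain_size3 golden_sqr hw wn w3 w2 _ _ _ (leqnn k.+3)) => // j _; apply: orbit_rel.
Qed.

Lemma mdeg3 (m : 'X_{1..3}) : mdeg m = (m i0 + m i1 + m i2)%N.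
Proof.
rewrite mdegE !big_ord_recl big_ord0 addn0 addnA.
by congr (m _ + m _ + m _)%N; exact: val_inj.
Qed.

(* The monomials of a form have pairwise distinct 3-adic sizes at all but
   finitely many points of the orbit. *)
Lemma orbit_form_eq0 (R : realType) d (p : {mpoly algC[3]}) : p \is (d).-homog ->
  (forall n, eval3 p (vec (orbit n) (orbit n.+1) 1) = 0) -> p = 0.
Proof.
move=> hp p0; apply/eqP; apply: contraT => pn0.
have [hw wn w3 w2] := padic_ext3 R; set w := extend_abs _ in hw wn w3 w2.
have q0 : 0 < ln 3 / 4 :> R by rewrite divr_gt0 // ln_gt0 // ltr1n.
pose T (k : nat) (m : 'X_{1..3}) := p@_m * (orbit k.+3 ^+ m i0 * orbit k.+4 ^+ m i1).
have TE k : \sum_(m <- msupp p) T k m = 0.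
  rewrite -[RHS](p0 k.+3) /eval3 mevalE; apply: eq_bigr => m _; congr (_ * _).
  rewrite !big_ord_recl big_ord0 !mxE /= expr1n !mulr1.
  have -> : ord0 = i0 by exact: val_inj.
  by have -> : lift i0 ord0 = i1 by exact: val_inj.
have lnT : forall k m, m \in msupp p -> 0 < w (T k m) /\ ln (w (T k m)) =
    ln (w p@_m) + ((m i0)%:R * lsize R k + (m i1)%:R * lsize R k.+1) * (ln 3 / 4).
  move=> k m mp; have [h1 e1] := orbit_size3 R k; have [h2 e2] := orbit_size3 R k.+1.
  have h3 : 0 < w p@_m by rewrite absval_gt0 // -mcoeff_msupp.
  rewrite /T !absvalM // !absvalX // !mulr_gt0 ?exprn_gt0 //; split=> //.
  rewrite !lnM ?posrE ?mulr_gt0 ?exprn_gt0 // !lnXn // -[_ *+ m i0]mulr_natl -[_ *+ m i1]mulr_natl e1 e2; ring.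
pose L := [seq (m, m') | m <- msupp p, m' <- msupp p].
have [N hN] : exists N, forall x k, x \in L -> (N <= k)%N -> x.1 != x.2 -> w (T k x.1) != w (T k x.2).
  apply: eventually_all => -[m m'] /allpairsP[[a b] /= [ma mb [-> ->]]] {m m'}.
  have [->|ab] := eqVneq a b; first by exists 0%N.
  pose I : int := (a i0)%:Z - (b i0)%:Z; pose J : int := (a i1)%:Z - (b i1)%:Z.
  (* All monomials have degree d, so the exponents of x and y determine that of z. *)
  have IJ : (I != 0) || (J != 0).
    rewrite -negb_and; apply: contra ab => /andP[/eqP I0 /eqP J0].
    have e0 : a i0 = b i0 by move: I0; rewrite /I; lia.
    have e1 : a i1 = b i1 by move: J0; rewrite /J; lia.
    have hd m : m \in msupp p -> mdeg m = d by move=> mp; move/dhomogP: hp => /(_ m mp).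
    have := hd b mb; rewrite -(hd a ma) !mdeg3 e0 e1 => /addnI e2.
    by apply/eqP/mnmP; elim/ord3P.
  have [N hN] := lsize_comb_unbounded (`|ln (w p@_a) - ln (w p@_b)| / (ln 3 / 4)) IJ.
  exists N => k /hN h _; have [h1 e1] := lnT k a ma; have [h2 e2] := lnT k b mb.
  apply/eqP => e; move: h; rewrite ltr_pdivrMr // -[X in _ * X](gtr0_norm q0) -normrM distrC.
  rewrite /I /J !intrB -!pmulrn; move: e1; rewrite e e2 => e'.
  suff -> : ((a i0)%:R - (b i0)%:R) * lsize R k + ((a i1)%:R - (b i1)%:R) * lsize R k.+1 =
      (ln (w p@_b) - ln (w p@_a)) / (ln 3 / 4) by rewrite divfK ?ltxx // gt_eqF.
  by rewrite -[LHS](mulfK (lt0r_neq0 q0)); congr (_ / _); move: e' => {e e2};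
     move: (ln 3 / 4) (lsize R k) (lsize R k.+1) (ln (w _)) (ln (w _)) => *; lra.
have [||j jp] := absval_sum_distinct (F := T N) hw wn (msupp_uniq p) _ _.
- by rewrite msupp_eq0.
- by move=> m m' mp mp'; apply: (hN (m, m')) => //; apply/allpairsP; exists (m, m').
rewrite TE absval0 // => e; have [h _] := lnT N j jp.
by rewrite -e ltxx in h.
Qed.

Lemma orbit_dense (R : realType) : zdense (range orbit_pt).
Proof.
apply/seteqP; split=> // Q _ phi [[d [p hp phiE]] phi0].
rewrite phiE; suff -> : p = 0 by rewrite /eval3 meval0.
apply: (orbit_form_eq0 R hp) => n; have [lam lamP] := pt_coords.
have [l0 lE] := lamP (orbit n, orbit n.+1).
have : phi (orbit_pt n) = 0 by apply: phi0; exists n.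
rewrite phiE /orbit_pt lE (eval3Z _ _ hp) => /eqP; rewrite mulf_eq0 expf_eq0 (negbTE l0) andbF /=.
by move=> /eqP.
Qed.

Theorem theorem4p1 (R : realType) :
  (forall d p : nat, (3 <= d)%N -> prime p ->
     [/\ dynamical_degree (fdp d p) 1 (d%:R : R),
         dynamical_degree (fdp d p) 2 (2 : R) &
         coh_hyperbolic R (fdp d p) 1]) /\
  (let f := fdp 4 2 in
   let P0 : P2 := affine_point ((1 + sqrtC 3) / 2) ((1 + sqrtC 3) / 2) in
   [/\ maps_to f P0 P0,
       back f P0 &
       exists P : nat -> P2,
         [/\ P 0%N = P0,
             forall n : nat, (1 <= n)%N ->
               ~ indet f (P n) /\ maps_to f (P n) (P n.-1),
             zdense (range P) &
             (fun n : nat => height R (P n)) @ \oo --> +oo]]).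
Proof.
split=> [d p d3 pr_p|f P0].
  have c0 : p%:R ^- (d - 3) != 0 :> algC.
    by rewrite invr_eq0 expf_neq0 // pnatr_eq0 -lt0n prime_gt0.
  split; rewrite fdpE.
  - exact: (@henon_dynamical_degree R d _ d3 c0 1).
  - exact: (@henon_dynamical_degree R d _ d3 c0 2).
  exact: henon_coh_hyperbolic.
have fE : f = henon 4 2^-1 by [].
rewrite fE; split.
- exact: golden_fixed R.
- by apply: back_good => // n; apply: (orbit_pt_good R 0).
exists orbit_pt; split=> //.
- by case=> // n _; apply: orbit_maps R n.
- exact: orbit_dense R.
exact: orbit_height_cvg.
Qed.
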